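(* Every cylindrical drawing of the complete graph $K_n$ has at least $Z(n)=\frac{1}{4}\left\lfloor \frac{n}{2}\right\rfloor \left\lfloor \frac{n-1}{2}\right\rfloor \left\lfloor \frac{n-2}{2}\right\rfloor \left\lfloor \frac{n-3}{2}\right\rfloor$ crossings.
   Context: A drawing places vertices at distinct points and edges as simple arcs between their endpoints avoiding other vertices. A cylindrical drawing of a graph is a drawing in which there are two concentric circles containing all the vertices, and no edge intersects these circles except at its endvertices. *)

(* Defs.v *)
From HB Require Import structures.
From mathcomp Require Import all_boot all_order all_algebra.
From mathcomp Require Import all_classical all_reals all_analysis.

Set Implicit Arguments.
Unset Strict Implicit.
Unset Printing Implicit Defensive.

Import Order.TTheory GRing.Theory Num.Theory.
Import numFieldNormedType.Exports.

Local Open Scope classical_set_scope.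
Local Open Scope ring_scope.

Record sgraph := SGraph {
  vertex : finType;
  edges : {set {set vertex}};
  edge_card : forall e, e \in edges -> #|e| = 2%N
}.

Fact complete_edge_card (n : nat) (e : {set 'I_n}) :
  e \in [set e : {set 'I_n} | #|e| == 2%N]%SET -> #|e| = 2%N.
Proof. by rewrite inE => /eqP. Qed.

Definition complete_graph (n : nat) : sgraph :=
  SGraph (@complete_edge_card n).

(* The product topology on R * R is the usual topology of the plane; only
   [circle] below uses the Euclidean distance. *)
Definition simple_arc (R : realType) (p q : R * R) (A : set (R * R)) : Prop :=
  exists g : R -> R * R,
    [/\ {within `[0, 1], continuous g},
        set_inj `[0, 1] g,
        g 0 = p, g 1 = q & g @` `[0, 1] = A].

(* Edges are drawn as point sets, so no orientation has to be chosen; the value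
   of [curve] on vertex sets that are not edges is irrelevant. *)
Record drawing (R : realType) (G : sgraph) := Drawing {
  vpoint : vertex G -> R * R;
  curve : {set vertex G} -> set (R * R);
  vpoint_inj : injective vpoint;
  curve_arc : forall u v, [set u; v]%SET \in edges G ->
    simple_arc (vpoint u) (vpoint v) (curve [set u; v]%SET);
  curve_avoid : forall e w, e \in edges G -> w \notin e ->
    ~ curve e (vpoint w)
}.

Section Drawings.
Context {R : realType} {G : sgraph}.
Implicit Types (D : drawing R G) (e f : {set vertex G}).

Definition endvertices D e : set (R * R) := [set vpoint D w | w in [set` e]].

Definition curve_interior D e : set (R * R) := curve D e `\` endvertices D e.

(* A crossing is an unordered pair of distinct edges together with a point
   interior to both, so k edges through one point contribute k (k - 1) / 2
   crossings, and edges meeting several times contribute each meeting point.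
   The set is infinite when two edges have infinitely many common points. *)
Definition crossings D : set ({set {set vertex G}} * (R * R)) :=
  [set c | exists e f, [/\ e \in edges G, f \in edges G, e != f,
     c.1 = [set e; f]%SET &
     (curve_interior D e `&` curve_interior D f) c.2]].

Definition circle (c : R * R) (r : R) : set (R * R) :=
  [set x | (x.1 - c.1) ^+ 2 + (x.2 - c.2) ^+ 2 = r ^+ 2].

Definition cylindrical D : Prop :=
  exists (c : R * R) (r1 r2 : R),
    let C := circle c r1 `|` circle c r2 in
    [/\ 0 < r1, r1 < r2,
        forall v, C (vpoint D v) &
        forall e, e \in edges G -> curve D e `&` C `<=` endvertices D e].

End Drawings.

Local Open Scope nat_scope.

Definition Z4 (n : nat) : nat :=
  (n %/ 2) * ((n - 1) %/ 2) * ((n - 2) %/ 2) * ((n - 3) %/ 2).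

Definition Z (n : nat) : nat := Z4 n %/ 4.

(* The division by 4 is exact; for n < 3 the truncated subtractions are
   harmless, since the product vanishes anyway. *)
Lemma ZE (n : nat) : 4 * Z n = Z4 n.
Proof.
suff H : 4 %| Z4 n by rewrite mulnC divnK.
have P m : 2 %| m * (m - 1).
  case: m => [|m] //; rewrite subn1 /= dvdn2 oddM /=; by case: (odd m).
have H m : m.*2 %/ 2 = m by rewrite divn2 doubleK.
have H1 m : m.*2.+1 %/ 2 = m by rewrite divn2 /= uphalf_double.
rewrite /Z4 -(odd_double_half n); move: (n./2) => k.
case: (odd n); rewrite ?add1n ?add0n.
- rewrite H1 subn1 /= H.
  case: k => [|k]; first by rewrite !mul0n.
  have -> : k.+1.*2.+1 - 2 = k.*2.+1 by rewrite doubleS !subSS subn0.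
  have -> : k.+1.*2.+1 - 3 = k.*2 by rewrite doubleS !subSS subn0.
  have /dvdnP[a Ha] := P k.+1; rewrite subn1 /= in Ha.
  by rewrite H1 H -mulnA mulnACA Ha mulnACA dvdn_mull.
- rewrite H; case: k => [|k]; first by rewrite !mul0n.
  have -> : k.+1.*2 - 1 = k.*2.+1 by rewrite doubleS subn1.
  have -> : k.+1.*2 - 2 = k.*2 by rewrite doubleS !subSS subn0.
  case: k => [|k]; first by rewrite div0n !muln0.
  have -> : k.+2.*2 - 3 = k.*2.+1 by rewrite !doubleS !subSS subn0.
  have /dvdnP[a Ha] := P k.+2; have /dvdnP[b Hb] := P k.+1.
  rewrite subn1 /= in Ha; rewrite subn1 /= in Hb.
  by rewrite !H1 H -mulnA Ha Hb mulnACA dvdn_mull.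
Qed.

(* Main.v *)
Require Import Defs.
From mathcomp Require Import all_boot all_order all_algebra.
From mathcomp Require Import all_classical all_reals all_analysis.
From mathcomp Require Import zify ring lra.

(** Call "main" a circle carrying at least half of the vertices, and cut it at a
    point that is not a vertex.  Edges joining two vertices of one circle lie
    either in the annulus or off it; edges joining the two circles (spokes) lie in
    the annulus, and lifting them to its universal cover, a strip, gives each of
    them a winding number.  Two spokes cross at least as often as the end points
    of their lifts force them to.  Uncrossing the spokes at a vertex never
    increases these forced numbers, so every main vertex may be assumed to see the
    other circle in a cyclic shift of its cyclic order.  Similarly, an annulus
    edge between two vertices of one circle meets all spokes at the vertices on
    one of its sides, and that may be assumed to be its smaller side.

    For data normalised in this way there is an orientation of the triples of
    vertices such that in every 4-tuple the number of separations (edges with the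
    two other vertices on different sides) and the number of forced crossings of
    disjoint edges sum to at least 3.  The total number of separations is
    determined by the numbers of vertices on the left of the edges, and these are
    controlled by the shelling argument of Abrego, Aichholzer, Fernandez-Merchant,
    Ramos and Salazar: removing the main vertices one by one from the two sides of
    the cut shows that [\sum_(x, y) (K - left x y)], summed over ordered pairs of
    vertices with truncated subtraction, is at least ['C(K + 2, 3) * 3]. *)

Set Implicit Arguments.
Unset Strict Implicit.
Unset Printing Implicit Defensive.

Import Order.TTheory GRing.Theory Num.Theory.
Import numFieldNormedType.Exports.

(** * Orientations of triples and shelling *)

Section Tournament.
Variables (X : finType) (A : pred X) (r : rel X).
Hypothesis rN : forall x y, A x -> A y -> x != y -> r y x = ~~ r x y.
Hypothesis r0 : forall x, r x x = false.
Hypothesis rT : forall x y z, A x -> A y -> A z -> r x y -> r y z -> r x z.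

Definition outdeg y := \sum_(z | A z) (r y z : nat).

Lemma outdeg_mono x y : A x -> A y -> r x y -> outdeg y < outdeg x.
Proof.
move=> Ax Ay rxy; rewrite /outdeg (bigD1 y) //= [X in _ < X](bigD1 y) //= r0 rxy.
rewrite add0n add1n ltnS; apply: leq_sum => z /andP[Az _].
by case ryz: (r y z) => //; rewrite (rT Ax Ay Az rxy ryz).
Qed.

Lemma outdeg_lt x : A x -> outdeg x < #|A|.
Proof.
move=> Ax; rewrite /outdeg -sum1_card (bigD1 x) //= [X in _ < X](bigD1 x) //= r0.
by rewrite add0n add1n ltnS; apply: leq_sum => z _; case: (r x z).
Qed.

Lemma tournament_sum (f : nat -> nat) :
  \sum_(y | A y) f (outdeg y) = \sum_(i < #|A|) f i.
Proof.
have inj : {in A &, injective outdeg}.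
  move=> x y Ax Ay exy; apply/eqP; apply: contraT => nxy.
  have := rN Ax Ay nxy; case rxy: (r x y) => /= ryx.
    by have := outdeg_mono Ax Ay rxy; rewrite exy ltnn.
  by have := outdeg_mono Ay Ax ryx; rewrite exy ltnn.
have uo : uniq [seq outdeg y | y <- enum A].
  rewrite map_inj_in_uniq ?enum_uniq // => x y; rewrite !mem_enum; exact: inj.
have sub : {subset [seq outdeg y | y <- enum A] <= iota 0 #|A|}.
  by move=> i /mapP[y]; rewrite mem_enum => Ay ->; rewrite mem_iota outdeg_lt.
have sz : size (iota 0 #|A|) <= size [seq outdeg y | y <- enum A].
  by rewrite size_iota size_map cardE.
have [_ eqi] := uniq_min_size uo sub sz.
have pe : perm_eq [seq outdeg y | y <- enum A] (iota 0 #|A|).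
  by apply: uniq_perm => //; rewrite iota_uniq.
rewrite -(big_mkord xpredT) /index_iota subn0 -(perm_big _ pe) big_map.
by rewrite big_enum.
Qed.

End Tournament.

Lemma sum_trunc K N : K <= N -> \sum_(i < N) (K - i) = 'C(K.+1, 2).
Proof.
move=> KN; rewrite -(subnKC KN) big_split_ord /= [X in _ + X]big1 ?addn0; last first.
  by move=> i _; apply/eqP; rewrite subn_eq0 leq_addr.
elim: K {KN} => [|K IH]; first by rewrite big_ord0.
by rewrite big_ord_recl subn0 -[X in K.+1 + X]/(\sum_(i < K) (K - i))
  IH [in RHS]binS bin1 addnC.
Qed.

Lemma sum_below K N : K <= N -> \sum_(i < N) (i < K : nat) = K.
Proof.
move=> KN; rewrite -(subnKC KN) big_split_ord /= [X in _ + X]big1 ?addn0; last first.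
  by move=> i _; rewrite ltnNge leq_addr.
by rewrite (eq_bigr (fun=> 1)) ?sum1_card ?card_ord // => i _; rewrite ltn_ord.
Qed.

Lemma sum_above K N : K <= N -> \sum_(i < N) (N.-1 - i < K : nat) = K.
Proof.
move=> KN; rewrite (reindex_inj rev_ord_inj) /= -[RHS](sum_below KN).
by apply: eq_bigr => i _; congr nat_of_bool; have := ltn_ord i; lia.
Qed.

Lemma sum_offdiag_split (X : finType) (P Q : pred X) (x0 : X) (g : X -> X -> nat) :
  P x0 -> (forall x, Q x = P x && (x != x0)) ->
  \sum_(x | P x) \sum_(y | P y && (y != x)) g x y =
  \sum_(y | Q y) (g x0 y + g y x0) +
  \sum_(x | Q x) \sum_(y | Q y && (y != x)) g x y.
Proof.
move=> Px0 QE; rewrite (bigD1 x0) //= big_split -addnA; congr (_ + _).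
  by apply: eq_bigl => y; rewrite QE.
rewrite -big_split; apply: eq_big => [x|x /andP[Px xx0]]; first by rewrite QE.
rewrite (bigD1 x0) ?Px0 1?eq_sym //=; congr (_ + _); apply: eq_bigl => y.
by rewrite QE andbAC.
Qed.

Section Shelling.
Variables (n s : nat) (chi : 'I_n -> 'I_n -> 'I_n -> bool).
Hypothesis s_le_n : s <= n.
Hypothesis chi0 : forall x y, chi x y y = false.
Hypothesis chi_cyc : forall x y z, chi x y z = chi y z x.
Hypothesis chi_anti : forall x y z, x != y -> y != z -> x != z -> chi x z y = ~~ chi x y z.

Definition slab a b : pred 'I_n := fun x => (s <= x) || (a <= x < b).

Hypothesis chi_transL : forall j : 'I_n, j < s -> {in slab 0 j & &, transitive (chi j)}.
Hypothesis chi_transR : forall j : 'I_n, j < s -> {in slab j.+1 s & &, transitive (chi j)}.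

Definition left_count (P : pred 'I_n) x y := \sum_(z | P z) (chi x y z : nat).

Lemma chi_xyx x y : chi x y x = false.
Proof. by rewrite chi_cyc chi0. Qed.

Lemma left_countD1 (P Q : pred 'I_n) x0 x y : P x0 -> (forall x, Q x = P x && (x != x0)) ->
  left_count P x y = chi x y x0 + left_count Q x y.
Proof.
by move=> Px0 QE; rewrite /left_count (bigD1 x0) //=; congr (_ + _); apply: eq_bigl => z;
  rewrite QE.
Qed.

Lemma left_countN (Q : pred 'I_n) x y : Q y -> ~~ Q x -> x != y ->
  left_count Q x y + left_count Q y x = #|Q|.-1.
Proof.
move=> Qy Qx xy; rewrite /left_count -big_split /= -sum1_card.
rewrite (bigD1 y) //= chi0 chi_xyx add0n [in RHS](bigD1 y) //=.
apply: eq_bigr => z /andP[Qz zy]; have zx : z != x by apply: contraNneq Qx => <-.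
by rewrite -(chi_cyc z y x) -(chi_cyc z x y) (@chi_anti z x y) //; case: chi.
Qed.

Lemma left_count_sum (Q : pred 'I_n) x (f : nat -> nat) :
  ~~ Q x -> {in Q & &, transitive (chi x)} ->
  \sum_(y | Q y) f (left_count Q x y) = \sum_(i < #|Q|) f i.
Proof.
move=> Qx tr; apply: tournament_sum => [y z Qy Qz yz|y|y z w Qy Qz Qw]; last exact: tr.
  by apply: chi_anti => //; apply: contraNneq Qx => ->.
exact: chi0.
Qed.

Definition deficit K (P : pred 'I_n) :=
  \sum_(x | P x) \sum_(y | P y && (y != x)) (K - left_count P x y).

(* Pairs whose left side does not change when a is removed. *)
Definition invariant_pairs K (a : 'I_n) b :=
  \sum_(x | slab a.+1 b x) \sum_(y | slab a.+1 b y && (y != x))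
    (~~ chi x y a && (left_count (slab a b) x y < K) : nat).

Lemma card_slab a b : a <= b <= s -> #|slab a b| = n - s + (b - a).
Proof.
move=> /andP[ab bs]; rewrite -sum1_card.
rewrite (eq_bigl (fun i : 'I_n => (s <= i) || (a <= i < b))) //.
rewrite -(big_mkord (fun i => (s <= i) || (a <= i < b)) (fun=> 1)).
rewrite (big_cat_nat (n := s)) //= (big_cat_nat (n := b) (p := s)) //= (big_cat_nat (n := a)
  (p := b)) //=.
rewrite (@big_nat_cond _ _ _ 0 a) big_pred0 ?add0n; last by move=> i; lia.
rewrite (@big_nat_cond _ _ _ a b) (eq_bigl (fun i => (a <= i < b) && true)); last by move=> i;
  lia.
rewrite -big_nat_cond sum_nat_const_nat (@big_nat_cond _ _ _ b s) big_pred0 ?addn0;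
  last by move=> i; lia.
rewrite (@big_nat_cond _ _ _ s n) (eq_bigl (fun i => (s <= i < n) && true)); last by move=> i;
  lia.
by rewrite -big_nat_cond sum_nat_const_nat !muln1 addnC.
Qed.

Lemma invariant_pairs_bound K (a : 'I_n) b :
  b <= s -> K + a < b -> K.*2.+1 <= n - s + (b - a) ->
  'C(K.+1, 2) <= invariant_pairs K a b.
Proof.
elim: K b => [|K IH] [|b] //; rewrite addSn => bs Kab Kn.
have bn : b < n by apply: leq_trans s_le_n.
pose x0 := Ordinal bn.
pose P := slab a.+1 b.+1; pose Q := slab a.+1 b.
have QE x : Q x = P x && (x != x0) by rewrite /Q /P /slab -val_eqE /=; lia.
have Px0 : P x0 by rewrite /P /slab /=; lia.
rewrite /invariant_pairs -/P (sum_offdiag_split _ Px0 QE) binS bin1 addnC.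
have ax0 : a != x0 by rewrite -val_eqE /=; lia.
pose A := slab a b.
have AE x : A x = slab a b.+1 x && (x != x0) by rewrite /A /slab -val_eqE /=; lia.
have TE y z : left_count (slab a b.+1) y z = chi y z x0 + left_count A y z.
  by apply: left_countD1 AE; rewrite /slab /=; lia.
apply: leq_add; last first.
  apply: (leq_trans (IH b _ _ _)); try lia.
  apply: leq_sum => x _; apply: leq_sum => y _; rewrite -/A TE.
  by case: (chi x y a) => //=; case: (chi x y x0) => /=; lia.
(* [x0] orders [A] linearly; the K.+1 elements at the end away from [a] give
   invariant pairs. *)
have Ax0 : ~~ A x0 by rewrite /A /slab /=; lia.
have Aa : A a by rewrite /A /slab /=; lia.
have trA : {in A & &, transitive (chi x0)}.
  have A0 x : A x -> x \in slab 0 x0 by rewrite /A /slab unfold_in /=; lia.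
  by move=> y x z /A0 Ay /A0 Ax /A0 Az; apply: (chi_transL _ Ay Ax Az).
have cA : #|A| = n - s + (b - a) by rewrite card_slab; lia.
have lt_out y z : A y -> A z -> chi x0 y z -> left_count A x0 z < left_count A x0 y.
  move=> Ay Az; apply: outdeg_mono => //.
  by move=> ? ? ? ? ? ?; apply: trA.
have [La|La] := leqP K.+1 (left_count A x0 a).
- rewrite -[X in X <= _](@sum_below K.+1 #|A|); last by lia.
  rewrite -(left_count_sum (fun i => i < K.+1 : nat) Ax0 trA) (bigD1 a) //= ltnNge La add0n.
  rewrite [X in _ <= X](bigID A) /=; apply: leq_trans (leq_addr _ _).
  rewrite (eq_bigl (fun y => Q y && A y)); last first.
    by move=> y; rewrite /A /Q /slab -val_eqE /=; lia.
  apply: leq_sum => y /andP[Qy Ay]; rewrite TE chi_xyx add0n.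
  case: (chi x0 y a) (lt_out y a Ay Aa) => /= [/(_ isT)|_]; lia.
- rewrite -[X in X <= _](@sum_above K.+1 #|A|); last by lia.
  rewrite -(left_count_sum (fun i => #|A|.-1 - i < K.+1 : nat) Ax0 trA) (bigD1 a) //=.
  rewrite [X in X + _ <= _](_ : _ = 0); last by apply/eqP; rewrite eqb0; lia.
  rewrite add0n [X in _ <= X](bigID A) /=; apply: leq_trans (leq_addr _ _).
  rewrite (eq_bigl (fun y => Q y && A y)); last first.
    by move=> y; rewrite /A /Q /slab -val_eqE /=; lia.
  apply: leq_sum => y /andP[Qy Ay]; rewrite (TE y x0) chi0 add0n.
  have yx0 : y != x0 by apply: contraTneq Ay => ->.
  have := left_countN Ay Ax0; rewrite eq_sym => /(_ yx0) <-; rewrite addnC addnK.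
  have [->|ya] := eqVneq y a; first by rewrite chi_xyx /=; lia.
  have := lt_out a y Aa Ay; rewrite -(chi_cyc y).
  have := left_countN Ay Ax0; rewrite eq_sym => /(_ yx0).
  case: (chi y x0 a) => /= E; [move=> /(_ isT)|move=> _]; lia.
Qed.

Lemma deficit_bound K (a : 'I_n) :
  K + a < s -> K.*2.+2 <= n - s + (s - a) ->
  3 * 'C(K.+2, 3) <= deficit K (slab a s).
Proof.
elim: K a => [|K IH] a; first by move=> _ _; rewrite bin_small.
rewrite addSn => Ka Kn; have a1n : a.+1 < n by apply: leq_trans s_le_n; lia.
pose a1 := Ordinal a1n.
pose P := slab a s; pose Q := slab a.+1 s.
have QE x : Q x = P x && (x != a) by rewrite /Q /P /slab -val_eqE /=; lia.
have Pa : P a by rewrite /P /slab; lia.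
have Qa : ~~ Q a by rewrite QE eqxx andbF.
have cQ : #|Q| = n - s + (s - a.+1) by rewrite card_slab; lia.
have trQ : {in Q & &, transitive (chi a)} by apply: chi_transR; lia.
rewrite /deficit -/P (sum_offdiag_split _ Pa QE).
have TE y z : left_count P y z = chi y z a + left_count Q y z by apply: left_countD1.
have E1 : \sum_(y | Q y) (K.+1 - left_count P a y) = 'C(K.+2, 2).
  under eq_bigr do rewrite TE chi_xyx add0n.
  by rewrite (left_count_sum (fun i => K.+1 - i) Qa trQ) sum_trunc; lia.
have E2 : \sum_(y | Q y) (K.+1 - left_count P y a) = 'C(K.+2, 2).
  under eq_bigr => y Qy.
    have ya : a != y by apply: contraNneq Qa => ->.
    rewrite TE chi0 add0n -(addKn (left_count Q a y) (left_count Q y a)).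
    rewrite (left_countN Qy Qa ya); over.
  rewrite (left_count_sum (fun i => K.+1 - (#|Q|.-1 - i)) Qa trQ).
  rewrite (reindex_inj rev_ord_inj) /= -(@sum_trunc K.+1 #|Q|); last by lia.
  by apply: eq_bigr => i _; have := ltn_ord i; lia.
have I := @invariant_pairs_bound K.+1 a s; rewrite /invariant_pairs -/P -/Q in I.
have {}IH := IH a1; rewrite /deficit -/Q in IH.
have E3 : \sum_(x | Q x) \sum_(y | Q y && (y != x)) (K.+1 - left_count P x y) =
  \sum_(x | Q x) \sum_(y | Q y && (y != x)) (K - left_count Q x y) +
  \sum_(x | Q x) \sum_(y | Q y && (y != x)) (~~ chi x y a && (left_count P x y < K.+1) : nat).
  rewrite -big_split; apply: eq_bigr => x _; rewrite -big_split; apply: eq_bigr => y _ /=.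
  by rewrite TE; case: (chi x y a) => /=; lia.
rewrite big_split /= E1 E2 E3.
have := I ltac:(lia) ltac:(lia) ltac:(lia).
have := IH ltac:(rewrite /=; lia) ltac:(rewrite /=; lia).
by rewrite (binS K.+2 2); lia.
Qed.

End Shelling.

Section QuadSum.
Variable X : finType.
Implicit Types f g : X -> X -> X -> X -> nat.

Definition quad_sum f :=
  \sum_x \sum_y \sum_z \sum_w (if uniq [:: x; y; z; w] then f x y z w else 0).

Lemma quad_sum_swap12 f : quad_sum f = quad_sum (fun x y z w => f y x z w).
Proof.
rewrite /quad_sum exchange_big; do 4![apply: eq_bigr => ? _].
by congr (if _ then _ else _); apply: perm_uniq; apply/permP => p /=; lia.
Qed.

Lemma quad_sum_swap23 f : quad_sum f = quad_sum (fun x y z w => f x z y w).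
Proof.
rewrite /quad_sum; apply: eq_bigr => x _; rewrite exchange_big.
do 3![apply: eq_bigr => ? _].
by congr (if _ then _ else _); apply: perm_uniq; apply/permP => p /=; lia.
Qed.

Lemma quad_sum_swap34 f : quad_sum f = quad_sum (fun x y z w => f x y w z).
Proof.
rewrite /quad_sum; do 2![apply: eq_bigr => ? _]; rewrite exchange_big.
do 2![apply: eq_bigr => ? _].
by congr (if _ then _ else _); apply: perm_uniq; apply/permP => p /=; lia.
Qed.

Lemma quad_sumD f g : quad_sum (fun x y z w => f x y z w + g x y z w) = quad_sum f + quad_sum g.
Proof.
rewrite /quad_sum; do 3![rewrite -big_split; apply: eq_bigr => ? _].
by rewrite -big_split; apply: eq_bigr => ? _ /=; case: ifP.
Qed.

Lemma quad_sum_le f g :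
  (forall x y z w, uniq [:: x; y; z; w] -> f x y z w <= g x y z w) -> quad_sum f <= quad_sum g.
Proof.
by move=> fg; do 4![apply: leq_sum => ? _]; case: ifP => // /fg.
Qed.

Lemma card_neq2 (x y : X) : x != y -> #|[pred z | (z != x) && (z != y)]| = #|X| - 2.
Proof.
move=> xy; have := cardC (pred2 x y); rewrite card2 xy => <-.
by rewrite addKn; apply: eq_card => z; rewrite !inE negb_or.
Qed.

Lemma card_neq3 (x y z : X) : x != y -> x != z -> y != z ->
  #|[pred w | [&& w != x, w != y & w != z]]| = #|X| - 3.
Proof.
move=> xy xz yz; have := cardD1 z [pred w | (w != x) && (w != y)].
rewrite card_neq2 // inE (eq_sym z x) (eq_sym z y) xz yz add1n => E.
rewrite -[RHS]/(#|X| - (2 + 1)) subnDA E subn1 /=; apply: eq_card => w.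
by rewrite !inE; case: (w != x); case: (w != y); case: (w != z).
Qed.

Lemma quad_sumE f : quad_sum f = \sum_x \sum_(y | y != x)
  \sum_(z | (z != x) && (z != y)) \sum_(w | [&& w != x, w != y & w != z]) f x y z w.
Proof.
rewrite /quad_sum; apply: eq_bigr => x _; rewrite [RHS]big_mkcond; apply: eq_bigr => y _ /=.
case: eqVneq => [->|yx] /=.
  by rewrite big1 // => z _; rewrite big1 // => w _; rewrite inE eqxx.
rewrite [RHS]big_mkcond; apply: eq_bigr => z _; case: ifP => [/andP[zx zy]|nz].
  rewrite [RHS]big_mkcond; apply: eq_bigr => w _; congr (if _ then _ else _).
  by rewrite !inE (eq_sym x y) (eq_sym x z) (eq_sym x w) (eq_sym y z) (eq_sym y w)
    (eq_sym z w); lia.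
rewrite big1 // => w _; rewrite !inE; rewrite (eq_sym x z) (eq_sym y z).
by case: ifP => //; lia.
Qed.

Lemma quad_sum1 : quad_sum (fun _ _ _ _ => 1) = #|X| * (#|X| - 1) * (#|X| - 2) * (#|X| - 3).
Proof.
rewrite quad_sumE -!mulnA -sum_nat_const; apply: eq_bigr => x _.
rewrite subn1 -(cardC1 x) -sum_nat_const; apply: eq_big => [y|y yx]; first by rewrite !inE.
rewrite -(@card_neq2 x y) 1?eq_sym //.
rewrite -sum_nat_const; apply: eq_big => // z /andP[zx zy].
by rewrite sum1_card -(@card_neq3 x y z) 1?eq_sym // eq_sym.
Qed.

Lemma sum_separated (P : pred X) (a : X -> bool) :
  \sum_(z | P z) \sum_(w | P w && (w != z)) (a z != a w : nat) =
  2 * (\sum_(z | P z) a z) * (\sum_(z | P z) ~~ a z).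
Proof.
have -> : \sum_(z | P z) \sum_(w | P w && (w != z)) (a z != a w : nat) =
  \sum_(z | P z) \sum_(w | P w) (a z * ~~ a w + ~~ a z * a w).
  apply: eq_bigr => z Pz; rewrite [RHS](bigD1 z) //= [a z * _ + _](_ : _ = 0) ?add0n.
    by apply: eq_bigr => w _; case: (a z) (a w) => [] [].
  by case: (a z).
under eq_bigr do rewrite big_split -!big_distrr /=.
rewrite big_split -!big_distrl /=; lia.
Qed.

End QuadSum.

Lemma sum_triangle M l : 2 * \sum_(K < M) (K - l) = (M - l) * (M - l).-1.
Proof.
elim: M => [|M IH]; first by rewrite big_ord0.
by rewrite big_ord_recr mulnDr IH /=; case: (leqP l M) => lM; nia.
Qed.

Lemma sum_bin3 M : \sum_(K < M) 'C(K.+2, 3) = 'C(M.+2, 4).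
Proof. by elim: M => [|M IH]; rewrite ?big_ord0 // big_ord_recr IH /= [in RHS]binS addnC. Qed.

Lemma bin3E M : 6 * 'C(M.+2, 3) = M.+2 * M.+1 * M.
Proof. by rewrite mulnC (bin_ffact M.+2 3) !ffactnS ffactn0 /=; lia. Qed.

Lemma bin4E M : 24 * 'C(M.+2, 4) = M.+2 * M.+1 * M * M.-1.
Proof. by rewrite mulnC (bin_ffact M.+2 4) !ffactnS ffactn0 /=; lia. Qed.

Lemma Z_even M : 4 * Z M.*2.+2 = M.+1 * M * M * M.-1.
Proof.
rewrite ZE /Z4.
have -> : M.*2.+2 %/ 2 = M.+1 by lia.
have -> : (M.*2.+2 - 1) %/ 2 = M by lia.
have -> : (M.*2.+2 - 2) %/ 2 = M by lia.
by have -> : (M.*2.+2 - 3) %/ 2 = M.-1 by lia.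
Qed.

Lemma Z_odd M : 4 * Z M.*2.+3 = M.+1 * M.+1 * M * M.
Proof.
rewrite ZE /Z4.
have -> : M.*2.+3 %/ 2 = M.+1 by lia.
have -> : (M.*2.+3 - 1) %/ 2 = M.+1 by lia.
have -> : (M.*2.+3 - 2) %/ 2 = M by lia.
by have -> : (M.*2.+3 - 3) %/ 2 = M by lia.
Qed.

Definition separates (T : Type) (chi : T -> T -> T -> bool) x y z w : nat :=
  chi x y z != chi x y w.

Definition separations (T : Type) (chi : T -> T -> T -> bool) x y z w :=
  separates chi x y z w + separates chi x z y w + separates chi x w y z +
  separates chi y z x w + separates chi y w x z + separates chi z w x y.

Section CrossingCount.
Variables (n s : nat) (chi : 'I_n -> 'I_n -> 'I_n -> bool).
Variable c : 'I_n -> 'I_n -> 'I_n -> 'I_n -> nat.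
Hypothesis s_le_n : s <= n.
Hypothesis n_le_2s : n <= s.*2.
Hypothesis chi0 : forall x y, chi x y y = false.
Hypothesis chi_cyc : forall x y z, chi x y z = chi y z x.
Hypothesis chi_anti : forall x y z, x != y -> y != z -> x != z -> chi x z y = ~~ chi x y z.
Hypothesis chi_transL : forall j : 'I_n, j < s -> {in slab s 0 j & &, transitive (chi j)}.
Hypothesis chi_transR : forall j : 'I_n, j < s -> {in slab s j.+1 s & &, transitive (chi j)}.

Hypothesis four_points : forall x y z w, uniq [:: x; y; z; w] ->
  3 <= separations chi x y z w + (c x y z w + c x z y w + c x w y z).

Local Notation left := (left_count chi predT).
Definition sep_sum := \sum_x \sum_(y | y != x) left x y * left y x.

Lemma left_predC1 x y z : x = y \/ x = z -> left y z = left_count chi (predC1 x) y z.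
Proof.
move=> xyz; rewrite (@left_countD1 _ _ predT (predC1 x) x) //.
by case: xyz => <-; rewrite ?(chi_xyx chi0 chi_cyc) ?chi0.
Qed.

Lemma leftN x y : y != x -> left x y + left y x = n - 2.
Proof.
move=> yx; rewrite !(@left_predC1 x); [|by right|by left].
rewrite (left_countN chi0 chi_cyc chi_anti) //; last by rewrite eq_sym.
  by rewrite cardC1 card_ord; lia.
by rewrite /= eqxx.
Qed.

Lemma quad_sum_separates : quad_sum (separates chi) = 2 * sep_sum.
Proof.
rewrite quad_sumE /sep_sum big_distrr; apply: eq_bigr => x _.
rewrite big_distrr; apply: eq_bigr => y yx.
pose P := [pred z | (z != x) && (z != y)].
transitivity (\sum_(z | P z) \sum_(w | P w && (w != z)) (chi x y z != chi x y w : nat)).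
  by apply: eq_bigr => z _; apply: eq_bigl => w; rewrite /= andbA.
rewrite sum_separated -mulnA /=; congr (_ * (_ * _)).
  rewrite /left_count [RHS](bigD1 x) //= [X in _ = _ + X](bigD1 y) //= (chi_xyx chi0 chi_cyc)
    chi0.
  by rewrite !add0n.
rewrite /left_count [RHS](bigD1 x) //= [X in _ = _ + X](bigD1 y)
  //= chi0 (chi_xyx chi0 chi_cyc) !add0n.
apply: eq_bigr => z /andP[zx zy].
rewrite -(chi_cyc z) -(chi_cyc z y x) (@chi_anti z x y) //.
  by rewrite eq_sym.
Qed.

Lemma quad_sum_bound : n * (n - 1) * (n - 2) * (n - 3) <= 4 * sep_sum + quad_sum c.
Proof.
have /quad_sum_le := four_points.
rewrite !quad_sumD.
have E3 : quad_sum (fun _ _ _ _ : 'I_n => 3) = 3 * (n * (n - 1) * (n - 2) * (n - 3)).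
  have := quad_sum1 'I_n; rewrite card_ord => <-.
  by rewrite !mulSn mul0n addn0 -!quad_sumD.
have c2 : quad_sum (fun x y z w => c x z y w) = quad_sum c by rewrite [RHS]quad_sum_swap23.
have c3 : quad_sum (fun x y z w => c x w y z) = quad_sum c.
  by rewrite quad_sum_swap34 -[RHS]c2.
have s2 : quad_sum (fun x y z w => separates chi x z y w) = quad_sum (separates chi).
  by rewrite [RHS]quad_sum_swap23.
have s3 : quad_sum (fun x y z w => separates chi x w y z) = quad_sum (separates chi).
  by rewrite quad_sum_swap34 -[RHS]s2.
have s4 : quad_sum (fun x y z w => separates chi y z x w) = quad_sum (separates chi).
  by rewrite quad_sum_swap12 -[RHS]s2.
have s5 : quad_sum (fun x y z w => separates chi y w x z) = quad_sum (separates chi).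
  by rewrite quad_sum_swap12 -[RHS]s3.
have s6 : quad_sum (fun x y z w => separates chi z w x y) = quad_sum (separates chi).
  by rewrite quad_sum_swap23 -[RHS]s5.
by rewrite E3 c2 c3 s2 s3 s4 s5 s6 quad_sum_separates; lia.
Qed.

Lemma left_right_bound M r l : 2 <= n -> l + r = n - 2 -> M = (n - 2)./2 ->
  l * r + 2 * \sum_(K < M) ((K - l) + (K - r)) +
    (1 + odd n) * ((M - l) + (M - r)) <= M * (n - 2 - M).
Proof.
move=> n2 lr ME; rewrite big_split /= (mulnDr 2) !sum_triangle.
wlog lr' : l r lr / l <= r.
  by move=> W; case: (leqP l r) => [|/ltnW] /W H; [|rewrite mulnC addnC in lr *];
    have := H ltac:(lia); lia.
have [d E] : exists d, l + d = M by exists (M - l); lia.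
have -> : M - l = d by lia.
have -> : M - r = 0 by lia.
case: (boolP (odd n)) => on; [have -> : r = M.+1 + d by lia|have -> : r = M + d by lia];
  rewrite -E; [have -> : n - 2 = (l + d).*2.+1 by lia|have -> : n - 2 = (l + d).*2 by lia];
  case: d {E} => [|d] /=; nia.
Qed.

Lemma sep_sum_bound M : 2 <= n -> M = (n - 2)./2 ->
  sep_sum + 12 * 'C(M.+2, 4) + 6 * (1 + odd n) * 'C(M.+2, 3) <= n * (n - 1) * (M * (n - 2 - M)).
Proof.
move=> n2 ME; have n0 : 0 < n by lia.
pose F K := \sum_x \sum_(y | y != x) (K - left x y).
have FE K : F K = \sum_x \sum_(y | y != x) (K - left y x).
  rewrite /F [LHS](exchange_big_dep predT) //=.
  by apply: eq_bigr => x _; apply: eq_bigl => y; rewrite eq_sym.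
have Fb K : K <= M -> 3 * 'C(K.+2, 3) <= F K.
  move=> KM; have /= := @deficit_bound n s chi s_le_n chi0 chi_cyc chi_anti
    chi_transL chi_transR K (Ordinal n0).
  move=> /(_ ltac:(lia) ltac:(lia)) /leq_trans; apply.
  rewrite /deficit (eq_bigl xpredT); last by move=> x; rewrite /slab /=; lia.
  apply: leq_sum => x _; rewrite (eq_bigl (fun y => y != x)); last first.
    by move=> y; rewrite /slab /=; case: eqP; lia.
  apply: leq_sum => y _; rewrite /left_count (eq_bigl xpredT) //.
  by move=> z; rewrite /slab /=; lia.
have T : sep_sum + 2 * (\sum_(K < M) (F K + F K)) + (1 + odd n) * (F M + F M) <=
    n * (n - 1) * (M * (n - 2 - M)).
  have E : \sum_(K < M) (F K + F K) =
      \sum_x \sum_(y | y != x) \sum_(K < M) ((K - left x y) + (K - left y x)).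
    rewrite (eq_bigr (fun K : 'I_M => \sum_x \sum_(y | y != x) ((K - left x y)
      + (K - left y x)))).
      rewrite exchange_big; apply: eq_bigr => x _.
      by rewrite exchange_big.
    move=> K _; rewrite {2}FE -big_split; apply: eq_bigr => x _.
    by rewrite -big_split.
  have E' : F M + F M = \sum_x \sum_(y | y != x) ((M - left x y) + (M - left y x)).
    by rewrite {2}FE -big_split; apply: eq_bigr => x _; rewrite -big_split.
  rewrite E E' /sep_sum !big_distrr -!big_split -mulnA -[X in X * _](card_ord n) -sum_nat_const.
  apply: leq_sum => x _; rewrite !big_distrr -!big_split /=.
  rewrite -[X in X - 1](card_ord n) subn1 -(cardC1 x) -sum_nat_const.
  rewrite [X in _ <= X](eq_bigl (fun y => y != x)) //.
  by apply: leq_sum => y yx; apply: left_right_bound => //; apply: leftN.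
have S4 : \sum_(K < M) 3 * 'C(K.+2, 3) <= \sum_(K < M) F K.
  by apply: leq_sum => K _; apply: Fb; apply: ltnW.
rewrite -big_distrr sum_bin3 /= in S4.
have := Fb M (leqnn _); rewrite big_split /= in T; nia.
Qed.

Theorem crossing_count : 8 * Z n <= quad_sum c.
Proof.
have Z_small m : m < 2 -> Z m = 0 by case: m => [|[|]].
have [/Z_small -> //|n2] := ltnP n 2.
have B := quad_sum_bound; have [M ME] : exists M, M = (n - 2)./2 by eexists.
have A := sep_sum_bound n2 ME.
have b3 := bin3E M; have b4 := bin4E M.
have [on|on] := boolP (odd n); rewrite ?on ?(negbTE on) in A.
  have nE : n = M.*2.+3 by lia.
  have := Z_odd M; rewrite -nE; move: A B b3 b4; move: (quad_sum c) sep_sum 'C(M.+2, 3)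
    'C(M.+2, 4) (Z n).
  move=> q S C3 C4 z A B b3 b4 zE.
  have {}A : S + 12 * C4 + 12 * C3 <= M.*2.+3 * M.*2.+2 * (M * M.+1).
    rewrite -[6 * _]/12 in A; apply: leq_trans A _; rewrite nE.
    by have -> : M.*2.+3 - 2 - M = M.+1 by lia.
  have {}B : M.*2.+3 * M.*2.+2 * M.*2.+1 * M.*2 <= 4 * S + q.
    by apply: leq_trans B; rewrite nE !subSS !subn0.
  by clear -A B b3 b4 zE; case: M A B b3 b4 zE => [|M] /= A B b3 b4 zE; nia.
have nE : n = M.*2.+2 by lia.
have := Z_even M; rewrite -nE; move: A B b3 b4; move: (quad_sum c) sep_sum 'C(M.+2, 3)
  'C(M.+2, 4) (Z n).
move=> q S C3 C4 z A B b3 b4 zE.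
have {}A : S + 12 * C4 + 6 * C3 <= M.*2.+2 * M.*2.+1 * (M * M).
  rewrite -[6 * _]/6 in A; apply: leq_trans A _; rewrite nE.
  by have -> : M.*2.+2 - 2 - M = M by lia.
have {}B : M.*2.+2 * M.*2.+1 * M.*2 * M.*2.-1 <= 4 * S + q.
  by apply: leq_trans B; rewrite nE !subSS !subn0 -subn1.
by clear -A B b3 b4 zE; case: M A B b3 b4 zE => [|M] /= A B b3 b4 zE; nia.
Qed.

End CrossingCount.

(** * Normalised cylindrical data *)

Section Alternating.
Variable F : nat -> nat -> nat -> bool.

Definition alternate x y z :=
  if x < y then
    if y < z then F x y z
    else if x < z then (z < y) && ~~ F x z y else (z < x) && F z x y
  else (y < x) &&
    if x < z then ~~ F y x z
    else if y < z then (z < x) && F y z x else (z < y) && ~~ F z y x.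

Lemma alternate0 x y : alternate x y y = false.
Proof. by rewrite /alternate ltnn; case: (ltngtP x y). Qed.

Lemma alternate_cyc x y z : alternate x y z = alternate y z x.
Proof.
by rewrite /alternate; case: (ltngtP x y) => ?; case: (ltngtP y z) => ?;
  case: (ltngtP x z) => ? //; exfalso; lia.
Qed.

Lemma alternate_anti x y z : x != y -> y != z -> x != z ->
  alternate x z y = ~~ alternate x y z.
Proof.
rewrite /alternate; case: (ltngtP x y) => ? //; case: (ltngtP y z) => ? //;
  case: (ltngtP x z) => ? // _ _ _; rewrite ?negbK //=; exfalso; lia.
Qed.

Lemma alternateE x y z : x < y -> y < z ->
  ((alternate x y z = F x y z) * (alternate y z x = F x y z) * (alternate z x y = F x y z)) *
  ((alternate x z y = ~~ F x y z) * (alternate z y x = ~~ F x y z) *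
   (alternate y x z = ~~ F x y z)).
Proof.
move=> xy yz; have xz := ltn_trans xy yz.
have E : alternate x y z = F x y z by rewrite /alternate xy yz.
have E' : alternate x z y = ~~ F x y z by rewrite -E alternate_anti // neq_ltn ?xy ?yz ?xz.
by do 3?split; rewrite // ?E ?E' // alternate_cyc ?E ?E' // alternate_cyc ?E ?E'.
Qed.
End Alternating.

Lemma sort4 (P : nat -> nat -> nat -> nat -> bool) :
  (forall x y z w, P x y z w = P y x z w) ->
  (forall x y z w, P x y z w = P x z y w) ->
  (forall x y z w, P x y z w = P x y w z) ->
  (forall x y z w, x < y -> y < z -> z < w -> P x y z w) ->
  forall x y z w, uniq [:: x; y; z; w] -> P x y z w.
Proof.
move=> s12 s23 s34 Ps.
have P3 x y z w : x < y -> x < z -> x < w -> y != z -> y != w -> z != w -> P x y z w.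
  move=> xy xz xw.
  case: (ltngtP y z) => yz // _; case: (ltngtP y w) => yw // _; case: (ltngtP z w) => zw // _;
  do 4?[by apply: Ps | rewrite s23; by apply: Ps | rewrite s34; by apply: Ps
    | rewrite s34 s23; by apply: Ps | rewrite s23 s34; by apply: Ps
    | rewrite s23 s34 s23; by apply: Ps]; by exfalso; lia.
move=> x y z w /=; rewrite !inE !negb_or andbT => /and3P[/and3P[xy xz xw] /andP[yz yw] zw].
case: (ltngtP x y) xy => // xy _; case: (ltngtP x z) xz => // xz _;
case: (ltngtP x w) xw => // xw _; case: (ltngtP y z) yz => // yz _;
case: (ltngtP y w) yw => // yw _; case: (ltngtP z w) zw => // zw _;
first [by exfalso; lia
 | by apply: P3; lia | by rewrite s12; apply: P3; lia | by rewrite s23 s12; apply: P3; lia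
 | by rewrite s34 s23 s12; apply: P3; lia].
Qed.

(* The main vertices are [0, ..., s - 1], the other ones [s, ..., n - 1], both
   numbered by increasing angle; [ann i j] says that the edge joining the vertices
   [i] and [j] of one circle lies in the annulus, and [w v u] is the number of full
   turns of the spoke from [v] to [u]. *)
Section Cylinder.
Variables (n s : nat) (ann : nat -> nat -> bool) (w : nat -> nat -> int).

Definition class_size j := if j < s then s else n - s.

(* An annulus edge [ij] separates from the other circle either the vertices
   between [i] and [j] or the remaining ones; we pretend that it is the smaller
   of these two sets. *)
Definition cuts_outside i j := ann i j && (class_size j < (j - i).*2).
Definition cuts_between i j := ann i j && ((j - i).*2 <= class_size j).
Definition covers i j k :=
  (cuts_between i j && (i < k < j)) || (cuts_outside i j && ((k < i) || (j < k))).

(* Meant as the orientation of the triangle [abc] seen from the cut point. *)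
Definition sorted_orientation a b c :=
  if c < s then ~~ ann a c
  else if b < s then cuts_outside a b
  else if a < s then (w a b <= w a c)%R
  else cuts_outside a b (+) cuts_between a c (+) cuts_outside b c.

Definition orientation := alternate sorted_orientation.

(* For lifts starting at main vertices [v < v'] and ending at [u] and [u'] after [a]
   and [b] turns: the number of integers [k] such that translating the first lift by
   [k] turns reverses the order of the end points strictly. *)
Definition spoke_crossings u (a : int) u' (b : int) : nat :=
  if u == u' then (if (0 < b - a)%R then absz (b - a - 1)%R else absz (b - a)%R)
  else absz (b - a - Posz (u' < u))%R.

Definition pair_crossings i j k l : nat :=
  if i < s then
    if j < s then
      if k < s then
        if l < s then nat_of_bool (((i < k < j) && (j < l) || (k < i < l) && (l < j))
          && (ann i j == ann k l))
        else nat_of_bool (covers i j k)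
      else 0
    else if k < s then
      if l < s then nat_of_bool (covers k l i)
      else if i < k then spoke_crossings j (w i j) l (w k l)
      else if k < i then spoke_crossings l (w k l) j (w i j) else 0
    else nat_of_bool (covers k l j)
  else if k < s then
    if l < s then 0 else nat_of_bool (covers i j l)
  else nat_of_bool (((i < k < j) && (j < l) || (k < i < l) && (l < j)) && (ann i j == ann k l)).

Definition edge_crossings x y z t :=
  pair_crossings (minn x y) (maxn x y) (minn z t) (maxn z t).

Lemma edge_crossingsC x y z t : edge_crossings x y z t = edge_crossings y x z t.
Proof. by rewrite /edge_crossings minnC maxnC. Qed.

Lemma edge_crossingsCr x y z t : edge_crossings x y z t = edge_crossings x y t z.
Proof. by rewrite /edge_crossings (minnC z) (maxnC z). Qed.

Lemma pair_crossingsC i j k l : i < j -> k < l ->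
  pair_crossings i j k l = pair_crossings k l i j.
Proof.
move=> ij kl; rewrite /pair_crossings.
case: (ltnP i s) => iS; case: (ltnP j s) => jS; case: (ltnP k s) => kS; case: (ltnP l s)
  => lS //;
 try (by exfalso; lia); try by (case: (ann i j); case: (ann k l); congr nat_of_bool; lia).
by case: (ltngtP i k).
Qed.

Lemma edge_crossings_swap x y z t : x != y -> z != t ->
  edge_crossings x y z t = edge_crossings z t x y.
Proof. by move=> xy zt; apply: pair_crossingsC; lia. Qed.

Hypothesis w_row : forall v u u', v < s -> s <= u -> u < u' -> u' < n ->
  (w v u - 1 <= w v u' <= w v u)%R.

Lemma cuts_betweenE i j : cuts_between i j = ann i j && ~~ cuts_outside i j.
Proof. by rewrite /cuts_between /cuts_outside; case: ann => //=; rewrite -leqNgt. Qed.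

Lemma covers_in i k j : i < k -> k < j -> covers i j k = cuts_between i j.
Proof.
by move=> ik kj; rewrite /covers ik kj !ltnNge (ltnW ik) (ltnW kj) /= andbT andbF orbF.
Qed.

Lemma covers_out i j k : (k < i) || (j < k) -> i < j -> covers i j k = cuts_outside i j.
Proof.
move=> out ij; rewrite /covers out andbT; case: (cuts_between i j) => //=;
  case: (cuts_outside i j); lia.
Qed.

Lemma separations_sorted F a b c d : a < b -> b < c -> c < d ->
  separations (alternate F) a b c d =
    (F a b c != F a b d) + (F a b c == F a c d) + (F a b d != F a c d) +
    (F a b c != F b c d) + (F a b d == F b c d) + (F a c d != F b c d).
Proof.
move=> ab bc cd; rewrite /separations /separates.
have [ac bd ad] : [/\ a < c, b < d & a < d] by split; lia.
rewrite !(alternateE F ab bc, alternateE F ab bd, alternateE F ac cd, alternateE F bc cd).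
by case: (F a b c); case: (F a b d); case: (F a c d); case: (F b c d).
Qed.

Lemma four_points_sorted a b c d : a < b -> b < c -> c < d -> d < n ->
  3 <= separations orientation a b c d +
    (edge_crossings a b c d + edge_crossings a c b d + edge_crossings a d b c).
Proof.
move=> ab bc cd dn; rewrite separations_sorted //=.
have [ac bd ad] : [/\ a < c, b < d & a < d] by split; lia.
have mE x y : x < y -> (minn x y = x) * (maxn x y = y) by move=> xy; split; lia.
rewrite /edge_crossings !(mE a b, mE c d, mE a c, mE b d, mE a d, mE b c) //.
suff : (sorted_orientation a b c (+) sorted_orientation a b d (+)
  sorted_orientation a c d (+) sorted_orientation b c d = false) ->
  0 < pair_crossings a b c d + pair_crossings a c b d + pair_crossings a d b c.
  move: (pair_crossings _ _ _ _) (pair_crossings _ _ _ _) (pair_crossings _ _ _ _) => x y z.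
  move: (sorted_orientation a b c) (sorted_orientation a b d).
  move: (sorted_orientation a c d) (sorted_orientation b c d) => p q r t.
  by case: p; case: q; case: r; case: t => /= H; try have {}H := H erefl; lia.
rewrite /sorted_orientation /pair_crossings.
case: (ltnP d s) => dS.
  have -> : c < s by lia. have -> : b < s by lia. have -> : a < s by lia.
  rewrite ab bc cd ac bd /=.
  by case: (ann a c); case: (ann b d); case: (ann a d) => //=; lia.
case: (ltnP c s) => cS.
  have -> : b < s by lia. have -> : a < s by lia.
  rewrite (@covers_out a b c) ?cd ?bc ?orbT // (covers_in ab bc) (@covers_out b c a) ?ab //.
  rewrite cuts_betweenE; have : cuts_outside a c -> ann a c by case/andP.
  by case: (ann a c); case: (cuts_outside a b); case: (cuts_outside a c);
    case: (cuts_outside b c) => //= /(_ isT).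
case: (ltnP b s) => bS.
  have -> : a < s by lia.
  rewrite ab addbb /spoke_crossings (gtn_eqF cd) (ltn_eqF cd) cd [d < c]ltnNge (ltnW cd) /=.
  move: (w a c) (w a d) (w b c) (w b d) => p q r t; clear; lia.
case: (ltnP a s) => aS.
  rewrite (@covers_out c d b) ?bc // (covers_in bc cd) (@covers_out b c d) ?cd ?orbT //.
  have H1 := w_row aS bS bc ltac:(lia); have H2 := w_row aS bS bd dn.
  have H3 := w_row aS cS cd dn.
  have -> : (w a b <= w a c)%R (+) (w a b <= w a d)%R (+) (w a c <= w a d)%R by lia.
  by case: (cuts_outside b c); case: (cuts_between b d); case: (cuts_outside c d).
have P i j : cuts_outside i j (+) cuts_between i j = ann i j.
  by rewrite cuts_betweenE /cuts_outside; case: ann => //=; case: ltnP.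
rewrite ab bc cd ac bd /= => H; have -> : ann a c == ann b d.
  rewrite -(P a c) -(P b d); move: H.
  case: (cuts_outside a b); case: (cuts_outside a c); case: (cuts_outside a d);
    case: (cuts_outside b c); case: (cuts_outside b d);
    case: (cuts_outside c d); case: (cuts_between a c); case: (cuts_between a d);
      by case: (cuts_between b d).
by rewrite !addn_gt0 orbT.
Qed.

Lemma orientation_left j x y : j < s -> x < j \/ s <= x -> y < j \/ s <= y ->
  orientation j x y =
    (x != y) &&
    (if x < j then
      if y < j then (if x < y then ~~ ann x j else ann y j) else ~~ cuts_outside x j
    else if y < j then cuts_outside y j
    else if x < y then (w j x <= w j y)%R else (w j x < w j y)%R).
Proof.
move=> js hx hy; rewrite /orientation.
case: (eqVneq x y) => [<-|xy]; first by rewrite alternate0.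
case: (ltnP x j) => xj; case: (ltnP y j) => yj /=.
- case: (ltngtP x y) xy => // xy _.
    by rewrite (alternateE _ xy yj) /sorted_orientation js.
  by rewrite (alternateE _ xy xj) /sorted_orientation js negbK.
- have sy : s <= y by lia.
  by rewrite (alternateE _ xj (leq_trans js sy)) /sorted_orientation js ltnNge sy.
- have sx : s <= x by lia.
  by rewrite (alternateE _ yj (leq_trans js sx)) /sorted_orientation js ltnNge sx.
- have [sx sy] : s <= x /\ s <= y by lia.
  case: (ltngtP x y) xy => // xy _.
    by rewrite (alternateE _ (leq_trans js sx) xy) /sorted_orientation js !ltnNge sx sy.
  rewrite (alternateE _ (leq_trans js sy) xy) /sorted_orientation js !(ltnNge _ s) sx sy /=.
  by rewrite ltNge.
Qed.

Lemma orientation_right j x y : j < s -> j < x -> j < y ->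
  orientation j x y =
    (x != y) &&
    (if x < s then
      if y < s then (if x < y then ~~ ann j y else ann j x) else cuts_outside j x
    else if y < s then ~~ cuts_outside j y
    else if x < y then (w j x <= w j y)%R else (w j x < w j y)%R).
Proof.
move=> js jx jy; rewrite /orientation.
case: (eqVneq x y) => [<-|xy]; first by rewrite alternate0.
case: (ltnP x s) => xs; case: (ltnP y s) => ys /=.
- case: (ltngtP x y) xy => // xy _.
    by rewrite (alternateE _ jx xy) /sorted_orientation ys.
  by rewrite (alternateE _ jy xy) /sorted_orientation xs negbK.
- have xy' : x < y by lia.
  by rewrite (alternateE _ jx xy') /sorted_orientation xs ltnNge ys.
- have xy' : y < x by lia.
  by rewrite (alternateE _ jy xy') /sorted_orientation ys ltnNge xs.
- case: (ltngtP x y) xy => // xy _.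
    by rewrite (alternateE _ jx xy) /sorted_orientation js !ltnNge xs ys.
  rewrite (alternateE _ jy xy) /sorted_orientation js !(ltnNge _ s) xs ys /=.
  by rewrite ltNge.
Qed.

Lemma orientation_asym j x y : j != x -> j != y -> orientation j x y -> orientation j y x ->
  False.
Proof.
move=> jx jy; have [<-|xy] := eqVneq x y; first by rewrite /orientation alternate0.
by rewrite /orientation [alternate _ j y x]alternate_anti // => ->.
Qed.

Lemma transitive_left j x y z : j < s -> x < j \/ s <= x -> y < j \/ s <= y ->
  z < j \/ s <= z ->
  orientation j x y -> orientation j y z -> orientation j x z.
Proof.
move=> js hx hy hz; have [<-|xz] := eqVneq x z.
  by move=> oxy oyx; case: (@orientation_asym j x y); rewrite // neq_ltn; lia.
rewrite !orientation_left // xz /cuts_outside /class_size js /=.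
case: (ltnP x j) => xj; case: (ltnP y j) => yj; case: (ltnP z j) => zj;
  case: (ltngtP x y) => // xy; case: (ltngtP y z) => // yz; case: (ltngtP x z) xz => // xz _ /=;
  rewrite ?andbT ?andbF //;
  try (by case: (ann x j); case: (ann y j); case: (ann z j) => //=; lia);
  try lia.
Qed.

Lemma transitive_right j x y z : j < s -> j < x -> j < y -> j < z ->
  orientation j x y -> orientation j y z -> orientation j x z.
Proof.
move=> js jx jy jz; have [<-|xz] := eqVneq x z.
  by move=> oxy oyx; case: (@orientation_asym j x y); rewrite // neq_ltn ?jx ?jy.
rewrite !orientation_right // xz /cuts_outside /class_size.
case: (ltnP x s) => xs; case: (ltnP y s) => ys; case: (ltnP z s) => zs;
  case: (ltngtP x y) => // xy; case: (ltngtP y z) => // yz; case: (ltngtP x z) xz => // xz _ /=;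
  rewrite ?andbT ?andbF //;
  try (by case: (ann j x); case: (ann j y); case: (ann j z) => //=; lia);
  lia.
Qed.

End Cylinder.

Section Smoothing.
Local Open Scope ring_scope.
Local Notation sc := spoke_crossings.

Lemma smooth_far_l (a b u : nat) (x y c : int) : a != b -> u != a -> u != b ->
  1 + Posz (b < a)%N <= y - x ->
  (sc a (x + 1) u c + sc b (y - 1) u c <= sc a x u c + sc b y u c)%N.
Proof.
by rewrite /sc => ab ua ub; rewrite !(eq_sym _ u) (negbTE ua) (negbTE ub); lia.
Qed.

Lemma smooth_far_r (a b u : nat) (x y c : int) : a != b -> u != a -> u != b ->
  1 + Posz (b < a)%N <= y - x ->
  (sc u c a (x + 1) + sc u c b (y - 1) <= sc u c a x + sc u c b y)%N.
Proof.
by rewrite /sc => ab ua ub; rewrite (negbTE ua) (negbTE ub); lia.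
Qed.

Lemma smooth_near_l (a b : nat) (x y c d : int) : a != b ->
  1 + Posz (b < a)%N <= y - x ->
  (sc a (x + 1)%R a c + sc b (y - 1)%R a c + (sc a (x + 1)%R b d + sc b (y - 1)%R b d) <=
   sc a x a c + sc b y a c + (sc a x b d + sc b y b d))%N.
Proof.
rewrite /sc => ab; rewrite !eqxx !(eq_sym b) !(negbTE ab).
by case: ifP; case: ifP; case: ifP; case: ifP; case: ltngtP ab => //= ab _; lia.
Qed.

Lemma smooth_near_r (a b : nat) (x y c d : int) : a != b ->
  1 + Posz (b < a)%N <= y - x ->
  (sc a c a (x + 1)%R + sc a c b (y - 1)%R + (sc b d a (x + 1)%R + sc b d b (y - 1)%R) <=
   sc a c a x + sc a c b y + (sc b d a x + sc b d b y))%N.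
Proof.
rewrite /sc => ab; rewrite !eqxx !(eq_sym b) !(negbTE ab).
by case: ifP; case: ifP; case: ifP; case: ifP; case: ltngtP ab => //= ab _; lia.
Qed.
End Smoothing.

Lemma sum_smooth (I : finType) (P : pred I) (a b : I) (f g : I -> I -> nat) :
  P a -> P b -> a != b ->
  (forall u v, u != a -> u != b -> f u v = g u v) ->
  (forall v, v != a -> v != b -> f a v + f b v <= g a v + g b v) ->
  f a a + f b a + (f a b + f b b) <= g a a + g b a + (g a b + g b b) ->
  \sum_(u | P u) \sum_(v | P v) f u v <= \sum_(u | P u) \sum_(v | P v) g u v.
Proof.
move=> Pa Pb ab fg le2 le4; rewrite exchange_big [X in _ <= X]exchange_big /=.
have ba : P b && (b != a) by rewrite Pb eq_sym.
pose R (h : I -> I -> nat) v := \sum_(u | P u && (u != a) && (u != b)) h u v.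
have split2 h v : \sum_(u | P u) h u v = h a v + h b v + R h v.
  by rewrite (bigD1 a) // (bigD1 b) //= addnA.
have RE v : R f v = R g v by apply: eq_bigr => u /andP[/andP[_ ua] ub]; apply: fg.
under eq_bigr do rewrite split2 RE; under [X in _ <= X]eq_bigr do rewrite split2.
rewrite !big_split /= leq_add2r -!big_split /=.
rewrite (bigD1 a) // (bigD1 b) //= [X in _ <= X](bigD1 a) // [X in _ <= _ + X](bigD1 b) //=.
rewrite !addnA in le4 *; apply: leq_add; first by rewrite -!addnA in le4 *.
by apply: leq_sum => v /andP[/andP[_ va] vb]; apply: le2.
Qed.

Section RowNormalization.
Variables n s : nat.
Local Open Scope ring_scope.
Implicit Types r : nat -> int.

Definition row_crossings r r' : nat :=
  (\sum_(u < n | (s <= u)%N) \sum_(v < n | (s <= v)%N) spoke_crossings u (r u) v (r' v))%N.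

(* Exchanges the tails of the spokes to [a] and [b] at a crossing of their lifts. *)
Definition smooth r (a b u : nat) :=
  if u == a then r a + 1 else if u == b then r b - 1 else r u.

Lemma row_smooth r (a b : 'I_n) : (s <= a)%N -> (s <= b)%N -> a != b ->
  1 + Posz (b < a)%N <= r b - r a ->
  forall r', (row_crossings (smooth r a b) r' <= row_crossings r r')%N /\
    (row_crossings r' (smooth r a b) <= row_crossings r' r)%N.
Proof.
move=> sa sb ab rab r'; have ba : (b == a :> nat) = false by apply/negbTE; rewrite eq_sym.
have nE (u v : 'I_n) : u != v -> (u == v :> nat) = false by move/negbTE.
split; last rewrite /row_crossings exchange_big [X in (_ <= X)%N]exchange_big /=;
  apply: (@sum_smooth _ _ a b) => //= [u v ua ub|v va vb|];
  rewrite /smooth ?eqxx ?ba.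
- by rewrite !nE.
- exact: smooth_far_l.
- exact: smooth_near_l.
- by rewrite !nE.
- exact: smooth_far_r.
- exact: smooth_near_r.
Qed.

(* [r u * n + u] is the position of the end of the lift, so smoothing brings two of
   these numbers closer to each other without changing their sum. *)
Definition row_energy r : nat :=
  (\sum_(u < n | (s <= u)%N) absz (r u * Posz n + Posz u)%R ^ 2)%N.

Lemma abszsq (z : int) : Posz (absz z ^ 2)%N = z * z.
Proof. by rewrite -abszX gez0_abs ?sqr_ge0 // expr2. Qed.

Lemma row_energy_smooth r (a b : 'I_n) : (s <= a)%N -> (s <= b)%N -> a != b ->
  1 + Posz (b < a)%N <= r b - r a -> (row_energy (smooth r a b) < row_energy r)%N.
Proof.
move=> sa sb ab rab; have ba : (b == a :> nat) = false by apply/negbTE; rewrite eq_sym.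
rewrite /row_energy (bigD1 a) // (bigD1 b) /=; last by rewrite sb eq_sym.
rewrite [X in (_ < X)%N](bigD1 a) // [X in (_ < _ + X)%N](bigD1 b) /=;
  last by rewrite sb eq_sym.
rewrite !addnA (eq_bigr (fun u : 'I_n => absz (r u * Posz n + Posz u)%R ^ 2)%N); last first.
  move=> u /andP[/andP[_ ua] ub].
  by rewrite /smooth -[u == a :> nat]/(u == a) -[u == b :> nat]/(u == b) (negbTE ua)
    (negbTE ub).
rewrite ltn_add2r /smooth eqxx ba eqxx.
have := ltn_ord a; have := ltn_ord b; move: (r a) (r b) rab => x y rab bn an.
rewrite -ltz_nat !PoszD !abszsq.
have K : (x + 1) * Posz n + Posz a < y * Posz n + Posz b.
  have : (x + 1) * Posz n <= (y - Posz (b < a)%N) * Posz n by rewrite ler_wpM2r //; lia.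
  have : a != b :> nat by [].
  rewrite mulrBl; case: (ltngtP b a) => //= ba' _; lia.
have N0 : 0 < Posz n by lia.
rewrite !mulrDl !mulNr !mul1r in K *; rewrite -subr_gt0.
set X := x * Posz n in K *; set Y := y * Posz n in K *; set N := Posz n in K N0 *.
have : 0 < N * (Y + Posz b - (X + N + Posz a)) by rewrite mulr_gt0 // subr_gt0.
by lia.
Qed.

Lemma row_normalize r : exists r' : nat -> int,
  (forall u v, (s <= u)%N -> (u < v)%N -> (v < n)%N -> r' u - 1 <= r' v <= r' u) /\
  forall q, (row_crossings r' q <= row_crossings r q)%N /\
    (row_crossings q r' <= row_crossings q r)%N.
Proof.
have [m] := ubnP (row_energy r); elim: m r => // m IH r /ltnSE le_m.
have [/existsP[a /existsP[b /and4P[sa sb ab rab]]]|none] := boolP [exists a : 'I_n,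
  exists b : 'I_n,
    [&& (s <= a)%N, (s <= b)%N, a != b & 1 + Posz (b < a)%N <= r b - r a]].
  have [r' [r'n r'le]] := IH _ (leq_trans (row_energy_smooth sa sb ab rab) le_m).
  exists r'; split => // q; have [le1 le2] := row_smooth sa sb ab rab q.
  have [le3 le4] := r'le q.
  by split; [apply: leq_trans le1|apply: leq_trans le2].
exists r; split => // u v su uv vn; have un := ltn_trans uv vn.
have H (a b : 'I_n) : (s <= a)%N -> (s <= b)%N -> a != b ->
  ~~ (1 + Posz (b < a)%N <= r b - r a).
  move=> sa sb ab; apply: contra none => rab; apply/existsP; exists a; apply/existsP; exists b.
  by rewrite sa sb ab.
have H1 := H (Ordinal un) (Ordinal vn) su (leq_trans su (ltnW uv)).
have H2 := H (Ordinal vn) (Ordinal un) (leq_trans su (ltnW uv)) su.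
move: H1 H2; rewrite -!val_eqE /= uv ltnNge (ltnW uv) /=.
have -> : u != v by lia. have -> : v != u by lia.
by move=> /(_ isT) + /(_ isT); lia.
Qed.
End RowNormalization.

Section NormalForm.
Variables (n s : nat) (ann : nat -> nat -> bool) (w : nat -> nat -> int).
Hypothesis s_le_n : s <= n.
Hypothesis n_le_2s : n <= s.*2.
Hypothesis w_row : forall v u u', v < s -> s <= u -> u < u' -> u' < n ->
  (w v u - 1 <= w v u' <= w v u)%R.

Local Notation crossings := (edge_crossings n s ann w).

Lemma four_points_all x y z t : uniq [:: x; y; z; t] -> x < n -> y < n -> z < n -> t < n ->
  3 <= separations (orientation n s ann w) x y z t +
    (crossings x y z t + crossings x z y t + crossings x t y z).
Proof.
pose c := crossings; pose f := orientation n s ann w.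
have cC x' y' z' t' : c x' y' z' t' = c y' x' z' t' by apply: edge_crossingsC.
have cCr x' y' z' t' : c x' y' z' t' = c x' y' t' z' by apply: edge_crossingsCr.
have fN x' y' z' : x' != y' -> y' != z' -> x' != z' -> f y' x' z' = ~~ f x' y' z'.
  by move=> *; rewrite /f /orientation alternate_cyc alternate_anti.
have sN x' y' z' t' : uniq [:: x'; y'; z'; t'] ->
  separates f y' x' z' t' = separates f x' y' z' t'.
  rewrite /= !inE !negb_or => /and4P[/and3P[xy xz xt] /andP[yz yt] _ _].
  by rewrite /separates (fN x' y' z') ?(fN x' y' t') //; case: (f x' y' z'); case: (f x' y' t').
have sC x' y' z' t' : separates f x' y' t' z' = separates f x' y' z' t'.
  by rewrite /separates eq_sym.
pose P x y z t := [&& uniq [:: x; y; z; t], x < n, y < n, z < n & t < n] ==>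
  (3 <= separations f x y z t + (c x y z t + c x z y t + c x t y z)).
suff H : forall x y z t, uniq [:: x; y; z; t] -> P x y z t.
  by move=> U X Y T S; have /implyP := H _ _ _ _ U; apply; rewrite U X Y T S.
move=> {x y z t}.
have uE a1 b1 c1 d1 a2 b2 c2 d2 : perm_eq [:: a1; b1; c1; d1] [:: a2; b2; c2; d2] ->
  uniq [:: a1; b1; c1; d1] -> uniq [:: a2; b2; c2; d2].
  by move=> /perm_uniq ->.
have pE (a b c' d a' b' c1 d' : nat) : (forall p : pred nat,
    p a + (p b + (p c' + (p d + 0))) = p a' + (p b' + (p c1 + (p d' + 0)))) ->
    perm_eq [:: a; b; c'; d] [:: a'; b'; c1; d'].
  by move=> H; apply/permP => p; apply: H.
have cS x' y' z' t' : x' != y' -> z' != t' -> c x' y' z' t' = c z' t' x' y'.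
  by apply: edge_crossings_swap.
have PE x y z t x' y' z' t' : perm_eq [:: x; y; z; t] [:: x'; y'; z'; t'] ->
   (uniq [:: x; y; z; t] -> separations f x y z t = separations f x' y' z' t') ->
   (uniq [:: x; y; z; t] -> c x y z t + c x z y t + c x t y z = c x' y' z' t' + c x' z' y' t' + c x' t' y' z') ->
   P x y z t = P x' y' z' t'.
  move=> pe se ce; rewrite /P (perm_uniq pe).
  have -> : [&& x < n, y < n, z < n & t < n] = [&& x' < n, y' < n, z' < n & t' < n].
    by have := perm_all (fun i => i < n) pe; rewrite /= !andbT.
  case: (boolP (uniq [:: x'; y'; z'; t'])) => [U|_]; last by [].
  by rewrite -(perm_uniq pe) in U; rewrite se ?ce.
apply: (sort4 (P := P)); last first.
- move=> x y z t xy yz zt; apply/implyP => /and5P[_ _ _ _ tn].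
  exact: four_points_sorted.
- move=> x y z t; apply: PE => [|U|U]; first by apply: pE => p; lia.
    rewrite /separations (sC x y z t) (sN z t x y) ?(sC z t x y); first by lia.
    by apply: uE U; apply: pE => p; lia.
  by rewrite (cCr x y t z); lia.
- move=> x y z t; apply: PE => [|U|U]; first by apply: pE => p; lia.
    rewrite /separations (sC x t y z) (sN y z x t); first by lia.
    by apply: uE U; apply: pE => p; lia.
  by rewrite (cCr x t z y); lia.
move=> x y z t; apply: PE => [|U|U]; first by apply: pE => p; lia.
  by rewrite /separations (sN x y z t) // (sC z t x y); lia.
move: U; rewrite /= !inE !negb_or => /and4P[/and3P[xy xz xt] /andP[yz yt] zt _].
rewrite -(cC x y z t) (cS y z x t) // (cS y t x z) //.
by lia.
Qed.

Theorem normal_form_count :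
  8 * Z n <= quad_sum (fun x y z t : 'I_n => crossings x y z t).
Proof.
apply: (@crossing_count n s (fun x y z : 'I_n => orientation n s ann w x y z)) => //.
- by move=> x y; apply: alternate0.
- by move=> x y z; apply: alternate_cyc.
- by move=> x y z; apply: alternate_anti.
- move=> j js y x z; rewrite !unfold_in /slab => hy hx hz.
  by apply: transitive_left => //; lia.
- move=> j js y x z; rewrite !unfold_in /slab => hy hx hz.
  by apply: transitive_right => //; lia.
by move=> x y z t xyzt; apply: four_points_all.
Qed.

End NormalForm.

Lemma sum_sym_pairs n (f : 'I_n -> 'I_n -> nat) : (forall x y, f x y = f y x) ->
  \sum_x \sum_(y | x != y) f x y = 2 * \sum_(e : 'I_n * 'I_n | e.1 < e.2) f e.1 e.2.
Proof.
move=> fC; rewrite -(pair_big_dep xpredT (fun i j : 'I_n => i < j) f) /=.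
have -> : \sum_x \sum_(y | x != y) f x y =
  \sum_(x < n) (\sum_(y : 'I_n | x < y) f x y + \sum_(y : 'I_n | y < x) f x y).
  apply: eq_bigr => x _; rewrite (bigID (fun y : 'I_n => x < y)) /=.
  by congr (_ + _); apply: eq_bigl => y; rewrite -val_eqE /=; lia.
rewrite big_split /= [X in _ + X](exchange_big_dep xpredT) //= mulSn mul1n; congr (_ + _).
by apply: eq_bigr => x _; apply: eq_bigr => y _.
Qed.

Section Count.
Variables (n s : nat) (ann : nat -> nat -> bool).
Hypothesis s_le_n : s <= n.

Lemma quad_sum_edge_crossings w :
  quad_sum (fun x y z t : 'I_n => edge_crossings n s ann w x y z t) <=
  4 * \sum_(e : 'I_n * 'I_n | e.1 < e.2) \sum_(f : 'I_n * 'I_n | f.1 < f.2)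
    pair_crossings n s ann w e.1 e.2 f.1 f.2.
Proof.
pose c (x y z t : 'I_n) := edge_crossings n s ann w x y z t.
apply: (@leq_trans (\sum_x \sum_(y | x != y) \sum_z \sum_(t | z != t) c x y z t)).
  apply: leq_sum => x _; rewrite [X in _ <= X]big_mkcond; apply: leq_sum => y _.
  case: eqVneq => [<-|xy] /=.
    by rewrite big1 // => z _; rewrite big1 // => t _; rewrite inE eqxx.
  apply: leq_sum => z _; rewrite [X in _ <= X]big_mkcond; apply: leq_sum => t _.
  case: (eqVneq z t) => [<-|zt]; case: ifP => //.
  by rewrite /= [z \in [:: z]]inE eqxx !andbF.
have E x y : \sum_z \sum_(t | z != t) c x y z t = 2 * \sum_(e : 'I_n * 'I_n | e.1 < e.2)
  c x y e.1 e.2.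
  by apply: sum_sym_pairs => z t; apply: edge_crossingsCr.
under eq_bigr => x _ do under eq_bigr => y _ do rewrite E.
rewrite (sum_sym_pairs (f := fun x y => 2 * \sum_(e : 'I_n * 'I_n | e.1 < e.2) c x y e.1 e.2)).
  rewrite -big_distrr mulnA leq_mul2l /=; apply: leq_sum => e e12; apply: leq_sum => f f12.
  rewrite /c /edge_crossings.
  by rewrite (minn_idPl (ltnW e12)) (maxn_idPr (ltnW e12)) (minn_idPl (ltnW f12))
    (maxn_idPr (ltnW f12)).
by move=> x y; congr (2 * _); apply: eq_bigr => e _; apply: edge_crossingsC.
Qed.

Lemma card_interval a b : b <= n -> #|[pred k : 'I_n | a <= k < b]| = b - a.
Proof.
move=> bn; rewrite -sum1_card (eq_bigl (fun k : 'I_n => a <= k < b)) //.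
rewrite -(big_mkord (fun k => a <= k < b) (fun=> 1)) -[RHS]muln1 -sum_nat_const_nat.
rewrite (@big_nat_widenl _ _ _ a 0) // (@big_nat_widen _ _ _ 0 b n) //.
Qed.

Definition inside i j : pred 'I_n := fun k => i < k < j.
Definition outside lo hi i j : pred 'I_n := fun k => (lo <= k < i) || (j < k < hi).

Lemma card_inside i j : j <= n -> #|inside i j| = j - i.+1.
Proof. by move=> jn; rewrite -(card_interval _ jn); apply: eq_card. Qed.

Lemma card_outside lo hi i j : lo <= i -> i < j -> j < hi -> hi <= n ->
  #|outside lo hi i j| = hi - lo - (j - i).+1.
Proof.
move=> li ij jh hn.
have := cardUI [pred k : 'I_n | lo <= k < i] [pred k : 'I_n | j.+1 <= k < hi].
rewrite [X in _ + X]eq_card0 ?addn0; last by move=> k; rewrite !inE; lia.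
rewrite !card_interval //; last by lia.
by rewrite (@eq_card _ _ (outside lo hi i j)) => [->|//]; lia.
Qed.

Lemma sum_positive (K U C : pred 'I_n) (y : 'I_n -> 'I_n -> nat) :
  (forall k, C k -> K k) -> (forall k u, C k -> U u -> 0 < y k u) ->
  #|C| * #|U| <= \sum_(k | K k) \sum_(u | U u) y k u.
Proof.
move=> CK y0; rewrite -sum_nat_const [X in _ <= X](bigID C) /=; apply: leq_trans (leq_addr _ _).
rewrite [X in _ <= X](eq_bigl C); last by move=> k; case Ck: (C k); rewrite ?andbF // CK.
by apply: leq_sum => k Ck; rewrite -sum1_card; apply: leq_sum => u Uu; apply: y0.
Qed.

Lemma covers_sum lo hi i j (U : pred 'I_n) (y : 'I_n -> 'I_n -> nat) :
  lo <= i -> i < j -> j < hi -> hi <= n -> class_size n s j = hi - lo -> ann i j ->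
  (forall k k' u u', inside i j k -> outside lo hi i j k' -> U u -> U u' ->
    0 < y k u + y k' u') ->
  \sum_(k : 'I_n | lo <= k < hi) \sum_(u | U u) (covers n s ann i j k : nat) <=
  \sum_(k : 'I_n | lo <= k < hi) \sum_(u | U u) y k u.
Proof.
move=> li ij jh hn size_j ann_ij y0.
have jn := leq_trans (ltnW jh) hn.
set C := if cuts_between n s ann i j then inside i j else outside lo hi i j.
have cC : #|C| <= #|inside i j| /\ #|C| <= #|outside lo hi i j|.
  rewrite /C /cuts_between ann_ij size_j card_outside // card_inside //.
  by case: ifP => cut_ij; rewrite ?card_outside ?card_inside //; split; lia.
have -> : \sum_(k : 'I_n | lo <= k < hi) \sum_(u | U u) (covers n s ann i j k : nat)
  = #|C| * #|U|.
  rewrite (eq_bigr (fun k => (C k : nat) * #|U|)); last first.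
    move=> k /andP[lk kh]; rewrite sum_nat_const mulnC; congr (nat_of_bool _ * _).
    rewrite /covers /C cuts_betweenE /cuts_outside ann_ij /=.
    case: ltnP => _ /=; rewrite /inside /outside ?orbF //; lia.
  rewrite -big_distrl; congr (_ * _); rewrite -sum1_card big_mkcond [in RHS]big_mkcond /=.
  apply: eq_bigr => k _; rewrite -[k \in C]/(C k).
  have : C k -> lo <= k < hi by rewrite /C; case: ifP => _; rewrite /inside /outside; lia.
  by case: (C k) => [->|_] //; case: ifP.
have [none|] := boolP [forall k, forall u, inside i j k && U u ==> (0 < y k u)].
  apply: (@leq_trans (#|inside i j| * #|U|)); first by rewrite leq_mul2r cC.1 orbT.
  apply: sum_positive => [k|k u ik Uu]; first by rewrite /inside; lia.
  by have /forallP/(_ k)/forallP/(_ u)/implyP := none; rewrite ik Uu; apply.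
rewrite negb_forall => /existsP[k]; rewrite negb_forall => /existsP[u].
rewrite negb_imply lt0n negbK => /andP[/andP[ik Uu] /eqP yku].
apply: (@leq_trans (#|outside lo hi i j| * #|U|)); first by rewrite leq_mul2r cC.2 orbT.
apply: sum_positive => [k'|k' u' ok' Uu']; first by rewrite /outside; lia.
by have := y0 _ _ _ _ ik ok' Uu Uu'; rewrite yku.
Qed.

End Count.

Lemma sum_split_sym (P : finType) (E S : pred P) (g : P -> P -> nat) :
  (forall e f, E e -> E f -> g e f = g f e) ->
  \sum_(e | E e) \sum_(f | E f) g e f =
  \sum_(e | E e && ~~ S e) \sum_(f | E f && ~~ S f) g e f +
  2 * (\sum_(e | E e && ~~ S e) \sum_(f | E f && S f) g e f) +
  \sum_(e | E e && S e) \sum_(f | E f && S f) g e f.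
Proof.
move=> gC; rewrite (bigID S) /=.
rewrite (eq_bigr (fun e => \sum_(f | E f && S f) g e f + \sum_(f | E f && ~~ S f) g e f));
  last first.
  by move=> e _; rewrite (bigID S).
rewrite [X in _ + X](eq_bigr (fun e => \sum_(f | E f && S f) g e f + \sum_(f | E f && ~~ S f)
  g e f)); last first.
  by move=> e _; rewrite (bigID S).
rewrite !big_split /=.
have -> : \sum_(e | E e && S e) \sum_(f | E f && ~~ S f) g e f =
    \sum_(e | E e && ~~ S e) \sum_(f | E f && S f) g e f.
  rewrite exchange_big; apply: eq_bigr => e /andP[Ee _]; apply: eq_bigr => f /andP[Ef _].
  exact: gC.
lia.
Qed.

Section CylindricalCount.
Variables (n s : nat) (ann : nat -> nat -> bool) (w : nat -> nat -> int).
Variable x : nat -> nat -> nat -> nat -> nat.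
Hypothesis s_le_n : s <= n.
Hypothesis n_le_2s : n <= s.*2.
Hypothesis xC : forall i j k l, x i j k l = x k l i j.
Hypothesis same_side : forall a b c d, a < b -> b < c -> c < d -> d < n ->
  (d < s) || (s <= a) -> ann a c = ann b d -> 0 < x a c b d.
Hypothesis separated_main : forall a b c d u v, a < c -> c < b -> b < s -> d < s ->
  (d < a) || (b < d) -> s <= u < n -> s <= v < n -> ann a b -> 0 < x a b c u + x a b d v.
Hypothesis separated_other : forall a b c d u v, s <= a -> a < c -> c < b -> b < n ->
  s <= d < n ->
  (d < a) || (b < d) -> u < s -> v < s -> ann a b -> 0 < x a b u c + x a b v d.
Hypothesis spokes : forall u v a b, u < v -> v < s -> s <= a < n -> s <= b < n ->
  spoke_crossings a (w u a) b (w v b) <= x u a v b.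

Local Notation edge := ('I_n * 'I_n)%type.

Definition is_spoke (e : edge) := e.1 < s <= e.2.
Definition distinct_crossings (e f : edge) := if f == e then 0 else x e.1 e.2 f.1 f.2.

Theorem cylindrical_count :
  2 * Z n <= \sum_(e : edge | e.1 < e.2) \sum_(f : edge | f.1 < f.2) distinct_crossings e f.
Proof.
have [w' w'P] := choice (fun v => row_normalize n s (w v)).
have w'_row v u u' : v < s -> s <= u -> u < u' -> u' < n -> (w' v u - 1 <= w' v u' <= w' v u)%R.
  by move=> _; apply: (w'P v).1.
pose pc (e f : edge) := pair_crossings n s ann w' e.1 e.2 f.1 f.2.
suff : \sum_(e : edge | e.1 < e.2) \sum_(f : edge | f.1 < f.2) pc e f <=
    \sum_(e : edge | e.1 < e.2) \sum_(f : edge | f.1 < f.2) distinct_crossings e f.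
  apply: leq_trans; rewrite -(@leq_pmul2l 4) // mulnA.
  apply: leq_trans (normal_form_count ann s_le_n n_le_2s w'_row) _.
  exact: quad_sum_edge_crossings.
rewrite (sum_split_sym is_spoke); last by move=> e f ee ff; apply: pair_crossingsC.
rewrite [X in _ <= X](sum_split_sym is_spoke); last first.
  by move=> e f _ _; rewrite /distinct_crossings eq_sym xC.
have nest (h : 'I_n -> 'I_n -> nat) :
    \sum_(f : edge | (f.1 < f.2) && is_spoke f) h f.1 f.2 =
    \sum_(k : 'I_n | 0 <= k < s) \sum_(u : 'I_n | s <= u) h k u.
  by rewrite pair_big; apply: eq_bigl => -[k u]; rewrite /is_spoke /=; lia.
apply: leq_add; [apply: leq_add; last rewrite leq_mul2l /=|].
- apply: leq_sum => -[i j] /andP[/= ij ijS]; apply: leq_sum => -[k l] /andP[/= kl klS].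
  have jn := ltn_ord j; have ln := ltn_ord l.
  have H : (j < s) && (l < s) || (s <= i) && (s <= k) ->
     nat_of_bool (((i < k < j) && (j < l) || (k < i < l) && (l < j)) && (ann i j == ann k l)) <=
     distinct_crossings (i, j) (k, l).
    move=> same; case: (boolP (_ && _)) => // /andP[inter /eqP annE].
    rewrite /distinct_crossings xpair_eqE -!val_eqE /= ifN; last by lia.
    case/orP: inter => /andP[/andP[h1 h2] h3]; last rewrite xC; apply: same_side => //; lia.
  move: ijS klS; rewrite /is_spoke /= => ijS klS; rewrite /pc /pair_crossings /=.
  case: (ltnP i s) => iS; case: (ltnP k s) => kS; last by apply: H; lia.
  + have -> : j < s by lia. have -> : l < s by lia. by apply: H; lia.
  + by have -> : j < s by lia.
  + by have -> : l < s by lia.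
- apply: leq_sum => -[i j] /andP[/= ij ijS]; have jn := ltn_ord j.
  rewrite [X in _ <= X](eq_bigr (fun f : edge => x i j f.1 f.2)); last first.
    move=> f /andP[_ fS]; rewrite /distinct_crossings ifN //.
    by apply: contraNneq ijS => <-.
  rewrite (nest (fun k l => pair_crossings n s ann w' i j k l)) (nest (fun k l => x i j k l)).
  move: ijS; rewrite /is_spoke /= => ijS.
  have noncover k : ~~ ann i j -> covers n s ann i j k = false.
    by rewrite /covers /cuts_between /cuts_outside => /negbTE ->.
  case: (ltnP i s) => iS.
    have jS : j < s by lia.
    rewrite (eq_bigr (fun k : 'I_n => \sum_(u : 'I_n | s <= u) (covers n s ann i j k : nat)));
      last first.
      move=> k /= kS; apply: eq_bigr => u su.
      by rewrite /pair_crossings iS jS kS ltnNge su.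
    case: (boolP (ann i j)) => [annij|/noncover none]; last first.
      by rewrite big1 // => k _; rewrite big1 // => u _; rewrite none.
    apply: (@covers_sum n s ann s_le_n 0 s i j (fun u => s <= u) (fun k u => x i j k u))
      => //; first by rewrite /class_size jS subn0.
    move=> k k' u u' /andP[ik kj] out su su'; apply: separated_main => //; move: out;
      by rewrite /outside ?su ?su' ?ltn_ord //; lia.
  have sj : s <= j by lia.
  rewrite exchange_big [X in _ <= X]exchange_big /=.
  rewrite (eq_bigr (fun u : 'I_n => \sum_(k : 'I_n | k < s) (covers n s ann i j u : nat)));
    last first.
    move=> u su; apply: eq_bigr => k kS.
    by rewrite /pair_crossings !ltnNge iS sj -!ltnNge kS ltnNge su.
  case: (boolP (ann i j)) => [annij|/noncover none]; last first.
    by rewrite big1 // => k _; rewrite big1 // => u _; rewrite none.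
  have K (h : 'I_n -> 'I_n -> nat) : \sum_(u < n | s <= u) \sum_(k < n | k < s) h u k =
      \sum_(u < n | s <= u < n) \sum_(k < n | k < s) h u k.
    by apply: eq_bigl => u; rewrite ltn_ord andbT.
  rewrite !K; apply: (@covers_sum n s ann s_le_n s n i j (fun k => k < s) (fun u k =>
    x i j k u)) => //.
    by rewrite /class_size ltnNge sj.
  move=> u u' k k' /andP[iu uj] out kS kS'; apply: separated_other => //; move: out;
    by rewrite /outside ?ltn_ord ?andbT //; lia.
have nest2 (h : 'I_n -> 'I_n -> 'I_n -> 'I_n -> nat) :
    \sum_(e : edge | (e.1 < e.2) && is_spoke e) \sum_(f : edge | (f.1 < f.2) && is_spoke f)
      h e.1 e.2 f.1 f.2 =
    \sum_(u : 'I_n | 0 <= u < s) \sum_(v : 'I_n | 0 <= v < s)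
      \sum_(a : 'I_n | s <= a) \sum_(b : 'I_n | s <= b) h u a v b.
  rewrite (eq_bigr (fun e : edge => \sum_(v : 'I_n | 0 <= v < s) \sum_(b : 'I_n | s <= b)
    h e.1 e.2 v b)).
    rewrite (nest (fun u a => \sum_(v : 'I_n | 0 <= v < s) \sum_(b : 'I_n | s <= b) h u a v b)).
    by apply: eq_bigr => u _; rewrite exchange_big.
  by move=> e _; rewrite -(nest (fun v b => h e.1 e.2 v b)).
rewrite (nest2 (fun u a v b => pair_crossings n s ann w' u a v b)).
rewrite (nest2 (fun u a v b => distinct_crossings (u, a) (v, b))).
apply: leq_sum => u /= us; apply: leq_sum => v /= vs.
have ltsn (a : 'I_n) : s <= a -> a < s = false by move=> sa; rewrite ltnNge sa.
have row_le (u' v' : 'I_n) : u' < v' -> v' < s ->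
  row_crossings n s (w' u') (w' v') <=
  \sum_(a : 'I_n | s <= a) \sum_(b : 'I_n | s <= b) x u' a v' b.
  move=> uv vs'; apply: leq_trans (proj1 ((w'P u').2 _)) _.
  apply: leq_trans (proj2 ((w'P v').2 _)) _.
  apply: leq_sum => a sa; apply: leq_sum => b sb.
  by apply: spokes; rewrite ?sa ?sb ?ltn_ord.
case: (ltngtP u v) => uv.
- apply: leq_trans (leq_trans _ (row_le u v uv vs)) _.
    apply: leq_sum => a sa; apply: leq_sum => b sb.
    by rewrite /pair_crossings us vs !ltsn // uv.
  apply: leq_sum => a sa; apply: leq_sum => b sb.
  by rewrite /distinct_crossings xpair_eqE -!val_eqE /= ifN //; lia.
- apply: leq_trans (leq_trans _ (row_le v u uv us)) _.
    rewrite [X in _ <= X]exchange_big /=.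
    apply: leq_sum => a sa; apply: leq_sum => b sb.
    by rewrite /pair_crossings us vs !ltsn // uv ltnNge (ltnW uv).
  rewrite exchange_big; apply: leq_sum => a sa; apply: leq_sum => b sb.
  by rewrite /distinct_crossings xpair_eqE -!val_eqE /= ifN; [rewrite (xC v)|lia].
rewrite big1 // => a sa; rewrite big1 // => b sb.
by rewrite /pair_crossings us vs !ltsn // uv !ltnn.
Qed.

End CylindricalCount.

(** * Crossing paths in the plane *)

Section GridParity.
Local Open Scope classical_set_scope.
Local Open Scope ring_scope.
Variable R : realType.

(* The crossings of the negative real axis count, modulo 2, the turns of the vector
   [(x, y)] around the origin; along the boundary of a grid cell on which the vector
   stays away from 0 and moves little, they are even in number. *)
Definition ray_crossing (x y y' : R) := ((0 <= y) != (0 <= y')) && (x < 0).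
Definition on_ray (x y : R) := (0 <= y) && (x < 0).

Lemma same_sign (e x x' : R) : e <= `|x| -> e <= `|x'| -> `|x - x'| < e -> (x < 0) = (x' < 0).
Proof.
rewrite ltr_norml => ex ex' /andP[lo hi].
case: (ltrP x 0) => x0; case: (ltrP x' 0) => x'0 //.
  by move: ex ex'; rewrite (ltr0_norm x0) (ger0_norm x'0); lra.
by move: ex ex'; rewrite (ger0_norm x0) (ltr0_norm x'0); lra.
Qed.

Lemma cell_same_side (I : Type) (e : R) (x y : I -> R) p q :
  (forall i, (e <= `|x i|) || (e <= `|y i|)) ->
  (forall i j, `|x i - x j| < e) -> (forall i j, `|y i - y j| < e) ->
  0 <= y p -> y q < 0 -> forall i j, (x i < 0) = (x j < 0).
Proof.
move=> away dx dy yp yq.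
have large i : e <= `|x i|.
  case/orP: (away i) => //; rewrite leNgt => /negP[].
  have := dy i p; have := dy i q; rewrite !ltr_norml => /andP[h1 h2] /andP[h3 h4].
  by apply/andP; split; lra.
by move=> i j; apply: (same_sign (e := e)); rewrite ?large ?dx.
Qed.

Section Grid.
Variables (N : nat) (e : R) (x y : nat -> nat -> R).
Hypothesis away : forall i j, (i <= N)%N -> (j <= N)%N -> (e <= `|x i j|) || (e <= `|y i j|).
Hypothesis adjacent_close : forall i j i' j', (i <= i'.+1)%N -> (i' <= i.+1)%N ->
  (j <= j'.+1)%N ->
  (j' <= j.+1)%N -> (i <= N)%N -> (i' <= N)%N -> (j <= N)%N -> (j' <= N)%N ->
  `|x i j - x i' j'| < e /\ `|y i j - y i' j'| < e.

Definition hstep i j := ray_crossing (x i j) (y i j) (y i.+1 j).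
Definition vstep i j := ray_crossing (x i j) (y i j) (y i j.+1).

Lemma cell_parity i j : (i < N)%N -> (j < N)%N ->
  hstep i j (+) vstep i.+1 j = vstep i j (+) hstep i j.+1.
Proof.
move=> iN jN; pose X (p : bool * bool) := x (i + p.1)%N (j + p.2)%N.
pose Y (p : bool * bool) := y (i + p.1)%N (j + p.2)%N.
have bnd (p : bool * bool) : (i + p.1 <= N)%N /\ (j + p.2 <= N)%N.
  by case: p => [[] []] /=; split; lia.
have awayXY p : (e <= `|X p|) || (e <= `|Y p|) by have [] := bnd p; apply: away.
have dXY p q : `|X p - X q| < e /\ `|Y p - Y q| < e.
  have [? ?] := bnd p; have [? ?] := bnd q; have : (p.1 <= 1)%N by case: p.1.
  have : (p.2 <= 1)%N by case: p.2. have : (q.1 <= 1)%N by case: q.1.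
  have : (q.2 <= 1)%N by case: q.2.
  by move=> *; apply: adjacent_close => //; lia.
have side p q : 0 <= Y p -> Y q < 0 -> forall i j, (X i < 0) = (X j < 0).
  by move=> Yp Yq; apply: (cell_same_side awayXY _ _ Yp Yq) => a b; case: (dXY a b).
rewrite /hstep /vstep /ray_crossing.
have -> : x i j = X (false, false) by rewrite /X !addn0.
have -> : x i.+1 j = X (true, false) by rewrite /X addn0 addn1.
have -> : x i j.+1 = X (false, true) by rewrite /X addn0 addn1.
have -> : y i j = Y (false, false) by rewrite /Y !addn0.
have -> : y i.+1 j = Y (true, false) by rewrite /Y addn0 addn1.
have -> : y i j.+1 = Y (false, true) by rewrite /Y addn0 addn1.
have -> : y i.+1 j.+1 = Y (true, true) by rewrite /Y !addn1.
have [/existsP[p /existsP[q /andP[Yp Yq]]]|none] :=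
    boolP [exists p : bool * bool, exists q : bool * bool, (0 <= Y p) && (Y q < 0)].
  rewrite (side _ _ Yp Yq (true, false) (false, false)) (side _ _ Yp Yq (false, true) (false,
    false)).
  by case: (_ < 0); case: (0 <= _); case: (0 <= _); case: (0 <= _); case: (0 <= _).
have same p q : (0 <= Y p) = (0 <= Y q).
  apply/idP/idP => h; rewrite leNgt; apply: contra none => h'; apply/existsP.
    by exists p; apply/existsP; exists q; rewrite h h'.
  by exists q; apply/existsP; exists p; rewrite h h'.
rewrite (same (true, false) (false, false)) (same (false, true) (false, false)).
by rewrite (same (true, true) (false, false)) eqxx.
Qed.

Lemma grid_parity :
  \big[addb/false]_(i < N) hstep i 0 (+) \big[addb/false]_(j < N) vstep N j =
  \big[addb/false]_(j < N) vstep 0 j (+) \big[addb/false]_(i < N) hstep i N.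
Proof.
have row i : (i <= N)%N ->
  \big[addb/false]_(i' < i) hstep i' 0 (+) \big[addb/false]_(j < N) vstep i j =
  \big[addb/false]_(j < N) vstep 0 j (+) \big[addb/false]_(i' < i) hstep i' N.
  elim: i => [|i IH] iN; first by rewrite !big_ord0 addbF.
  have /(_ N (leqnn N)) C : forall j, (j <= N)%N ->
      hstep i 0 (+) \big[addb/false]_(j' < j) vstep i.+1 j' =
      \big[addb/false]_(j' < j) vstep i j' (+) hstep i j.
    elim=> [|j IHj] jN; first by rewrite !big_ord0 addbF.
    rewrite !big_ord_recr /= addbA IHj 1?ltnW // -[RHS]addbA -(cell_parity iN jN).
    by rewrite !addbA.
  rewrite !big_ord_recr /= -addbA C addbA IH 1?ltnW //.
  by rewrite addbA.
exact: row.
Qed.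

End Grid.

Lemma lower_side (N : nat) (e : R) (x y : nat -> R) :
  (forall i, (i <= N)%N -> (e <= `|x i|) || (e <= `|y i|)) ->
  (forall i, (i < N)%N -> `|x i - x i.+1| < e /\ `|y i - y i.+1| < e) ->
  (forall i, (i <= N)%N -> y i <= 0) ->
  \big[addb/false]_(i < N) ray_crossing (x i) (y i) (y i.+1) =
  on_ray (x 0%N) (y 0%N) (+) on_ray (x N) (y N).
Proof.
move=> away step low.
have /(_ N (leqnn N)) // : forall k, (k <= N)%N ->
  \big[addb/false]_(i < k) ray_crossing (x i) (y i) (y i.+1) =
  on_ray (x 0%N) (y 0%N) (+) on_ray (x k) (y k).
elim=> [|k IH] kN; first by rewrite big_ord0 addbb.
rewrite big_ord_recr /= IH 1?ltnW // -addbA; congr (_ (+) _).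
have [dx dy] := step _ kN; rewrite /ray_crossing /on_ray.
have [up|] := boolP ((0 <= y k) || (0 <= y k.+1)); last first.
  by rewrite negb_or => /andP[/negbTE -> /negbTE ->].
have large i : (i == k) || (i == k.+1) -> e <= `|x i|.
  move=> ik; have iN : (i <= N)%N by case/orP: ik => /eqP ->; rewrite // ltnW.
  case/orP: (away _ iN) => //; rewrite leNgt => /negP[].
  have := low _ (ltnW kN); have := low _ kN; move: dy up; rewrite !ltr_norml.
  by move=> /andP[? ?] /orP[] ? ? ?; case/orP: ik => /eqP ->; apply/andP; split; lra.
rewrite (same_sign (large k _) (large k.+1 _) dx) ?eqxx ?orbT //.
by case: (0 <= y k); case: (0 <= y k.+1); case: (x k.+1 < 0).
Qed.

Lemma upper_side (N : nat) (x y : nat -> R) : (forall i, (i <= N)%N -> 0 <= y i) ->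
  \big[addb/false]_(i < N) ray_crossing (x i) (y i) (y i.+1) = false.
Proof.
move=> up; rewrite big1 // => i _; rewrite /ray_crossing !up //.
exact: ltnW.
Qed.

End GridParity.

Section Paths.
Local Open Scope classical_set_scope.
Local Open Scope ring_scope.
Variable R : realType.
Implicit Types f g : R -> R.

Lemma segment_unif_continuous f : continuous f -> forall e : R, 0 < e ->
  exists2 d : R, 0 < d & forall x y : R, 0 <= x <= 1 -> `|x - y| < d -> `|f x - f y| < e.
Proof.
move=> cf e e0; have := @segment_compact R 0 1; rewrite compact_near_coveringP.
move=> /(_ R (0^'+) (fun d x => forall y, `|x - y| < d -> `|f x - f y| < e)).
have cov : forall x : R, `[0, 1]%classic x -> \forall x' \near x & d \near 0^'+,
    forall y, `|x' - y| < d -> `|f x' - f y| < e.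
  move=> x _; have /cvgrPdist_lt/(_ (e / 2)) := cf x.
  rewrite divr_gt0 // => /(_ isT)/nbhs_ballP[d /= d0 xd].
  exists (ball x (d / 2), [set t | t < d / 2]) => /=.
    split; first by apply: nbhsx_ballx; rewrite divr_gt0.
    by apply: nbhs_right_lt; rewrite divr_gt0.
  move=> [x' t] /= [bx' td] y yd.
  have h1 := xd x' (le_ball _ bx'); have h2 := xd y.
  have {}h1 : `|f x - f x'| < e / 2 by apply: h1; lra.
  have {}h2 : `|f x - f y| < e / 2.
    apply: h2; rewrite /ball /= in bx' *.
    have := ler_normD (x - x') (x' - y); rewrite addrA subrK => h3.
    by apply: (le_lt_trans h3); lra.
  have := ler_normB (f x - f y) (f x - f x').
  have -> : f x - f y - (f x - f x') = f x' - f y by ring.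
  by move/le_lt_trans; apply; lra.
move=> /(_ _ cov) [d /= d0 H].
exists (d / 2); first by rewrite divr_gt0.
move=> x y x01 xy; apply: (H (d / 2)) => //=; rewrite ?divr_gt0 //.
by rewrite sub0r normrN gtr0_norm ?divr_gt0 //; lra.
Qed.

Lemma grid_mesh (d : R) : 0 < d -> exists N : nat, (0 < N)%N /\ (N%:R : R)^-1 < d.
Proof.
move=> d0; exists (Num.truncn d^-1).+1; split => //.
by rewrite invf_plt ?posrE // truncnS_gt.
Qed.

Section Crossing.
Variables X1 Y1 X2 Y2 : R -> R.
Hypotheses (cX1 : continuous X1) (cY1 : continuous Y1).
Hypotheses (cX2 : continuous X2) (cY2 : continuous Y2).

Lemma paths_apart :
  (forall s t : R, 0 <= s <= 1 -> 0 <= t <= 1 -> ~ (X1 s = X2 t /\ Y1 s = Y2 t)) ->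
  exists2 e : R, 0 < e & forall s t : R, 0 <= s <= 1 -> 0 <= t <= 1 ->
    (e <= `|X1 s - X2 t|) || (e <= `|Y1 s - Y2 t|).
Proof.
move=> apart; pose m (p : R * R) := `|X1 p.1 - X2 p.2| + `|Y1 p.1 - Y2 p.2|.
have cm : continuous m.
  move=> p; apply: cvgD; apply: cvg_norm; apply: cvgB.
  - by apply: (continuous_comp (f := fst) (g := X1)); [exact: cvg_fst|exact: cX1].
  - by apply: (continuous_comp (f := snd) (g := X2)); [exact: cvg_snd|exact: cX2].
  - by apply: (continuous_comp (f := fst) (g := Y1)); [exact: cvg_fst|exact: cY1].
  - by apply: (continuous_comp (f := snd) (g := Y2)); [exact: cvg_snd|exact: cY2].
have [|c cA cmin] := compact_EVT_min _ (compact_setX (@segment_compact R 0 1)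
  (@segment_compact R 0 1))
    (continuous_subspaceT cm).
  by exists (0, 0); split; rewrite /= in_itv /= lexx ler01.
rewrite inE /= !in_itv /= in cA; case: cA => c1 c2.
have m0 : 0 < m c.
  rewrite lt_neqAle addr_ge0 // andbT eq_sym; apply/negP.
  rewrite paddr_eq0 // !normr_eq0 !subr_eq0 => /andP[/eqP h1 /eqP h2].
  exact: (apart _ _ c1 c2).
exists (m c / 2); first by rewrite divr_gt0.
move=> s t s01 t01; have : m c <= m (s, t) by apply: cmin; rewrite inE /= !in_itv.
rewrite /m /=; case: lerP => //= h1 h2; move: h1 h2; set a := `|X1 s - X2 t|.
by rewrite /m; lra.
Qed.

Lemma crossing_parity (l r b t : bool) :
  (forall s t : R, 0 <= s <= 1 -> 0 <= t <= 1 -> ~ (X1 s = X2 t /\ Y1 s = Y2 t)) ->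
  (forall u : R, 0 <= u <= 1 -> if l then Y1 0 <= Y2 u else Y2 u <= Y1 0) ->
  (forall u : R, 0 <= u <= 1 -> if r then Y1 1 <= Y2 u else Y2 u <= Y1 1) ->
  (forall u : R, 0 <= u <= 1 -> if b then Y1 u <= Y2 0 else Y2 0 <= Y1 u) ->
  (forall u : R, 0 <= u <= 1 -> if t then Y1 u <= Y2 1 else Y2 1 <= Y1 u) ->
  let corner u v := on_ray (X1 u - X2 v) (Y1 u - Y2 v) in
  (l && (corner 0 0 (+) corner 0 1)) (+) (t && (corner 0 1 (+) corner 1 1)) =
  (b && (corner 0 0 (+) corner 1 0)) (+) (r && (corner 1 0 (+) corner 1 1)).
Proof.
move=> apart hl hr hb ht corner; have [e e0 away] := paths_apart apart.
have e20 : 0 < e / 2 by rewrite divr_gt0.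
have [d1 d10 u1] := segment_unif_continuous cX1 e20.
have [d2 d20 u2] := segment_unif_continuous cY1 e20.
have [d3 d30 u3] := segment_unif_continuous cX2 e20.
have [d4 d40 u4] := segment_unif_continuous cY2 e20.
have [|N [N0 Nd]] := @grid_mesh (Num.min (Num.min d1 d2) (Num.min d3 d4)).
  by rewrite !lt_min d10 d20 d30 d40.
rewrite !lt_min in Nd; case/andP: Nd => /andP[Nd1 Nd2] /andP[Nd3 Nd4].
have NR : 0 < N%:R :> R by rewrite ltr0n.
pose q i : R := i%:R / N%:R.
have q01 i : (i <= N)%N -> 0 <= q i <= 1.
  by move=> iN; rewrite /q divr_ge0 ?ler0n //= ler_pdivrMr // mul1r ler_nat.
have q0 : q 0%N = 0 by rewrite /q mul0r.
have qN : q N = 1 by rewrite /q divff ?gt_eqF.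
have qq i j : (i <= j.+1)%N -> (j <= i.+1)%N -> `|q i - q j| <= N%:R^-1.
  move=> ij ji; rewrite /q -mulrBl normrM normfV (ger0_norm (ltW NR)).
  rewrite ler_piMl ?invr_ge0 ?(ltW NR) //; have := ij; have := ji.
  by rewrite -!(ler_nat R) -!natr1 ler_norml => ? ?; apply/andP; split; lra.
pose x i j := X1 (q i) - X2 (q j); pose y i j := Y1 (q i) - Y2 (q j).
have aw i j : (i <= N)%N -> (j <= N)%N -> (e <= `|x i j|) || (e <= `|y i j|).
  by move=> iN jN; apply: away; apply: q01.
have close_step (f g : R -> R) d d' : (forall x y : R, 0 <= x <= 1 -> `|x - y| < d ->
  `|f x - f y| < e / 2) ->
    (forall x y : R, 0 <= x <= 1 -> `|x - y| < d' -> `|g x - g y| < e / 2) ->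
    N%:R^-1 < d -> N%:R^-1 < d' ->
    forall i j i' j', (i <= i'.+1)%N -> (i' <= i.+1)%N -> (j <= j'.+1)%N ->
  (j' <= j.+1)%N -> (i <= N)%N -> (j <= N)%N ->
  `|f (q i) - g (q j) - (f (q i') - g (q j'))| < e.
  move=> uf ug Nd Nd' i j i' j' h1 h2 h3 h4 iN jN.
  have F := uf _ _ (q01 _ iN) (le_lt_trans (qq _ _ h1 h2) Nd).
  have G := ug _ _ (q01 _ jN) (le_lt_trans (qq _ _ h3 h4) Nd').
  have -> : f (q i) - g (q j) - (f (q i') - g (q j')) =
    (f (q i) - f (q i')) - (g (q j) - g (q j')) by ring.
  by apply: (le_lt_trans (ler_normB _ _)); lra.
have close i j i' j' : (i <= i'.+1)%N -> (i' <= i.+1)%N -> (j <= j'.+1)%N ->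
  (j' <= j.+1)%N -> (i <= N)%N -> (i' <= N)%N -> (j <= N)%N -> (j' <= N)%N ->
  `|x i j - x i' j'| < e /\ `|y i j - y i' j'| < e.
  move=> h1 h2 h3 h4 iN _ jN _.
  by split; [apply: (close_step _ _ _ _ u1 u3)|apply: (close_step _ _ _ _ u2 u4)].
have := grid_parity aw close.
have sideE (low : bool) (z w : nat -> R) :
    (forall i, (i <= N)%N -> (e <= `|z i|) || (e <= `|w i|)) ->
    (forall i, (i < N)%N -> `|z i - z i.+1| < e /\ `|w i - w i.+1| < e) ->
    (forall i, (i <= N)%N -> if low then w i <= 0 else 0 <= w i) ->
    \big[addb/false]_(i < N) ray_crossing (z i) (w i) (w i.+1) =
      low && (on_ray (z 0%N) (w 0%N) (+) on_ray (z N) (w N)).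
  case: low => zw st lo; [exact: lower_side zw st lo|exact: upper_side lo].
have hN i : (i < N)%N -> forall j, (j <= N)%N ->
    `|x i j - x i.+1 j| < e /\ `|y i j - y i.+1 j| < e.
  by move=> iN j jN; apply: close => //; rewrite ?leqnSn // ltnW // ltnW.
have vN j : (j < N)%N -> forall i, (i <= N)%N ->
    `|x i j - x i j.+1| < e /\ `|y i j - y i j.+1| < e.
  by move=> jN i iN; apply: close => //; rewrite ?leqnSn // ltnW // ltnW.
rewrite /hstep /vstep.
rewrite (sideE b (x^~ 0%N) (y^~ 0%N)); last 3 first.
- by move=> i iN; apply: aw.
- by move=> i iN; apply: hN.
- move=> i iN; have := hb _ (q01 _ iN); rewrite /y q0.
  by case: (b); rewrite ?subr_le0 ?subr_ge0.
rewrite (sideE t (x^~ N) (y^~ N)); last 3 first.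
- by move=> i iN; apply: aw.
- by move=> i iN; apply: hN.
- move=> i iN; have := ht _ (q01 _ iN); rewrite /y qN.
  by case: (t); rewrite ?subr_le0 ?subr_ge0.
rewrite (sideE l (x 0%N) (y 0%N)); last 3 first.
- by move=> i iN; apply: aw.
- by move=> i iN; apply: vN.
- move=> i iN; have := hl _ (q01 _ iN); rewrite /y q0.
  by case: (l); rewrite ?subr_le0 ?subr_ge0.
rewrite (sideE r (x N) (y N)); last 3 first.
- by move=> i iN; apply: aw.
- by move=> i iN; apply: vN.
- move=> i iN; have := hr _ (q01 _ iN); rewrite /y qN.
  by case: (r); rewrite ?subr_le0 ?subr_ge0.
by rewrite /x /y q0 qN => ->.
Qed.

Lemma halfplane_crossing :
  (forall u : R, 0 <= u <= 1 -> 0 <= Y1 u) -> (forall u : R, 0 <= u <= 1 -> 0 <= Y2 u) ->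
  Y1 0 = 0 -> Y1 1 = 0 -> Y2 0 = 0 -> Y2 1 = 0 ->
  (X1 0 < X2 0) (+) (X1 0 < X2 1) (+) (X1 1 < X2 0) (+) (X1 1 < X2 1) ->
  exists s t : R, [/\ 0 <= s <= 1, 0 <= t <= 1, X1 s = X2 t & Y1 s = Y2 t].
Proof.
move=> p1 p2 z10 z11 z20 z21 par; apply: contrapT => none.
have apart (s t : R) : 0 <= s <= 1 -> 0 <= t <= 1 -> ~ (X1 s = X2 t /\ Y1 s = Y2 t).
  by move=> s01 t01 [hX hY]; apply: none; exists s, t.
have E := @crossing_parity true true false false apart.
rewrite /= z10 z11 z20 z21 /on_ray !subrr lexx /= !subr_lt0 in E.
move: par; rewrite -addbA -(E p2 p2 p1 p1) addbF.
by case: (X1 0 < X2 0); case: (X1 0 < X2 1).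
Qed.

Lemma strip_crossing (lo hi : R) :
  (forall u : R, 0 <= u <= 1 -> lo <= Y1 u <= hi) ->
  (forall u : R, 0 <= u <= 1 -> lo <= Y2 u <= hi) ->
  Y1 0 = lo -> Y1 1 = hi -> Y2 0 = lo -> Y2 1 = hi ->
  (X1 0 < X2 0) (+) (X1 1 < X2 1) ->
  exists s t : R, [/\ 0 <= s <= 1, 0 <= t <= 1, X1 s = X2 t & Y1 s = Y2 t].
Proof.
move=> p1 p2 z10 z11 z20 z21 par; apply: contrapT => none.
have apart (s t : R) : 0 <= s <= 1 -> 0 <= t <= 1 -> ~ (X1 s = X2 t /\ Y1 s = Y2 t).
  by move=> s01 t01 [hX hY]; apply: none; exists s, t.
have E := @crossing_parity true false false true apart.
rewrite /= z10 z11 z20 z21 /on_ray !subrr lexx /= !subr_lt0 in E.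
have {}E := E _ _ _ _; move: par; rewrite -[X in _ (+) X](addKb ((0 <= lo - hi)
  && (X1 0 < X2 1))) addbA E //.
- by move=> u /p2 /andP[].
- by move=> u /p2 /andP[].
- by move=> u /p1 /andP[].
- by move=> u /p1 /andP[].
Qed.

End Crossing.

End Paths.

Section Polar.
Local Open Scope classical_set_scope.
Local Open Scope ring_scope.
Variable R : realType.
Implicit Types x y a b : R.

Definition has_angle x y a := exists2 r : R, 0 < r & x = r * cos a /\ y = r * sin a.

Lemma cosD_int2pi a (k : int) : cos (a + k%:~R * (pi *+ 2)) = cos a.
Proof.
case: k => k; first by rewrite -[k%:~R]/(k%:R) mulr_natl (periodicn (@cosD2pi R)).
rewrite NegzE mulrNz mulNr -[(Posz _)%:~R]/(k.+1%:R) mulr_natl.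
by rewrite -[in RHS](subrK (pi *+ 2 *+ k.+1) a) (periodicn (@cosD2pi R)).
Qed.

Lemma sinD_int2pi a (k : int) : sin (a + k%:~R * (pi *+ 2)) = sin a.
Proof.
case: k => k; first by rewrite -[k%:~R]/(k%:R) mulr_natl (periodicn (@sinD2pi R)).
rewrite NegzE mulrNz mulNr -[(Posz _)%:~R]/(k.+1%:R) mulr_natl.
by rewrite -[in RHS](subrK (pi *+ 2 *+ k.+1) a) (periodicn (@sinD2pi R)).
Qed.

Lemma cos_eq1_int a : cos a = 1 -> exists k : int, a = k%:~R * (pi *+ 2).
Proof.
move=> ca; have p0 := pi_gt0 R; have p20 : 0 < (pi : R) *+ 2 by rewrite pmulrn_lgt0.
pose k := Num.floor (a / (pi *+ 2)); exists k.
pose b := a - k%:~R * (pi *+ 2).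
have cb : cos b = 1 by rewrite /b -mulNr -mulrNz cosD_int2pi.
have b0 : 0 <= b by rewrite subr_ge0 -ler_pdivlMr // real_floor_le // num_real.
have b1 : b < pi *+ 2.
  rewrite ltrBlDl -[X in _ + X]mul1r -mulrDl -ltr_pdivrMr // addrC.
  by have := real_floorD1_gt (num_real (a / (pi *+ 2))); rewrite intrD addrC.
suff : b = 0 by move/eqP; rewrite subr_eq0 => /eqP.
have [bp|bp] := lerP b pi.
  by apply: cos_inj; rewrite ?in_itv /= ?b0 ?lexx ?pi_ge0 ?cos0.
have : pi *+ 2 - b = 0.
  apply: cos_inj; rewrite ?in_itv /= ?lexx ?pi_ge0 ?cos0 //.
    by rewrite mulr2n in b1 *; apply/andP; split; lra.
  by rewrite addrC cosD2pi cosN.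
by rewrite mulr2n in b1 *; lra.
Qed.

Lemma has_angle_norm x y a : has_angle x y a ->
  0 < x ^+ 2 + y ^+ 2 /\ (x = Num.sqrt (x ^+ 2 + y ^+ 2) * cos a)
    /\ (y = Num.sqrt (x ^+ 2 + y ^+ 2) * sin a).
Proof.
case=> r r0 [-> ->]; have -> : (r * cos a) ^+ 2 + (r * sin a) ^+ 2 = r ^+ 2.
  by rewrite !exprMn -mulrDr cos2Dsin2 mulr1.
by rewrite sqrtr_sqr gtr0_norm // exprn_gt0.
Qed.

Lemma has_angle_inj x y a b : has_angle x y a -> has_angle x y b ->
  exists k : int, b = a + k%:~R * (pi *+ 2).
Proof.
move=> /has_angle_norm[n0 [xa ya]] /has_angle_norm[_ [xb yb]].
have s0 : Num.sqrt (x ^+ 2 + y ^+ 2) != 0 by rewrite gt_eqF ?sqrtr_gt0.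
have ec : cos a = cos b by apply: (mulfI s0); rewrite -xa -xb.
have es : sin a = sin b by apply: (mulfI s0); rewrite -ya -yb.
have [|k E] := @cos_eq1_int (b - a).
  by rewrite cosB ec es -!expr2 cos2Dsin2.
by exists k; rewrite -E addrC subrK.
Qed.

Lemma has_angle_exists x y : 0 < x ^+ 2 + y ^+ 2 -> exists2 a,
  0 <= a < pi *+ 2 & has_angle x y a.
Proof.
move=> n0; pose r := Num.sqrt (x ^+ 2 + y ^+ 2).
have r0 : 0 < r by rewrite sqrtr_gt0.
have r2 : r ^+ 2 = x ^+ 2 + y ^+ 2 by rewrite sqr_sqrtr // ltW.
pose c := x / r.
have c2 : 1 - c ^+ 2 = (y / r) ^+ 2.
  by rewrite /c !expr_div_n r2; field; rewrite gt_eqF.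
have c1 : -1 <= c <= 1.
  by rewrite -ler_norml -(@ler_pXn2r _ 2)
    ?nnegrE // ?normr_ge0 // real_normK ?num_real // expr1n -subr_ge0 c2 sqr_ge0.
have xE : x = r * cos (acos c) by rewrite acosK ?in_itv // /c; field; rewrite gt_eqF.
have sE : sin (acos c) = `|y| / r.
  by rewrite sin_acos // c2 sqrtr_sqr normrM normfV (gtr0_norm r0).
have a0 := acos_ge0 c1; have ap := acos_lepi c1; have p0 := pi_gt0 R.
have [y0|y0] := lerP 0 y.
  exists (acos c); first by rewrite a0 mulr2n; lra.
  exists r => //; split => //; rewrite sE ger0_norm //; field; by rewrite gt_eqF.
exists (pi *+ 2 - acos c).
  rewrite mulr2n; apply/andP; split; first by lra.
  have : 0 < acos c; last by lra.
  rewrite lt_neqAle a0 andbT eq_sym; apply/eqP => ac0.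
  move: sE; rewrite ac0 sin0 => /esym/eqP; rewrite mulf_eq0 normr_eq0 invr_eq0 (gt_eqF r0) orbF.
  by move/eqP => yy; rewrite yy ltxx in y0.
exists r => //; rewrite addrC cosD2pi sinD2pi cosN sinN; split => //.
by rewrite sE ltr0_norm //; field; rewrite gt_eqF.
Qed.

Definition turn x y x' y' := atan ((x * y' - y * x') / (x * x' + y * y')).

Lemma has_angle_turn x y x' y' a : 0 < x * x' + y * y' ->
  has_angle x y a -> has_angle x' y' (a + turn x y x' y').
Proof.
move=> d0 [r r0 [xE yE]]; rewrite /turn; set d := _ + _ in d0 *; set c := _ - _.
set b := atan _.
have cb : 0 < cos b by apply: cos_gt0_pihalf; rewrite atan_gtNpi2 atan_ltpi2.
have sb : sin b = c / d * cos b.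
  by rewrite -[c / d]atanK -/b /tan divfK // gt_eqF.
have n0 : x ^+ 2 + y ^+ 2 = r ^+ 2 by rewrite xE yE !exprMn -mulrDr cos2Dsin2 mulr1.
exists (d / (r * cos b)); first by rewrite divr_gt0 // mulr_gt0.
have r_neq0 : r != 0 by rewrite gt_eqF.
have d_neq0 : d != 0 by rewrite gt_eqF.
have cb_neq0 : cos b != 0 by rewrite gt_eqF.
have ca : cos a = x / r by rewrite xE; field.
have sa : sin a = y / r by rewrite yE; field.
rewrite cosD sinD sb ca sa; split.
  have -> : d / (r * cos b) * (x / r * cos b - y / r * (c / d * cos b)) =
    (d * x - c * y) / r ^+ 2 by field; rewrite d_neq0 r_neq0 cb_neq0.
  have -> : d * x - c * y = x' * r ^+ 2 by rewrite -n0 /d /c; ring.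
  by field.
have -> : d / (r * cos b) * (y / r * cos b + x / r * (c / d * cos b)) =
  (d * y + c * x) / r ^+ 2 by field; rewrite d_neq0 r_neq0 cb_neq0.
have -> : d * y + c * x = y' * r ^+ 2 by rewrite -n0 /d /c; ring.
by field.
Qed.

Lemma polar_lift (X Y : R -> R) a : continuous X -> continuous Y ->
  (forall t, 0 < X t ^+ 2 + Y t ^+ 2) -> has_angle (X 0) (Y 0) a ->
  exists th : R -> R, [/\ continuous th, th 0 = a &
    forall t : R, 0 <= t <= 1 -> has_angle (X t) (Y t) (th t)].
Proof.
move=> cX cY n0 a0; pose n t := X t ^+ 2 + Y t ^+ 2.
have cn : continuous n.
  by move=> t; apply: cvgD; apply: cvgM; (exact: cX || exact: cY).
have [c c01 cmin] := EVT_min ler01 (continuous_subspaceT cn).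
pose e := Num.min 1 (n c / 2).
have e0 : 0 < e by rewrite lt_min ltr01 divr_gt0 // n0.
have [d1 d10 u1] := segment_unif_continuous cX e0.
have [d2 d20 u2] := segment_unif_continuous cY e0.
have [|N [N0 Nd]] := @grid_mesh R (Num.min d1 d2); first by rewrite lt_min d10.
rewrite lt_min in Nd; case/andP: Nd => Nd1 Nd2.
have NR : 0 < N%:R :> R by rewrite ltr0n.
pose q (i : nat) (t : R) := Num.min t (i%:R / N%:R).
have cq i : continuous (q i).
  by move=> t; apply: (@continuous_min R R (fun t : R => t) (fun=> i%:R / N%:R) t);
    [exact: cvg_id|exact: cvg_cst].
pose dot i t := X (q i t) * X (q i.+1 t) + Y (q i t) * Y (q i.+1 t).
have q_lt0 i t : t < 0 -> q i t = t.
  by move=> t0; rewrite /q min_l // (le_trans (ltW t0)) // divr_ge0.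
have dot0 i t : (i < N)%N -> 0 < dot i t.
  move=> iN; rewrite /dot; have [t0|t0] := ltrP t 0.
    by rewrite !q_lt0 // -!expr2.
  have q01 : 0 <= q i t <= 1.
    rewrite /q le_min t0 divr_ge0 // ge_min ler_pdivrMr // mul1r.
    by rewrite ler_nat (ltnW iN) orbT.
  have qq : `|q i t - q i.+1 t| <= N%:R^-1.
    rewrite /q -[i.+1%:R]natr1 mulrDl mul1r; have : 0 < (N%:R : R)^-1 by rewrite invr_gt0.
    move: (N%:R^-1) (i%:R / N%:R) => v u v0; rewrite ler_norml.
    by case: (lerP t u) => h1; case: (lerP t (u + v)) => h2; apply/andP; split; lra.
  have hX := u1 _ _ q01 (le_lt_trans qq Nd1); have hY := u2 _ _ q01 (le_lt_trans qq Nd2).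
  have nq : n c <= n (q i t) by apply: cmin; rewrite in_itv.
  have nq' : 0 < n (q i.+1 t) by apply: n0.
  move: hX hY nq nq'; rewrite /n; move: (X (q i t)) (Y (q i t)) (X (q i.+1 t)) (Y (q i.+1 t)).
  rewrite -/(n c) => x y x' y' hX hY nq nq'.
  have small (z : R) : `|z| < e -> z ^+ 2 < n c / 2.
    move=> ze; rewrite -real_normK ?num_real // expr2.
    have e1 : e <= 1 by rewrite ge_min lexx.
    have e2 : e <= n c / 2 by rewrite ge_min lexx orbT.
    have := normr_ge0 z; move: (`|z|) ze => w we w0; nra.
  have := small _ hX; have := small _ hY; nra.
pose A i t := turn (X (q i t)) (Y (q i t)) (X (q i.+1 t)) (Y (q i.+1 t)).
have cA i : (i < N)%N -> continuous (A i).
  move=> iN t; pose ratio t := (X (q i t) * Y (q i.+1 t) - Y (q i t) * X (q i.+1 t)) / dot i t.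
  suff cr : {for t, continuous ratio}.
    exact: (@continuous_comp _ _ _ ratio (@atan R) t cr (@continuous_atan R _)).
  have cXq k : {for t, continuous (X \o q k)} by apply: continuous_comp; [exact: cq|exact: cX].
  have cYq k : {for t, continuous (Y \o q k)} by apply: continuous_comp; [exact: cq|exact: cY].
  apply: cvgM.
    by apply: cvgB; apply: cvgM; (exact: cXq || exact: cYq).
  apply: cvgV; first by rewrite gt_eqF // dot0.
  by apply: cvgD; apply: cvgM; (exact: cXq || exact: cYq).
exists (fun t => a + \sum_(i < N) A i t); split.
- have cs k : (k <= N)%N -> continuous (fun t => a + \sum_(i < k) A i t).
    elim: k => [|k IH] kN.
      by under eq_fun do rewrite big_ord0; move=> t; apply: cvg_cst.
    under eq_fun do rewrite big_ord_recr addrA /=.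
    by move=> t; apply: cvgD; [apply: IH; exact: ltnW|exact: cA].
  exact: cs.
- rewrite big1 ?addr0 // => i _; rewrite /A.
  have -> : q i 0 = 0 by rewrite /q min_l // divr_ge0.
  have -> : q i.+1 0 = 0 by rewrite /q min_l // divr_ge0.
  by rewrite /turn [Y 0 * X 0]mulrC subrr mul0r atan0.
move=> t /andP[t0 t1].
have step k : (k <= N)%N -> has_angle (X (q k t)) (Y (q k t)) (a + \sum_(i < k) A i t).
  elim: k => [|k IH] kN; first by rewrite big_ord0 addr0 /q mul0r min_r.
  rewrite big_ord_recr /= addrA; apply: has_angle_turn; first exact: dot0.
  exact/IH/ltnW.
have := step N (leqnn N); have -> // : q N t = t.
by rewrite /q divff ?gt_eqF // min_l.
Qed.

End Polar.

Section Inversion.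
Local Open Scope classical_set_scope.
Local Open Scope ring_scope.
Variables (R : realType) (r cut : R).
Hypothesis r0 : 0 < r.
Implicit Types x y a b : R.

Let ox : R := r * cos cut.
Let oy : R := r * sin cut.
Let dist x y : R := (x - ox) ^+ 2 + (y - oy) ^+ 2.

Definition inv_abscissa x y := (x * oy - y * ox) / dist x y.
Definition inv_ordinate x y := (r ^+ 2 - (x ^+ 2 + y ^+ 2)) / dist x y.

Let o_norm : ox ^+ 2 + oy ^+ 2 = r ^+ 2.
Proof. by rewrite /ox /oy !exprMn -mulrDr cos2Dsin2 mulr1. Qed.

Lemma dist_gt0 x y : (x, y) <> (ox, oy) -> 0 < dist x y.
Proof.
move=> ne; rewrite lt_neqAle addr_ge0 ?sqr_ge0 // andbT eq_sym paddr_eq0 ?sqr_ge0 //.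
by rewrite !sqrf_eq0 !subr_eq0; apply/negP => /andP[/eqP xo /eqP yo]; apply: ne; rewrite xo yo.
Qed.

Lemma inversion_inj x y x' y' : (x, y) <> (ox, oy) -> (x', y') <> (ox, oy) ->
  inv_abscissa x y = inv_abscissa x' y' -> inv_ordinate x y = inv_ordinate x' y' ->
  x = x' /\ y = y'.
Proof.
move=> /dist_gt0 d0 /dist_gt0 d0' eU eV.
have r2 : r ^+ 2 != 0 by rewrite expf_neq0 // gt_eqF.
pose A U V := oy * U - ox * ((V + 1) / 2); pose B U V := - ox * U - oy * ((V + 1) / 2).
have coords u v : 0 < dist u v ->
    r ^+ 2 * (u - ox) = dist u v * A (inv_abscissa u v) (inv_ordinate u v) /\
    r ^+ 2 * (v - oy) = dist u v * B (inv_abscissa u v) (inv_ordinate u v).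
  move=> d; have dn : dist u v != 0 by rewrite gt_eqF.
  have Ud : inv_abscissa u v * dist u v = u * oy - v * ox by rewrite divfK.
  have Vd : inv_ordinate u v * dist u v = r ^+ 2 - (u ^+ 2 + v ^+ 2) by rewrite divfK.
  have -> : dist u v * A (inv_abscissa u v) (inv_ordinate u v) =
    oy * (inv_abscissa u v * dist u v) - ox * ((inv_ordinate u v * dist u v + dist u v) / 2).
    by rewrite /A; field.
  have -> : dist u v * B (inv_abscissa u v) (inv_ordinate u v) =
    - ox * (inv_abscissa u v * dist u v) - oy * ((inv_ordinate u v * dist u v + dist u v) / 2).
    by rewrite /B; field.
  by rewrite Ud Vd -o_norm /dist; split; field.
have [cx cy] := coords _ _ d0; have [cx' cy'] := coords _ _ d0'; rewrite -eU -eV in cx' cy'.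
move: (A _ _) (B _ _) cx cy cx' cy' => a b cx cy cx' cy'.
have size u v : r ^+ 2 * (u - ox) = dist u v * a -> r ^+ 2 * (v - oy) = dist u v * b ->
    0 < dist u v -> dist u v * (a ^+ 2 + b ^+ 2) = r ^+ 2 * r ^+ 2.
  move=> hx hy d; have dn : dist u v != 0 by rewrite gt_eqF.
  apply: (mulfI dn).
  have -> : dist u v * (dist u v * (a ^+ 2 + b ^+ 2)) = (dist u v * a) ^+ 2 + (dist u v * b)
    ^+ 2 by ring.
  by rewrite -hx -hy [in RHS]/dist; ring.
have s1 := size _ _ cx cy d0; have s2 := size _ _ cx' cy' d0'.
have ab0 : a ^+ 2 + b ^+ 2 != 0.
  by apply/eqP => h; move: s1; rewrite h mulr0 => /esym/eqP; rewrite mulf_eq0 (negbTE r2).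
have dd : dist x y = dist x' y' by apply: (mulIf ab0); rewrite s1 s2.
have hx : x - ox = x' - ox by apply: (mulfI r2); rewrite cx cx' dd.
have hy : y - oy = y' - oy by apply: (mulfI r2); rewrite cy cy' dd.
by split; [apply: (addIr (- ox))|apply: (addIr (- oy))].
Qed.

Lemma inv_abscissa_mono a b : cut < a -> a < b -> b < cut + pi *+ 2 ->
  inv_abscissa (r * cos a) (r * sin a) < inv_abscissa (r * cos b) (r * sin b).
Proof.
have on_circle c : cut < c -> c < cut + pi *+ 2 -> let h := (c - cut) / 2 in
    0 < sin h /\ inv_abscissa (r * cos c) (r * sin c) = - (cos h / sin h) / 2.
  move=> lo hi h; have sh : 0 < sin h.
    apply: sin_gt0_pi; rewrite mulr2n in hi; rewrite /h; apply/andP; split; lra.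
  split => //; have sn : sin h != 0 by rewrite gt_eqF.
  have rn : r != 0 by rewrite gt_eqF.
  have cE : c = cut + h + h by rewrite /h; lra.
  have cs' := cos2Dsin2 cut.
  rewrite /inv_abscissa /dist /ox /oy.
  have -> : r * cos c * (r * sin cut) - r * sin c * (r * cos cut) =
      - (r ^+ 2 * (2 * (sin h * cos h))).
    transitivity (- (r ^+ 2 * sin (c - cut))); first by rewrite sinB; ring.
    have -> : c - cut = h *+ 2 by rewrite mulr2n cE; ring.
    by rewrite sin_mulr2n; ring.
  have -> : (r * cos c - r * cos cut) ^+ 2 + (r * sin c - r * sin cut) ^+ 2 =
      r ^+ 2 * (4 * sin h ^+ 2).
    transitivity (r ^+ 2 * (2 - 2 * cos (c - cut))).
      have cc := cos2Dsin2 c; rewrite cosB.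
      transitivity (r ^+ 2 * ((cos c ^+ 2 + sin c ^+ 2) + (cos cut ^+ 2 + sin cut ^+ 2)
        - 2 * (cos c * cos cut + sin c * sin cut))); first by ring.
      by rewrite cc cs'; ring.
    have -> : c - cut = h *+ 2 by rewrite mulr2n cE; ring.
    by rewrite cos_mulr2n cos2sin2; ring.
  by field; rewrite sn rn.
move=> ca ab bc; have [sa ->] := on_circle a ca (lt_trans ab bc).
have [sb ->] := on_circle b (lt_trans ca ab) bc.
set h := (a - cut) / 2 in sa *; set h' := (b - cut) / 2 in sb *.
rewrite -subr_gt0.
have -> : - (cos h' / sin h') / 2 - - (cos h / sin h) / 2 = sin (h' - h) / (sin h * sin h') / 2.
  by rewrite sinB; field; rewrite !gt_eqF.
rewrite !divr_gt0 ?mulr_gt0 //; apply: sin_gt0_pi; rewrite mulr2n in bc.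
by rewrite /h /h'; apply/andP; split; lra.
Qed.

Lemma inv_abscissa_lt a b : cut < a < cut + pi *+ 2 -> cut < b < cut + pi *+ 2 ->
  (inv_abscissa (r * cos a) (r * sin a) < inv_abscissa (r * cos b) (r * sin b)) = (a < b).
Proof.
move=> /andP[a1 a2] /andP[b1 b2]; have [ab|ab|->] := ltgtP a b.
- by rewrite inv_abscissa_mono.
- by apply/negbTE; rewrite -leNgt ltW // inv_abscissa_mono.
- by rewrite ltxx.
Qed.

Lemma inv_ordinate_circle a : inv_ordinate (r * cos a) (r * sin a) = 0.
Proof. by rewrite /inv_ordinate !exprMn -mulrDr cos2Dsin2 mulr1 subrr mul0r. Qed.

(* The inversion centred at a point of the circle turns the circle into a line,
   so that [halfplane_crossing] applies both inside and outside. *)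
Lemma circle_crossing (inside : bool) (X1 Y1 X2 Y2 : R -> R) a b c d :
  continuous X1 -> continuous Y1 -> continuous X2 -> continuous Y2 ->
  (forall t, (X1 t, Y1 t) <> (ox, oy)) -> (forall t, (X2 t, Y2 t) <> (ox, oy)) ->
  (forall t, 0 <= t <= 1 -> if inside then X1 t ^+ 2 + Y1 t ^+ 2 <= r ^+ 2
                            else r ^+ 2 <= X1 t ^+ 2 + Y1 t ^+ 2) ->
  (forall t, 0 <= t <= 1 -> if inside then X2 t ^+ 2 + Y2 t ^+ 2 <= r ^+ 2
                            else r ^+ 2 <= X2 t ^+ 2 + Y2 t ^+ 2) ->
  X1 0 = r * cos a -> Y1 0 = r * sin a -> X1 1 = r * cos b -> Y1 1 = r * sin b ->
  X2 0 = r * cos c -> Y2 0 = r * sin c -> X2 1 = r * cos d -> Y2 1 = r * sin d ->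
  cut < a < cut + pi *+ 2 -> cut < b < cut + pi *+ 2 ->
  cut < c < cut + pi *+ 2 -> cut < d < cut + pi *+ 2 ->
  (a < c) (+) (a < d) (+) (b < c) (+) (b < d) ->
  exists s t : R, [/\ 0 <= s <= 1, 0 <= t <= 1, X1 s = X2 t & Y1 s = Y2 t].
Proof.
move=> cX1 cY1 cX2 cY2 o1 o2 in1 in2 x10 y10 x11 y11 x20 y20 x21 y21 ha hb hc hd par.
pose sg : R := (-1) ^+ (~~ inside).
pose U (X Y : R -> R) t := inv_abscissa (X t) (Y t).
pose V (X Y : R -> R) t := sg * inv_ordinate (X t) (Y t).
have cdist (X Y : R -> R) : continuous X -> continuous Y -> continuous (fun t => dist (X t)
  (Y t)).
  move=> cX cY t; apply: cvgD; apply: cvgM; apply: cvgB;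
    (exact: cX || exact: cY || exact: cvg_cst).
have cU (X Y : R -> R) : continuous X -> continuous Y -> (forall t, (X t, Y t) <> (ox, oy)) ->
    continuous (U X Y).
  move=> cX cY no t; apply: cvgM.
    by apply: cvgB; apply: cvgM; (exact: cX || exact: cY || exact: cvg_cst).
  by apply: cvgV; [rewrite gt_eqF // dist_gt0|apply: cdist].
have cV (X Y : R -> R) : continuous X -> continuous Y -> (forall t, (X t, Y t) <> (ox, oy)) ->
    continuous (V X Y).
  move=> cX cY no t; apply: cvgM; first exact: cvg_cst; apply: cvgM.
    apply: cvgB; first exact: cvg_cst.
    by apply: cvgD; apply: cvgM; (exact: cX || exact: cY).
  by apply: cvgV; [rewrite gt_eqF // dist_gt0|apply: cdist].
have V0 (X Y : R -> R) : (forall t, (X t, Y t) <> (ox, oy)) ->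
   (forall t, 0 <= t <= 1 -> if inside then X t ^+ 2 + Y t ^+ 2 <= r ^+ 2
                            else r ^+ 2 <= X t ^+ 2 + Y t ^+ 2) ->
   forall t, 0 <= t <= 1 -> 0 <= V X Y t.
  move=> no side t /side; rewrite /V /sg /inv_ordinate; have := dist_gt0 (no t).
  move: (dist _ _) => e e0; case: (inside) => h /=.
    by rewrite expr0 mul1r divr_ge0 ?subr_ge0 // ltW.
  by rewrite expr1 mulN1r -mulNr opprB divr_ge0 ?subr_ge0 // ltW.
have [|||||||s [t [s01 t01 eU eV]]] := halfplane_crossing (cU _ _ cX1 cY1 o1)
  (cV _ _ cX1 cY1 o1)
    (cU _ _ cX2 cY2 o2) (cV _ _ cX2 cY2 o2).
- exact: V0.
- exact: V0.
- by rewrite /V x10 y10 inv_ordinate_circle mulr0.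
- by rewrite /V x11 y11 inv_ordinate_circle mulr0.
- by rewrite /V x20 y20 inv_ordinate_circle mulr0.
- by rewrite /V x21 y21 inv_ordinate_circle mulr0.
- by rewrite /U x10 y10 x11 y11 x20 y20 x21 y21 !inv_abscissa_lt.
have [] := @inversion_inj _ _ _ _ (o1 s) (o2 t) eU.
  by apply: (mulfI _ eV); rewrite /sg signr_eq0.
by move=> eX eY; exists s, t.
Qed.

End Inversion.

(** * Cylindrical drawings *)

Section OneSide.
Local Open Scope classical_set_scope.
Local Open Scope ring_scope.
Variable R : realType.
Implicit Types f : R -> R.

Lemma stays_below f (rho : R) : continuous f -> (forall t, 0 < t < 1 -> f t != rho) ->
  forall s t, 0 <= s <= 1 -> 0 < t < 1 -> f s < rho -> f t < rho.
Proof.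
move=> cf ne s t /andP[s0 s1] t01 fs; rewrite ltNge; apply/negP => ft.
have [st|ts] := lerP s t.
  have [|u] := IVT st (continuous_subspaceT cf) (v := rho).
    by rewrite ge_min le_max (ltW fs) ft orbT.
  rewrite in_itv /= => /andP[su ut] fu.
  have su' : s < u by rewrite lt_neqAle su andbT; apply: contraTneq fs => ->; rewrite fu ltxx.
  have /negP[] := ne u ltac:(case/andP: t01 => ? ?; apply/andP; split; lra).
  by rewrite fu.
have [|u] := IVT (ltW ts) (continuous_subspaceT cf) (v := rho).
  by rewrite ge_min le_max (ltW fs) ft orbT.
rewrite in_itv /= => /andP[su ut] fu.
have su' : u < s by rewrite lt_neqAle ut andbT; apply: contraTneq fs => <-; rewrite fu ltxx.
have /negP[] := ne u ltac:(case/andP: t01 => ? ?; apply/andP; split; lra).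
by rewrite fu.
Qed.

Lemma stays_above f (rho : R) : continuous f -> (forall t, 0 < t < 1 -> f t != rho) ->
  forall s t, 0 <= s <= 1 -> 0 < t < 1 -> rho < f s -> rho < f t.
Proof.
move=> cf ne s t s01 t01 fs; rewrite -ltrN2.
apply: (@stays_below (\- f) (- rho) _ _ s) => //; last by rewrite ltrN2.
  by move=> x; apply: cvgN; apply: cf.
by move=> u u01; rewrite eqr_opp ne.
Qed.

Lemma continuous_compose f g :
  continuous f -> continuous g -> continuous (fun t => g (f t) : R).
Proof. by move=> cf cg t; exact: (@continuous_comp _ _ _ f g t (cf t) (cg (f t))). Qed.

Definition clamp (t : R) : R := Num.max 0 (Num.min 1 t).

Lemma clamp01 t : 0 <= clamp t <= 1.
Proof. by rewrite /clamp le_max lexx /= ge_max ler01 ge_min lexx. Qed.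

Lemma clampK t : 0 <= t <= 1 -> clamp t = t.
Proof. by case/andP => t0 t1; rewrite /clamp min_r // max_r. Qed.

Lemma continuous_clamp : continuous clamp.
Proof.
move=> t; apply: (@continuous_max R R (fun=> 0) (fun t => Num.min 1 t) t); first exact: cvg_cst.
by apply: (@continuous_min R R (fun=> 1) (fun t : R => t) t); [exact: cvg_cst|exact: cvg_id].
Qed.

Lemma simple_arc_path (p q : R * R) (A : set (R * R)) : simple_arc p q A ->
  exists X Y : R -> R, [/\ continuous X /\ continuous Y, (X 0, Y 0) = p /\ (X 1, Y 1) = q,
    forall t, X t = X (clamp t) /\ Y t = Y (clamp t),
    forall t, A (X t, Y t) &
    forall s t, 0 <= s <= 1 -> 0 <= t <= 1 -> X s = X t -> Y s = Y t -> s = t].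
Proof.
case=> g [cg ig g0 g1 gA].
have cgc : continuous (g \o clamp).
  move=> t; have ct : `[0, 1]%classic (clamp t) by rewrite /= in_itv /= clamp01.
  move/subspace_continuousP : cg => /(_ (clamp t) ct) cgt.
  apply: cvg_comp cgt => U; rewrite /within /= => hU.
  have H : nbhs t [set u | `[0, 1]%classic (clamp u) ->
    U (clamp u)] := @continuous_clamp t _ hU.
  change (nbhs t [set u | U (clamp u)]); apply: filterS H => u /=; apply.
  by rewrite in_itv /= clamp01.
exists (fst \o g \o clamp), (snd \o g \o clamp); split.
- split=> t; first by apply: (continuous_comp (f := g \o clamp) (g := fst));
  [exact: cgc|exact: cvg_fst].
  by apply: (continuous_comp (f := g \o clamp) (g := snd)); [exact: cgc|exact: cvg_snd].
- by rewrite /= !clampK ?lexx ?ler01 // -!surjective_pairing.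
- by move=> t /=; rewrite (clampK (clamp01 t)).
- move=> t /=; rewrite -surjective_pairing -gA; exists (clamp t) => //=.
  by rewrite in_itv /= clamp01.
- move=> s t s01 t01 /=; rewrite !clampK // => e1 e2; apply: ig; rewrite ?inE /= ?in_itv //.
  by rewrite [g s]surjective_pairing [g t]surjective_pairing e1 e2.
Qed.

End OneSide.

Lemma complete_edge n (u v : 'I_n) : u != v -> [set u; v]%SET \in edges (complete_graph n).
Proof. by move=> uv; rewrite inE cards2 uv. Qed.

Section CylindricalDrawing.
Local Open Scope classical_set_scope.
Local Open Scope ring_scope.
Variables (R : realType) (n : nat) (D : drawing R (complete_graph n)).
Variables (c : R * R) (r1 r2 : R).
Hypotheses (r1_gt0 : 0 < r1) (r1_lt_r2 : r1 < r2).
Hypothesis vertex_on_circle : forall v, (circle c r1 `|` circle c r2) (vpoint D v).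
Hypothesis curve_off_circles : forall e, e \in edges (complete_graph n) ->
  curve D e `&` (circle c r1 `|` circle c r2) `<=` endvertices D e.

Definition xpos (v : 'I_n) : R := (vpoint D v).1 - c.1.
Definition ypos (v : 'I_n) : R := (vpoint D v).2 - c.2.
Definition inner v := xpos v ^+ 2 + ypos v ^+ 2 == r1 ^+ 2.
Definition radius v := if inner v then r1 else r2.

Lemma r2_gt0 : 0 < r2. Proof. exact: lt_trans r1_lt_r2. Qed.

Lemma r1_sqr_lt : r1 ^+ 2 < r2 ^+ 2.
Proof. by rewrite ltr_pXn2r // nnegrE ltW // r2_gt0. Qed.

Lemma radius_gt0 v : 0 < radius v.
Proof. by rewrite /radius; case: ifP => _ //; exact: r2_gt0. Qed.

Lemma pos_norm v : xpos v ^+ 2 + ypos v ^+ 2 = radius v ^+ 2.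
Proof.
rewrite /radius; case: ifP => [/eqP //|/negbT ne].
by case: (vertex_on_circle v) => //= E; move: ne; rewrite /inner E eqxx.
Qed.

Definition is_path u v (X Y : R -> R) := [/\ continuous X /\ continuous Y,
  (X 0 = xpos u /\ Y 0 = ypos u) /\ (X 1 = xpos v /\ Y 1 = ypos v),
  forall t, X t = X (clamp t) /\ Y t = Y (clamp t),
  forall t, curve D [set u; v]%SET (c.1 + X t, c.2 + Y t) &
  forall s t, 0 <= s <= 1 -> 0 <= t <= 1 -> X s = X t -> Y s = Y t -> s = t].

Lemma path_exists u v : u != v -> exists p : (R -> R) * (R -> R), is_path u v p.1 p.2.
Proof.
move=> uv; have [X [Y [[cX cY] [e0 e1] XYc XYin XYinj]]] :=
  simple_arc_path (curve_arc D (complete_edge uv)).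
exists (fun t => X t - c.1, fun t => Y t - c.2); split => /=.
- by split=> t; apply: cvgB; (exact: cX || exact: cY || exact: cvg_cst).
- by rewrite /xpos /ypos -e0 -e1.
- by move=> t; case: (XYc t) => <- <-.
- by move=> t; rewrite !(addrC _ (_ - _)) !subrK.
- by move=> s t s01 t01 /addIr eX /addIr eY; apply: XYinj.
Qed.

Section Paths.
Variables PX PY : 'I_n -> 'I_n -> R -> R.
Hypothesis P_path : forall u v, u != v -> is_path u v (PX u v) (PY u v).

Definition nsq u v t := PX u v t ^+ 2 + PY u v t ^+ 2.

Lemma nsq_continuous u v : u != v -> continuous (nsq u v).
Proof.
move=> /P_path[[cX cY] _ _ _ _] t.
by apply: cvgD; apply: cvgM; (exact: cX || exact: cY).
Qed.

Lemma nsq0 u v : u != v -> nsq u v 0 = radius u ^+ 2.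
Proof. by move=> /P_path[_ [[eX eY] _] _ _ _]; rewrite /nsq eX eY pos_norm. Qed.

Lemma nsq1 u v : u != v -> nsq u v 1 = radius v ^+ 2.
Proof. by move=> /P_path[_ [_ [eX eY]] _ _ _]; rewrite /nsq eX eY pos_norm. Qed.

Definition point u v t : R * R := (c.1 + PX u v t, c.2 + PY u v t).

Lemma point0 u v : u != v -> point u v 0 = vpoint D u.
Proof.
move=> /P_path[_ [[eX eY] _] _ _ _]; rewrite /point eX eY /xpos /ypos.
by rewrite !(addrC _ (_ - _)) !subrK -surjective_pairing.
Qed.

Lemma point1 u v : u != v -> point u v 1 = vpoint D v.
Proof.
move=> /P_path[_ [_ [eX eY]] _ _ _]; rewrite /point eX eY /xpos /ypos.
by rewrite !(addrC _ (_ - _)) !subrK -surjective_pairing.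
Qed.

Lemma point_inj u v s t : u != v -> 0 <= s <= 1 -> 0 <= t <= 1 ->
  point u v s = point u v t -> s = t.
Proof.
by move=> /P_path[_ _ _ _ inj] s01 t01 [/addrI eX /addrI eY]; apply: inj.
Qed.

Lemma point_interior u v t : u != v -> 0 < t < 1 -> curve_interior D [set u;
  v]%SET (point u v t).
Proof.
move=> uv /andP[t0 t1]; have [_ _ _ inc _] := P_path uv.
have t01 : 0 <= t <= 1 by rewrite !ltW.
split; first exact: inc.
case=> w /= /set2P[] -> /=.
  rewrite -(point0 uv) => /(point_inj uv) E; move: t0.
  by rewrite -E ?lexx ?ler01 ?ltxx.
rewrite -(point1 uv) => /(point_inj uv) E; move: t1.
by rewrite -E ?lexx ?ler01 ?ltxx.
Qed.

Lemma nsq_off u v t : u != v -> 0 < t < 1 -> nsq u v t != r1 ^+ 2 /\ nsq u v t != r2 ^+ 2.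
Proof.
move=> uv t01; have [inc noend] := point_interior uv t01.
have off r : (r = r1 \/ r = r2) -> nsq u v t != r ^+ 2.
  move=> rr; apply/eqP => E; apply: noend; apply: (curve_off_circles (complete_edge uv)).
  split=> //; have : circle c r (point u v t) by rewrite /circle /= !(addrC c.1, addrC c.2)
    !addrK.
  by case: rr => ->; [left|right].
by split; apply: off; [left|right].
Qed.

Lemma nsq_spoke u v t : inner u != inner v -> 0 < t < 1 -> r1 ^+ 2 < nsq u v t < r2 ^+ 2.
Proof.
move=> iuv t01; have uv : u != v by apply: contraNneq iuv => ->.
have off1 s (s01 : 0 < s < 1) := (nsq_off uv s01).1.
have off2 s (s01 : 0 < s < 1) := (nsq_off uv s01).2.
have cn := nsq_continuous uv; have n0 := nsq0 uv; have n1 := nsq1 uv.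
have u0 : 0 <= (0 : R) <= 1 by rewrite lexx ler01.
have u1 : 0 <= (1 : R) <= 1 by rewrite lexx ler01.
move: n0 n1 iuv; rewrite /radius.
case: (inner u); case: (inner v) => // n0 n1 _.
  rewrite (stays_above cn off1 u1 t01) ?n1 ?r1_sqr_lt //.
  by rewrite (stays_below cn off2 u0 t01) // n0 r1_sqr_lt.
rewrite (stays_above cn off1 u0 t01) ?n0 ?r1_sqr_lt //.
by rewrite (stays_below cn off2 u1 t01) // n1 r1_sqr_lt.
Qed.

Definition in_annulus u v := r1 ^+ 2 < nsq u v (1 / 2) < r2 ^+ 2.

Lemma half01 : 0 < (1 / 2 : R) < 1. Proof. by apply/andP; split; lra. Qed.

Lemma nsq_chord u v t : u != v -> inner u = inner v -> 0 < t < 1 ->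
  if in_annulus u v then r1 ^+ 2 < nsq u v t < r2 ^+ 2
  else if inner u then nsq u v t < r1 ^+ 2 else r2 ^+ 2 < nsq u v t.
Proof.
move=> uv iuv t01.
have off1 s (s01 : 0 < s < 1) := (nsq_off uv s01).1.
have off2 s (s01 : 0 < s < 1) := (nsq_off uv s01).2.
have cn := nsq_continuous uv; have n0 := nsq0 uv.
have u0 : 0 <= (0 : R) <= 1 by rewrite lexx ler01.
have h01 : 0 <= (1 / 2 : R) <= 1 by apply/andP; split; lra.
have o1 := off1 _ half01; have o2 := off2 _ half01.
rewrite /in_annulus; case: ifP => [/andP[lo hi]|/negbT].
  by rewrite (stays_above cn off1 h01 t01 lo) (stays_below cn off2 h01 t01 hi).
move: n0; rewrite /radius; case: (inner u) => n0.
  have -> : nsq u v (1 / 2) < r2 ^+ 2.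
    by apply: (stays_below cn off2 u0 half01); rewrite n0 r1_sqr_lt.
  rewrite andbT -leNgt le_eqVlt (negbTE o1) /=.
  exact: (stays_below cn off1 h01 t01).
have -> : r1 ^+ 2 < nsq u v (1 / 2).
  by apply: (stays_above cn off1 u0 half01); rewrite n0 r1_sqr_lt.
rewrite /= -leNgt le_eqVlt eq_sym (negbTE o2) /=.
exact: (stays_above cn off2 h01 t01).
Qed.

Lemma nsq_spoke_le u v t : inner u != inner v -> 0 <= t <= 1 ->
  r1 ^+ 2 <= nsq u v t <= r2 ^+ 2.
Proof.
move=> iuv /andP[t0 t1]; have uv : u != v by apply: contraNneq iuv => ->.
have ends w : r1 ^+ 2 <= radius w ^+ 2 <= r2 ^+ 2.
  by rewrite /radius; case: (inner w); rewrite lexx (ltW r1_sqr_lt).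
have [->|t_neq0] := eqVneq t 0; first by rewrite nsq0.
have [->|t_neq1] := eqVneq t 1; first by rewrite nsq1.
have t01 : 0 < t < 1 by rewrite !lt_neqAle t0 t1 eq_sym t_neq0 t_neq1.
by have /andP[/ltW -> /ltW ->] := nsq_spoke iuv t01.
Qed.

Lemma nsq_chord_le u v t : u != v -> inner u = inner v -> 0 <= t <= 1 ->
  if inner u (+) in_annulus u v then nsq u v t <= radius u ^+ 2 else radius u ^+ 2 <= nsq u v t.
Proof.
move=> uv iuv /andP[t0 t1].
have rv : radius v = radius u by rewrite /radius iuv.
have [->|t_neq0] := eqVneq t 0; first by rewrite nsq0 // lexx if_same.
have [->|t_neq1] := eqVneq t 1; first by rewrite nsq1 // rv lexx if_same.
have t01 : 0 < t < 1 by rewrite !lt_neqAle t0 t1 eq_sym t_neq0 t_neq1.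
have := nsq_chord uv iuv t01; rewrite /radius.
case: (in_annulus u v) => [/andP[h1 h2]|]; first by case: (inner u) => /=; apply: ltW.
by case: (inner u) => /= /ltW.
Qed.

Lemma path_clamp u v t : u != v -> PX u v t = PX u v (clamp t) /\ PY u v t = PY u v (clamp t).
Proof. by move=> /P_path[_ _ cl _ _]; apply: cl. Qed.

Variable ang : 'I_n -> R.
Hypothesis ang_bound : forall v, 0 <= ang v < pi *+ 2.
Hypothesis ang_pos : forall v, has_angle (xpos v) (ypos v) (ang v).

Lemma xposE v : xpos v = radius v * cos (ang v).
Proof.
have [_ [e _]] := has_angle_norm (ang_pos v); rewrite [LHS]e.
by rewrite pos_norm sqrtr_sqr gtr0_norm // radius_gt0.
Qed.

Lemma yposE v : ypos v = radius v * sin (ang v).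
Proof.
have [_ [_ e]] := has_angle_norm (ang_pos v); rewrite [LHS]e.
by rewrite pos_norm sqrtr_sqr gtr0_norm // radius_gt0.
Qed.

Section Cut.
Variable cut : R.
Hypothesis cut_lt0 : cut < 0.
Hypothesis ang_cut : forall v, ang v < cut + pi *+ 2.

Lemma cut_ang v : cut < ang v < cut + pi *+ 2.
Proof. by rewrite ang_cut andbT (lt_le_trans cut_lt0) //; case/andP: (ang_bound v). Qed.

Lemma vertex_avoids_cut r v : 0 < r -> (xpos v, ypos v) <> (r * cos cut, r * sin cut).
Proof.
move=> r0 [eX eY]; have [|k E] := @has_angle_inj R (xpos v) (ypos v) cut (ang v) _ (ang_pos v).
  by exists r.
have := cut_ang v; rewrite E ltrDl ltrD2l => /andP[k0 k1].
have p0 : 0 < (pi : R) *+ 2 by rewrite pmulrn_lgt0 ?pi_gt0.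
rewrite pmulr_lgt0 // ltr0z in k0; rewrite gtr_pMl // in k1.
by rewrite -[1]/(1%:~R) ltr_int in k1; lia.
Qed.

Lemma path_avoids_cut u v w t : u != v ->
  (PX u v t, PY u v t) <> (radius w * cos cut, radius w * sin cut).
Proof.
move=> uv; have [-> ->] := path_clamp t uv; move: (clamp t) (clamp01 t) => {}t /andP[t0 t1].
have [_ [[X0 Y0] [X1 Y1]] _ _ _] := P_path uv.
have [->|t_neq0] := eqVneq t 0; first by rewrite X0 Y0; apply/vertex_avoids_cut/radius_gt0.
have [->|t_neq1] := eqVneq t 1; first by rewrite X1 Y1; apply/vertex_avoids_cut/radius_gt0.
have t01 : 0 < t < 1 by rewrite !lt_neqAle t0 t1 eq_sym t_neq0 t_neq1.
move=> [eX eY]; have : nsq u v t = radius w ^+ 2.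
  by rewrite /nsq eX eY !exprMn -mulrDr cos2Dsin2 mulr1.
have [/eqP n1 /eqP n2] := nsq_off uv t01.
by rewrite /radius; case: ifP.
Qed.

Lemma same_side_meet a b c' d : a != c' -> b != d ->
  inner a = inner c' -> inner a = inner b -> inner b = inner d ->
  in_annulus a c' = in_annulus b d ->
  (ang a < ang b) (+) (ang a < ang d) (+) (ang c' < ang b) (+) (ang c' < ang d) ->
  exists s t, point a c' s = point b d t.
Proof.
move=> ac bd iac iab ibd ann par.
have [[cX1 cY1] [[X10 Y10] [X11 Y11]] _ _ _] := P_path ac.
have [[cX2 cY2] [[X20 Y20] [X21 Y21]] _ _ _] := P_path bd.
have rc : radius c' = radius a by rewrite /radius iac.
have rb : radius b = radius a by rewrite /radius iab.
have rd : radius d = radius a by rewrite /radius iab ibd.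
have [|||||||||||||||s [t [s01 t01 eX eY]]] := @circle_crossing R (radius a) cut (radius_gt0 a)
  (inner a (+) in_annulus a c') _ _ _ _ (ang a) (ang c') (ang b) (ang d) cX1 cY1 cX2 cY2
  (fun t => path_avoids_cut ac) (fun t => path_avoids_cut bd).
- by move=> t t01; apply: nsq_chord_le.
- by move=> t t01; rewrite iab ann -rb; apply: nsq_chord_le.
- by rewrite X10 xposE.
- by rewrite Y10 yposE.
- by rewrite X11 xposE rc.
- by rewrite Y11 yposE rc.
- by rewrite X20 xposE rb.
- by rewrite Y20 yposE rb.
- by rewrite X21 xposE rd.
- by rewrite Y21 yposE rd.
- exact: cut_ang.
- exact: cut_ang.
- exact: cut_ang.
- exact: cut_ang.
- exact: par.
by exists s, t; rewrite /point eX eY.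
Qed.

(* The spokes [c' u] and [v d], joined by an arc of the other circle, form a path
   with both ends on the circle of [a] and [b]. *)
Lemma separated_meet a b c' d u v : a != b -> inner a = inner b ->
  inner c' = inner a -> inner d = inner a -> inner u != inner a -> inner v != inner a ->
  in_annulus a b ->
  (ang a < ang c') (+) (ang a < ang d) (+) (ang b < ang c') (+) (ang b < ang d) ->
  (exists s t, point a b s = point c' u t) \/ (exists s t, point a b s = point v d t).
Proof.
move=> ab iab ic id iu iv ann par.
have icu : inner c' != inner u by rewrite ic eq_sym.
have ivd : inner v != inner d by rewrite id.
have cu : c' != u by apply: contraNneq icu => ->.
have vd : v != d by apply: contraNneq ivd => ->.
have [[cX1 cY1] [[X10 Y10] [X11 Y11]] _ _ _] := P_path ab.
have [[cX2 cY2] [[X20 Y20] [X21 Y21]] _ _ _] := P_path cu.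
have [[cX3 cY3] [[X30 Y30] [X31 Y31]] _ _ _] := P_path vd.
have rb : radius b = radius a by rewrite /radius iab.
have rc : radius c' = radius a by rewrite /radius ic.
have rd : radius d = radius a by rewrite /radius id.
have rv : radius v = radius u.
  by rewrite /radius; case: (inner v) iv; case: (inner u) iu; case: (inner a).
have ru : radius u != radius a.
  by rewrite /radius; case: (inner u) iu; case: (inner a) => // _; rewrite ?(gt_eqF r1_lt_r2)
    ?(lt_eqF r1_lt_r2).
pose arc t := ang u + t * (ang v - ang u).
pose AX t := radius u * cos (arc t); pose AY t := radius u * sin (arc t).
have carc : continuous arc.
  by move=> t; apply: cvgD; [exact: cvg_cst|apply: cvgM; [exact: cvg_id|exact: cvg_cst]].
have cAX : continuous AX.
  move=> t; apply: cvgM; first exact: cvg_cst.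
  exact: (continuous_compose carc (@continuous_cos R)).
have cAY : continuous AY.
  move=> t; apply: cvgM; first exact: cvg_cst.
  exact: (continuous_compose carc (@continuous_sin R)).
pose k (i : nat) (t : R) := clamp (3 * t - i%:R).
have ck i : continuous (k i).
  apply: (continuous_compose (f := fun t => 3 * t - i%:R)); last exact: continuous_clamp.
  by move=> t; apply: cvgB; [apply: cvgM; [exact: cvg_cst|exact: cvg_id]|exact: cvg_cst].
pose join (f g h : R -> R) t := f (k 0%N t) + (g (k 1%N t) - g 0) + (h (k 2%N t) - h 0).
have cjoin (f g h : R -> R) : continuous f -> continuous g -> continuous h ->
  continuous (join f g h).
  move=> cf cg ch t; apply: cvgD; first apply: cvgD.
  - exact: (continuous_compose (ck _) cf).
  - by apply: cvgB; [exact: (continuous_compose (ck _) cg)|exact: cvg_cst].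
  - by apply: cvgB; [exact: (continuous_compose (ck _) ch)|exact: cvg_cst].
have clamp_le0 (t : R) : t <= 0 -> clamp t = 0.
  by move=> t0; rewrite /clamp max_l // ge_min t0 orbT.
have clamp_ge1 (t : R) : 1 <= t -> clamp t = 1.
  by move=> t1; rewrite /clamp min_l // max_r.
have joinE t : exists i, exists2 w : R, 0 <= w <= 1 & forall f g h : R -> R, f 1 = g 0 ->
  g 1 = h 0 ->
    join f g h t = if i == 0%N then f w else if i == 1%N then g w else h w.
  have [t1|t1] := lerP (3 * t) 1.
    exists 0%N; exists (k 0%N t); first exact: clamp01.
    move=> f g h _ _; rewrite /join /k (clamp_le0 (3 * t - 1)) ?(clamp_le0 (3 * t - 2));
      try lra.
    by rewrite !subrr !addr0.
  have [t2|t2] := lerP (3 * t) 2.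
    exists 1%N; exists (k 1%N t); first exact: clamp01.
    move=> f g h fg _; rewrite /join /k (clamp_ge1 (3 * t - 0)) ?(clamp_le0 (3 * t - 2));
      try lra.
    by rewrite fg /=; ring.
  exists 2%N; exists (k 2%N t); first exact: clamp01.
  move=> f g h fg gh; rewrite /join /k (clamp_ge1 (3 * t - 0)) ?(clamp_ge1 (3 * t - 1));
    try lra.
  by rewrite fg gh /=; ring.
have AX0 : PX c' u 1 = AX 0 by rewrite X21 xposE /AX /arc mul0r addr0.
have AY0 : PY c' u 1 = AY 0 by rewrite Y21 yposE /AY /arc mul0r addr0.
have AX1 : AX 1 = PX v d 0 by rewrite X30 xposE rv /AX /arc mul1r addrC subrK.
have AY1 : AY 1 = PY v d 0 by rewrite Y30 yposE rv /AY /arc mul1r addrC subrK.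
pose X2 := join (PX c' u) AX (PX v d); pose Y2 := join (PY c' u) AY (PY v d).
have arc_norm t : AX t ^+ 2 + AY t ^+ 2 = radius u ^+ 2.
  by rewrite /AX /AY !exprMn -mulrDr cos2Dsin2 mulr1.
have XYE t : exists2 w : R, 0 <= w <= 1 & [\/ X2 t = PX c' u w /\ Y2 t = PY c' u w,
    X2 t = AX w /\ Y2 t = AY w | X2 t = PX v d w /\ Y2 t = PY v d w].
  have [i [w w01 E]] := joinE t; exists w => //.
  rewrite /X2 /Y2 !E //; case: (i == 0%N); first by apply: Or31.
  by case: (i == 1%N); [apply: Or32|apply: Or33].
have radius_range w : r1 ^+ 2 <= radius w ^+ 2 <= r2 ^+ 2.
  by rewrite /radius; case: (inner w); rewrite lexx (ltW r1_sqr_lt).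
have norm2 t : r1 ^+ 2 <= X2 t ^+ 2 + Y2 t ^+ 2 <= r2 ^+ 2.
  by have [w w01 []] := XYE t; case=> -> ->;
    [exact: nsq_spoke_le|rewrite arc_norm|exact: nsq_spoke_le].
have sq_inj (x y : R) : 0 < x -> 0 < y -> x ^+ 2 = y ^+ 2 -> x = y.
  by move=> x0 y0 /eqP; rewrite eqrXn2 ?ltW // => /eqP.
have avoid2 t : (X2 t, Y2 t) <> (radius a * cos cut, radius a * sin cut).
  have [w w01 []] := XYE t; case=> -> ->; [exact: path_avoids_cut| |exact: path_avoids_cut].
  move=> [eX eY]; have := arc_norm w; rewrite eX eY !exprMn -mulrDr cos2Dsin2 mulr1.
  by move=> /sq_inj E; move: ru; rewrite E ?eqxx // radius_gt0.
have k00 : k 0%N 0 = 0 by rewrite /k clamp_le0 //; lra.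
have k10 : k 1%N 0 = 0 by rewrite /k clamp_le0 //; lra.
have k20 : k 2%N 0 = 0 by rewrite /k clamp_le0 //; lra.
have k01 : k 0%N 1 = 1 by rewrite /k clamp_ge1 //; lra.
have k11 : k 1%N 1 = 1 by rewrite /k clamp_ge1 //; lra.
have k21 : k 2%N 1 = 1 by rewrite /k clamp_ge1 //; lra.
have [|||||||||||||||s [t [s01 t01 eX eY]]] := @circle_crossing R (radius a) cut (radius_gt0 a)
  (~~ inner a) _ _ _ _ (ang a) (ang b) (ang c') (ang d) cX1 cY1
  (cjoin _ _ _ cX2 cAX cX3) (cjoin _ _ _ cY2 cAY cY3)
  (fun t => path_avoids_cut ab) avoid2.
- by move=> t t01; have := nsq_chord_le ab iab t01; rewrite ann addbT.
- move=> t _; have := norm2 t; rewrite /radius.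
  by case: (inner a) => /= /andP[].
- by rewrite X10 xposE.
- by rewrite Y10 yposE.
- by rewrite X11 xposE rb.
- by rewrite Y11 yposE rb.
- by rewrite /join k00 k10 k20 !subrr !addr0 X20 xposE rc.
- by rewrite /join k00 k10 k20 !subrr !addr0 Y20 yposE rc.
- by rewrite /join k01 k11 k21 AX0 AX1 X31 xposE rd; ring.
- by rewrite /join k01 k11 k21 AY0 AY1 Y31 yposE rd; ring.
- exact: cut_ang.
- exact: cut_ang.
- exact: cut_ang.
- exact: cut_ang.
- exact: par.
have [w w01 []] := XYE t; rewrite -/X2 -/Y2 in eX eY; rewrite -eX -eY => -[wX wY].
- by left; exists s, w; rewrite /point wX wY.
- exfalso; have : nsq a b s = radius u ^+ 2 by rewrite /nsq wX wY arc_norm.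
  case/andP: s01 => s0 s1.
  have [->|s_neq0] := eqVneq s 0.
    by rewrite nsq0 // => /sq_inj E; move: ru; rewrite E ?eqxx // radius_gt0.
  have [->|s_neq1] := eqVneq s 1.
    by rewrite nsq1 // rb => /sq_inj E; move: ru; rewrite E ?eqxx // radius_gt0.
  have s01 : 0 < s < 1 by rewrite !lt_neqAle s0 s1 eq_sym s_neq0 s_neq1.
  have [/eqP n1 /eqP n2] := nsq_off ab s01.
  by rewrite /radius; case: ifP.
- by right; exists s, w; rewrite /point wX wY.
Qed.

End Cut.

Variables (lift : 'I_n -> 'I_n -> R -> R) (turns : 'I_n -> 'I_n -> int).
Hypothesis lift_path : forall i o, inner i -> ~~ inner o -> [/\ continuous (lift i o),
  lift i o 0 = ang i, lift i o 1 = ang o + (turns i o)%:~R * (pi *+ 2) &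
  forall t, 0 <= t <= 1 -> has_angle (PX i o t) (PY i o t) (lift i o t)].

Lemma angle_shift_lt u v (k : int) :
  (ang u + k%:~R * (pi *+ 2) < ang v) = (k < 0) || (k == 0) && (ang u < ang v).
Proof.
have /andP[u0 u1] := ang_bound u; have /andP[v0 v1] := ang_bound v.
have p0 : 0 < (pi : R) *+ 2 by rewrite pmulrn_lgt0 ?pi_gt0.
have [k0|k0|->] /= := ltrgt0P k; last by rewrite mul0r addr0.
  apply/negbTE; rewrite -leNgt; have : 1 * (pi *+ 2) <= k%:~R * (pi *+ 2) :> R.
    by rewrite ler_pM2r // -[1]/(1%:~R) ler_int; lia.
  by lra.
have : k%:~R * (pi *+ 2) <= (-1) * (pi *+ 2) :> R.
  by rewrite ler_pM2r // -[-1]/((-1)%:~R) ler_int; lia.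
by lra.
Qed.

Lemma angle_shift_eq u v (k : int) :
  (ang u + k%:~R * (pi *+ 2) == ang v) = (k == 0) && (ang u == ang v).
Proof.
have := angle_shift_lt v u (- k); rewrite mulrNz mulNr ltrBlDr => E.
rewrite [LHS]eq_le [ang u == _]eq_le !leNgt angle_shift_lt E oppr_lt0 oppr_eq0.
by case: (ltrgt0P k); case: (ang u < ang v); case: (ang v < ang u).
Qed.

Definition reversed i o i' o' (k : int) :=
  let k' := k + turns i o - turns i' o' in
  [/\ ~~ ((k == 0) && (ang i == ang i')), ~~ ((k' == 0) && (ang o == ang o')) &
    ((k < 0) || (k == 0) && (ang i < ang i')) (+) ((k' < 0) || (k' == 0) && (ang o < ang o'))].

Lemma reversed_meet i o i' o' k : inner i -> ~~ inner o -> inner i' -> ~~ inner o' ->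
  reversed i o i' o' k -> exists p : R * R, [/\ 0 < p.1 < 1, 0 < p.2 < 1,
    point i o p.1 = point i' o' p.2 & lift i o p.1 + k%:~R * (pi *+ 2) = lift i' o' p.2].
Proof.
move=> ii oo ii' oo' [ne_start ne_end rev].
have iio : inner i != inner o by rewrite ii (negbTE oo).
have iio' : inner i' != inner o' by rewrite ii' (negbTE oo').
have io : i != o by apply: contraNneq iio => ->.
have io' : i' != o' by apply: contraNneq iio' => ->.
have [c1 s1 e1 a1] := lift_path ii oo; have [c2 s2 e2 a2] := lift_path ii' oo'.
have ri v : inner v -> radius v = r1 by rewrite /radius => ->.
have ro v : ~~ inner v -> radius v = r2 by rewrite /radius => /negbTE ->.
have [Ri Ro Ri' Ro'] := And4 (ri _ ii) (ro _ oo) (ri _ ii') (ro _ oo').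
pose T t := lift i o t + k%:~R * (pi *+ 2).
have cT : continuous T by move=> t; apply: cvgD; [exact: c1|exact: cvg_cst].
have T1 : T 1 - (turns i' o')%:~R * (pi *+ 2) =
    ang o + (k + turns i o - turns i' o')%:~R * (pi *+ 2).
  by rewrite /T e1 intrB intrD; ring.
have endE : (T 1 < lift i' o' 1) = (ang o + (k + turns i o - turns i' o')%:~R * (pi *+ 2)
  < ang o').
  by rewrite e2 -T1 ltrBlDr.
have endE' : (T 1 == lift i' o' 1) = (ang o + (k + turns i o - turns i' o')%:~R * (pi *+ 2)
  == ang o').
  by rewrite e2 -T1 subr_eq.
have [|||||||s [t [s01 t01 eT eN]]] := @strip_crossing R T (nsq i o) (lift i' o') (nsq i' o')
  cT (nsq_continuous io) c2 (nsq_continuous io') (r1 ^+ 2) (r2 ^+ 2).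
- by move=> u; apply: nsq_spoke_le.
- by move=> u; apply: nsq_spoke_le.
- by rewrite nsq0 // ?Ri ?Ri'.
- by rewrite nsq1 // ?Ro ?Ro'.
- by rewrite nsq0 // ?Ri ?Ri'.
- by rewrite nsq1 // ?Ro ?Ro'.
- by rewrite endE /T s1 s2 !angle_shift_lt.
have lt12 := r1_sqr_lt.
have at0 u v w : inner u != inner v -> radius u = r1 -> radius v = r2 -> 0 <= w <= 1 ->
    nsq u v w = r1 ^+ 2 -> w = 0.
  move=> uv ru rv /andP[w0 w1] E; have uv' : u != v by apply: contraNneq uv => ->.
  have [//|w_neq0] := eqVneq w 0; have [w_eq1|w_neq1] := eqVneq w 1.
    by move: E lt12; rewrite w_eq1 nsq1 // rv => ->; rewrite ltxx.
  have w01 : 0 < w < 1 by rewrite !lt_neqAle w0 w1 eq_sym w_neq0 w_neq1.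
  by have := nsq_spoke uv w01; rewrite E ltxx.
have at1 u v w : inner u != inner v -> radius u = r1 -> radius v = r2 -> 0 <= w <= 1 ->
    nsq u v w = r2 ^+ 2 -> w = 1.
  move=> uv ru rv /andP[w0 w1] E; have uv' : u != v by apply: contraNneq uv => ->.
  have [//|w_neq1] := eqVneq w 1; have [w_eq0|w_neq0] := eqVneq w 0.
    by move: E lt12; rewrite w_eq0 nsq0 // ru => ->; rewrite ltxx.
  have w01 : 0 < w < 1 by rewrite !lt_neqAle w0 w1 eq_sym w_neq0 w_neq1.
  by have := nsq_spoke uv w01; rewrite E ltxx andbF.
have start0 : s = 0 -> t = 0 -> False.
  move=> s0 t0; move: eT; rewrite s0 t0 /T s1 s2 => /eqP.
  by rewrite angle_shift_eq (negbTE ne_start).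
have end1 : s = 1 -> t = 1 -> False.
  by move=> s_1 t_1; move/eqP: eT; rewrite s_1 t_1 endE' angle_shift_eq (negbTE ne_end).
have s_neq0 : s != 0.
  apply/eqP => s0; apply: (start0 s0); apply: (at0 i' o') => //.
  by rewrite -eN s0 nsq0 // ?Ri ?Ri'.
have s_neq1 : s != 1.
  apply/eqP => s_1; apply: (end1 s_1); apply: (at1 i' o') => //.
  by rewrite -eN s_1 nsq1 // ?Ro ?Ro'.
have t_neq0 : t != 0.
  apply/eqP => t0; apply: (start0 _ t0); apply: (at0 i o) => //.
  by rewrite eN t0 nsq0 // ?Ri ?Ri'.
have t_neq1 : t != 1.
  apply/eqP => t_1; apply: (end1 _ t_1); apply: (at1 i o) => //.
  by rewrite eN t_1 nsq1 // ?Ro ?Ro'.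
exists (s, t); split => //=.
- by case/andP: s01 => h0 h1; rewrite !lt_neqAle h0 h1 eq_sym s_neq0 s_neq1.
- by case/andP: t01 => h0 h1; rewrite !lt_neqAle h0 h1 eq_sym t_neq0 t_neq1.
have [_ [X1 Y1]] := has_angle_norm (a1 _ s01); have [_ [X2 Y2]] := has_angle_norm (a2 _ t01).
rewrite -/(nsq i o s) in X1 Y1; rewrite -/(nsq i' o' t) -eN -eT in X2 Y2.
rewrite /point X1 Y1 X2 Y2 /T.
by rewrite cosD_int2pi sinD_int2pi.
Qed.

Lemma spokes_meet i o i' o' (ks : seq int) : inner i -> ~~ inner o -> inner i' -> ~~ inner o' ->
  uniq ks -> (forall k, k \in ks -> reversed i o i' o' k) ->
  exists ps : seq (R * R), [/\ uniq ps, size ps = size ks &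
    forall p, p \in ps -> curve_interior D [set i; o]%SET p /\ curve_interior D [set i';
      o']%SET p].
Proof.
move=> ii oo ii' oo' uks rev.
have io : i != o by apply: contraNneq oo => <-.
have io' : i' != o' by apply: contraNneq oo' => <-.
have /choice[q qP] : forall k : int, exists p : R * R, k \in ks -> [/\ 0 < p.1 < 1, 0 < p.2 < 1,
    point i o p.1 = point i' o' p.2 & lift i o p.1 + k%:~R * (pi *+ 2) = lift i' o' p.2].
  move=> k; have [kin|kn] := boolP (k \in ks); last by exists (0, 0).
  by have [p pP] := reversed_meet ii oo ii' oo' (rev k kin); exists p.
have weak (t : R) : 0 < t < 1 -> 0 <= t <= 1 by case/andP => *; rewrite !ltW.
exists [seq point i o (q k).1 | k <- ks]; split; last 2 first.
- by rewrite size_map.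
- move=> p /mapP[k kin ->]; have [h1 h2 E _] := qP k kin; split; first exact: point_interior.
  by rewrite E; apply: point_interior.
rewrite map_inj_in_uniq // => k l kin lin.
have [hk1 hk2 Ek Lk] := qP k kin; have [hl1 hl2 El Ll] := qP l lin => E.
have e1 := point_inj io (weak _ hk1) (weak _ hl1) E.
rewrite Ek El in E; have e2 := point_inj io' (weak _ hk2) (weak _ hl2) E.
have p0 : (pi : R) *+ 2 != 0 by rewrite gt_eqF // pmulrn_lgt0 // pi_gt0.
by move: Lk; rewrite e1 e2 -Ll => /addrI /(mulIf p0) /intr_inj.
Qed.

End Paths.
End CylindricalDrawing.

Section IntRange.
Local Open Scope classical_set_scope.
Local Open Scope ring_scope.

Definition int_range (m : int) (l : nat) : seq int := [seq m + Posz i | i <- iota 0 l].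

Lemma int_range_uniq m l : uniq (int_range m l).
Proof. by rewrite map_inj_uniq ?iota_uniq // => i j /addrI []. Qed.

Lemma size_int_range m l : size (int_range m l) = l.
Proof. by rewrite size_map size_iota. Qed.

Lemma mem_int_range m l k : (k \in int_range m l) = (m <= k < m + Posz l).
Proof.
apply/mapP/idP => [[i]|kml]; first by rewrite mem_iota => il ->; lia.
by exists (absz (k - m)); [rewrite mem_iota; lia|lia].
Qed.

Lemma spoke_range (a b : nat) (x y : int) : exists ks : seq int,
  [/\ uniq ks, size ks = spoke_crossings a x b y & forall k, k \in ks ->
    ~~ ((k + x - y == 0) && (a == b)) /\
    (k <= 0) (+) ((k + x - y < 0) || (k + x - y == 0) && (a < b)%N)].
Proof.
rewrite /spoke_crossings; case: (ltngtP a b) => ab.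
- have [d0|d0] := lerP (y - x) 0.
    exists (int_range (y - x + 1)%R (absz (y - x)%R)); split.
    + exact: int_range_uniq.
    + by rewrite size_int_range subr0.
    + by move=> k; rewrite mem_int_range; lia.
  exists (int_range 1%R (absz (y - x)%R)); split.
  + exact: int_range_uniq.
  + by rewrite size_int_range subr0.
  + by move=> k; rewrite mem_int_range; lia.
- have [d0|d0] := lerP (y - x - 1) 0.
    exists (int_range (y - x)%R (absz (y - x - 1)%R)); split.
    + exact: int_range_uniq.
    + exact: size_int_range.
    + by move=> k; rewrite mem_int_range; lia.
  exists (int_range 1%R (absz (y - x - 1)%R)); split.
  + exact: int_range_uniq.
  + exact: size_int_range.
  + by move=> k; rewrite mem_int_range; lia.
have [d0|d0] := lerP (y - x) 0.
  exists (int_range (y - x + 1)%R (absz (y - x)%R)); split.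
  + exact: int_range_uniq.
  + exact: size_int_range.
  + by move=> k; rewrite mem_int_range; lia.
exists (int_range 1%R (absz (y - x - 1)%R)); split.
+ exact: int_range_uniq.
+ exact: size_int_range.
+ by move=> k; rewrite mem_int_range; lia.
Qed.

End IntRange.

Section CountCrossings.
Local Open Scope classical_set_scope.
Local Open Scope ring_scope.
Variables (R : realType) (n : nat) (D : drawing R (complete_graph n)).
Hypothesis fin : finite_set (crossings D).

Local Notation cross_set := (finmap.enum_fset (fset_set (crossings D))).

Definition num_crossings (e f : {set 'I_n}) : nat :=
  (\sum_(z <- cross_set | z.1 == [set e; f]%SET) 1)%N.

Lemma num_crossingsC e f : num_crossings e f = num_crossings f e.
Proof. by rewrite /num_crossings finset.setUC. Qed.

Lemma num_crossings_ge e f (ps : seq (R * R)) : e \in edges (complete_graph n) ->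
  f \in edges (complete_graph n) -> e != f -> uniq ps ->
  (forall p, p \in ps -> curve_interior D e p /\ curve_interior D f p) ->
  (size ps <= num_crossings e f)%N.
Proof.
move=> ee ff ef ups psP; rewrite /num_crossings sum1_count -size_filter.
rewrite -(size_map (fun p => ([set e; f]%SET, p))); apply: uniq_leq_size.
  by rewrite map_inj_uniq // => p q [].
move=> z /mapP[p pin ->]; rewrite mem_filter eqxx /= in_fset_set // inE.
by exists e, f; split => //; apply: psP.
Qed.

Lemma num_crossings_gt0 (u v u' v' : 'I_n) p : u != v -> u' != v' ->
  ([set u; v] :&: [set u'; v'])%SET = finset.set0 ->
  curve D [set u; v]%SET p -> curve D [set u'; v']%SET p ->
  (0 < num_crossings [set u; v]%SET [set u'; v']%SET)%N.
Proof.
move=> uv uv' dis cp cp'; have e1 := complete_edge uv; have e2 := complete_edge uv'.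
apply: (@num_crossings_ge _ _ [:: p]) => //.
  apply/eqP => E; move: dis; rewrite E finset.setIid => /setP/(_ u').
  by rewrite !inE eqxx.
move=> q; rewrite inE => /eqP ->; split; split=> // -[w /= win wp].
  apply: (curve_avoid (d := D) e2 (w := w)); rewrite ?wp //; apply/negP => wf.
  by move/setP/(_ w) : dis; rewrite finset.in_setI win wf inE.
apply: (curve_avoid (d := D) e1 (w := w)); rewrite ?wp //; apply/negP => wf.
by move/setP/(_ w) : dis; rewrite finset.in_setI win wf inE.
Qed.

Lemma sum_num_crossings (m : nat) (E : 'I_m * 'I_m -> {set 'I_n}) :
  (forall e f : 'I_m * 'I_m, (e.1 < e.2)%N -> (f.1 < f.2)%N -> E e = E f -> e = f) ->
  (\sum_(e : 'I_m * 'I_m | (e.1 < e.2)%N) \sum_(f : 'I_m * 'I_m | (f.1 < f.2)%N)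
    (if f == e then 0 else num_crossings (E e) (E f)) <= 2 * size cross_set)%N.
Proof.
move=> Einj; rewrite /num_crossings.
pose edge := ('I_m * 'I_m)%type.
pose hit (z : {set {set 'I_n}}) (p : edge * edge) :=
  [&& (p.1.1 < p.1.2)%N, (p.2.1 < p.2.2)%N, p.2 != p.1 & z == [set E p.1; E p.2]%SET].
have -> : (\sum_(e : edge | (e.1 < e.2)%N) \sum_(f : edge | (f.1 < f.2)%N)
    (if f == e then 0 else \sum_(z <- cross_set | z.1 == [set E e; E f]%SET) 1) =
  \sum_(z <- cross_set) \sum_(p | hit z.1 p) 1)%N.
  rewrite pair_big big_mkcond /= [RHS](eq_bigr (fun z => \sum_p (hit z.1 p : nat)))%N;
    last first.
    by move=> z _; rewrite big_mkcond; apply: eq_bigr => p _; case: (hit _ _).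
  rewrite exchange_big; apply: eq_bigr => p _.
  rewrite /hit; case: (_ < _)%N => /=; last by rewrite big1.
  case: (_ < _)%N => /=; last by rewrite big1.
  case: (p.2 == p.1) => /=; first by rewrite big1.
  by rewrite big_mkcond; apply: eq_bigr => z _; case: (_ == _).
rewrite -sum1_size big_distrr; apply: leq_sum => z _; rewrite sum1_card /=.
have [[p hp]|none] := pselect (exists p, hit z.1 p); last first.
  by rewrite eq_card0 // => p; apply/negbTE/negP => hp; apply: none; exists p.
apply: leq_trans (card_size [:: p; (p.2, p.1)]); apply: subset_leq_card;
  apply/fintype.subsetP => q.
rewrite !inE; case/and4P: hp => p1 p2 pp /eqP zp /and4P[q1 q2 qq /eqP zq].
have inE1 : E q.1 \in [set E p.1; E p.2]%SET by rewrite -zp zq !inE eqxx.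
have inE2 : E q.2 \in [set E p.1; E p.2]%SET by rewrite -zp zq !inE eqxx orbT.
have cases (e : edge) : (e.1 < e.2)%N -> E e \in [set E p.1; E p.2]%SET -> e = p.1 \/ e = p.2.
  by move=> ee /set2P[] /Einj H; [left|right]; apply: H.
rewrite [q]surjective_pairing [p]surjective_pairing !xpair_eqE /=.
by case: (cases _ q1 inE1) qq => ->; case: (cases _ q2 inE2) => ->; rewrite ?eqxx ?orbT.
Qed.

End CountCrossings.

(* Keeps only the hypotheses on natural numbers, for speed. *)
Ltac nat_lia :=
  repeat match goal with
  | [H : is_true (leq _ _) |- _] => revert H
  | [H : is_true (orb _ _) |- _] => revert H
  | [H : is_true (andb _ _) |- _] => revert H
  end; clear; lia.

Section Assembly.
Local Open Scope classical_set_scope.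
Local Open Scope ring_scope.
Variables (R : realType) (n : nat) (D : drawing R (complete_graph n)).
Hypothesis fin : finite_set (crossings D).
Variables (c : R * R) (r1 r2 : R).
Hypotheses (r1_gt0 : 0 < r1) (r1_lt_r2 : r1 < r2).
Hypothesis vertex_on_circle : forall v, (circle c r1 `|` circle c r2) (vpoint D v).
Hypothesis curve_off_circles : forall e, e \in edges (complete_graph n) ->
  curve D e `&` (circle c r1 `|` circle c r2) `<=` endvertices D e.
Variables PX PY : 'I_n -> 'I_n -> R -> R.
Hypothesis P_path : forall u v, u != v -> is_path D c u v (PX u v) (PY u v).
Variables (ang : 'I_n -> R) (cut : R).
Hypothesis ang_bound : forall v, 0 <= ang v < pi *+ 2.
Hypothesis ang_pos : forall v, has_angle (xpos D c v) (ypos D c v) (ang v).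
Hypothesis cut_lt0 : cut < 0.
Hypothesis ang_cut : forall v, ang v < cut + pi *+ 2.
Variables (lift : 'I_n -> 'I_n -> R -> R) (turns : 'I_n -> 'I_n -> int).
Local Notation inner := (inner D c r1).
Hypothesis lift_path : forall i o, inner i -> ~~ inner o -> [/\ continuous (lift i o),
  lift i o 0 = ang i, lift i o 1 = ang o + (turns i o)%:~R * (pi *+ 2) &
  forall t, 0 <= t <= 1 -> has_angle (PX i o t) (PY i o t) (lift i o t)].

Variables (side : bool) (M O : seq 'I_n) (v0 : 'I_n).
Hypothesis uniq_MO : uniq (M ++ O).
Hypothesis size_MO : size (M ++ O) = n.
Hypothesis size_O : (size O <= size M)%N.
Hypothesis side_M : forall v, v \in M -> inner v = side.
Hypothesis side_O : forall v, v \in O -> inner v = ~~ side.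
Hypothesis sorted_M : forall i j, (i < j < size M)%N -> ang (nth v0 M i) < ang (nth v0 M j).
Hypothesis sorted_O : forall i j, (i < j < size O)%N -> ang (nth v0 O i) < ang (nth v0 O j).

Local Notation s := (size M).
Definition vert k := nth v0 (M ++ O) k.

Lemma vert_inj i j : (i < n)%N -> (j < n)%N -> vert i = vert j -> i = j.
Proof.
by move=> i_n j_n /eqP; rewrite /vert nth_uniq ?size_MO // => /eqP.
Qed.

Lemma vert_neq i j : (i < n)%N -> (j < n)%N -> i != j -> vert i != vert j.
Proof. by move=> i_n j_n; apply: contraNneq => /vert_inj ->. Qed.

Lemma vert_M i : (i < s)%N -> inner (vert i) = side.
Proof. by move=> i_s; rewrite /vert nth_cat i_s; apply/side_M/mem_nth. Qed.

Lemma s_le_n : (s <= n)%N.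
Proof. by rewrite -[n in (_ <= n)%N]size_MO size_cat leq_addr. Qed.

Lemma vert_O i : (s <= i < n)%N -> inner (vert i) = ~~ side.
Proof.
move=> /andP[si i_n]; rewrite /vert nth_cat ltnNge si /=; apply/side_O/mem_nth.
by rewrite ltn_subLR // -size_cat size_MO.
Qed.

Lemma vert_lt_M i j : (i < j)%N -> (j < s)%N -> ang (vert i) < ang (vert j).
Proof.
by move=> ij js; rewrite /vert !nth_cat js (ltn_trans ij js); apply: sorted_M; rewrite ij.
Qed.

Lemma vert_lt_O i j : (s <= i)%N -> (i < j)%N -> (j < n)%N -> ang (vert i) < ang (vert j).
Proof.
move=> si ij j_n; rewrite /vert !nth_cat !ltnNge si (leq_trans si (ltnW ij)) /=.
apply: sorted_O; rewrite ltn_sub2rE // ij ltn_subLR ?(leq_trans si (ltnW ij)) //.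
by rewrite -size_cat size_MO.
Qed.

Local Notation edge i j := ([set vert i; vert j]%SET).
Definition ann i j := in_annulus r1 r2 PX PY (vert i) (vert j).
Definition arc_crossings i j k l := num_crossings D (edge i j) (edge k l).

Lemma curve_point u v t : u != v -> curve D [set u; v]%SET (point c PX PY u v t).
Proof. by move=> /P_path[_ _ _ inc _]; apply: inc. Qed.

Lemma arc_crossings_gt0 i j k l p : (i < n)%N -> (j < n)%N -> (k < n)%N -> (l < n)%N ->
  uniq [:: i; j; k; l] -> curve D (edge i j) p -> curve D (edge k l) p ->
    (0 < arc_crossings i j k l)%N.
Proof.
move=> i_n j_n k_n l_n /=; rewrite !inE !negb_or => /and4P[/and3P[ij ik il] /andP[jk jl] kl _].
apply: num_crossings_gt0; rewrite // ?vert_neq //; apply/setP => v; rewrite !inE.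
apply/negbTE/negP => /andP[/orP[]/eqP -> /orP[]/eqP /vert_inj E].
- by move/eqP: ik; apply; apply: E.
- by move/eqP: il; apply; apply: E.
- by move/eqP: jk; apply; apply: E.
- by move/eqP: jl; apply; apply: E.
Qed.

Lemma ang_ltE i j : ang (vert i) < ang (vert j) -> (ang (vert j) < ang (vert i)) = false.
Proof. by move=> ij; apply/negbTE; rewrite -leNgt ltW. Qed.

Lemma assembly_same_side a b d e : (a < b)%N -> (b < d)%N -> (d < e)%N -> (e < n)%N ->
  (e < s)%N || (s <= a)%N -> ann a d = ann b e -> (0 < arc_crossings a d b e)%N.
Proof.
move=> ab bd de en cls annE.
have [a_n b_n d_n] : [/\ (a < n)%N, (b < n)%N & (d < n)%N] by split; nat_lia.
have [s1 s2 s3] : [/\ inner (vert a) = inner (vert d), inner (vert a) = inner (vert b) &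
    inner (vert b) = inner (vert e)].
  case/orP: cls => h; first by rewrite !vert_M //; nat_lia.
  by rewrite !vert_O //; nat_lia.
have lt i j : (a <= i)%N -> (i < j)%N -> (j <= e)%N -> ang (vert i) < ang (vert j).
  move=> ai ij je; case/orP: cls => h; first by apply: vert_lt_M; nat_lia.
  by apply: vert_lt_O; nat_lia.
have ad : vert a != vert d by apply: vert_neq; nat_lia.
have be : vert b != vert e by apply: vert_neq; nat_lia.
have l1 : ang (vert a) < ang (vert b) by apply: lt; nat_lia.
have l2 : ang (vert a) < ang (vert e) by apply: lt; nat_lia.
have l3 : ang (vert b) < ang (vert d) by apply: lt; nat_lia.
have l4 : ang (vert d) < ang (vert e) by apply: lt; nat_lia.
have [|x [y E]] := same_side_meet r1_gt0 r1_lt_r2 vertex_on_circle curve_off_circles P_path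
  ang_bound ang_pos cut_lt0 ang_cut ad be s1 s2 s3 annE.
  by rewrite l1 l2 l4 (ang_ltE l3).
apply: (@arc_crossings_gt0 _ _ _ _ (point c PX PY (vert a) (vert d) x)) => //.
- by rewrite /= !inE; nat_lia.
- exact: curve_point.
- by rewrite E; apply: curve_point.
Qed.

Lemma assembly_separated a b e d u v : (a < n)%N -> (b < n)%N -> (e < n)%N -> (d < n)%N ->
  (u < n)%N -> (v < n)%N -> uniq [:: a; b; e; u] -> uniq [:: a; b; d; v] ->
  inner (vert a) = inner (vert b) -> inner (vert e) = inner (vert a) ->
  inner (vert d) = inner (vert a) -> inner (vert u) != inner (vert a) ->
  inner (vert v) != inner (vert a) -> ann a b ->
  ang (vert a) < ang (vert e) -> ang (vert e) < ang (vert b) ->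
  (ang (vert d) < ang (vert a)) || (ang (vert b) < ang (vert d)) ->
  (0 < arc_crossings a b e u + arc_crossings a b d v)%N.
Proof.
move=> a_n b_n e_n d_n u_n v_n uq1 uq2 ab ea da ua va annab ae eb out.
have abn : vert a != vert b.
  by apply: vert_neq => //; move: uq1; rewrite /= !inE; case: eqP.
have eu : vert e != vert u by apply: contraNneq ua => <-; rewrite ea.
have vd : vert v != vert d by apply: contraNneq va => ->; rewrite da.
have ltab := lt_trans ae eb.
have par : (ang (vert a) < ang (vert e)) (+) (ang (vert a) < ang (vert d)) (+)
    (ang (vert b) < ang (vert e)) (+) (ang (vert b) < ang (vert d)).
  rewrite ae (ang_ltE eb); case/orP: out => out.
    by rewrite (ang_ltE out) (ang_ltE (lt_trans out ltab)).
  by rewrite out (lt_trans ltab out).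
have [[x [y E]]|[x [y E]]] := separated_meet r1_gt0 r1_lt_r2 vertex_on_circle curve_off_circles
    P_path ang_bound ang_pos cut_lt0 ang_cut abn ab ea da ua va annab par.
  rewrite addn_gt0 (@arc_crossings_gt0 _ _ _ _ (point c PX PY (vert a) (vert b) x)) //.
    exact: curve_point.
  by rewrite E; apply: curve_point.
rewrite addn_gt0 orbC (@arc_crossings_gt0 _ _ _ _ (point c PX PY (vert a) (vert b) x)) //.
  exact: curve_point.
by rewrite E finset.setUC; apply: curve_point.
Qed.

Lemma arc_crossings_swap a b u e : arc_crossings a b u e = arc_crossings a b e u.
Proof. by rewrite /arc_crossings [edge u e]finset.setUC. Qed.

Definition winding k l := if side then turns (vert k) (vert l) else - turns (vert l) (vert k).

Lemma spoke_count i o i' o' k l k' l' (ks : seq int) : (k < n)%N -> (l < n)%N ->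
  (k' < n)%N -> (l' < n)%N -> edge k l = [set i; o]%SET -> edge k' l' = [set i'; o']%SET ->
  edge k l != edge k' l' ->
  inner i -> ~~ inner o -> inner i' -> ~~ inner o' -> uniq ks ->
  (forall z, z \in ks -> reversed ang turns i o i' o' z) ->
    (size ks <= arc_crossings k l k' l')%N.
Proof.
move=> k_n l_n k'_n l'_n e1 e2 ne ii oo ii' oo' uks rev.
have io : i != o by apply: contraNneq oo => <-.
have io' : i' != o' by apply: contraNneq oo' => <-.
have [ps [ups <- psP]] := spokes_meet r1_gt0 r1_lt_r2 vertex_on_circle curve_off_circles
  P_path ang_bound lift_path ii oo ii' oo' uks rev.
rewrite /arc_crossings e1 e2; apply: num_crossings_ge => //; try exact: complete_edge.
by rewrite -e1 -e2.
Qed.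

Lemma assembly_spokes u v a b : (u < v)%N -> (v < s)%N -> (s <= a < n)%N -> (s <= b < n)%N ->
  (spoke_crossings a (winding u a) b (winding v b) <= arc_crossings u a v b)%N.
Proof.
move=> uv vs /andP[sa a_n] /andP[sb b_n].
have us := ltn_trans uv vs; have sn := s_le_n.
have un := leq_trans us sn; have vn := leq_trans vs sn.
have [ks [uks sks ksP]] := spoke_range a b (winding u a) (winding v b).
have luv := vert_lt_M uv vs.
have ltab : (ang (vert a) < ang (vert b)) = (a < b)%N.
  have [ab|ba|->] := ltngtP a b; last by rewrite ltxx.
    by apply: vert_lt_O.
  by apply: ang_ltE; apply: vert_lt_O.
have eqab : (ang (vert a) == ang (vert b)) = (a == b).
  have [ab|ba|->] := ltngtP a b; last by rewrite eqxx.
    by rewrite lt_eqF //; apply: vert_lt_O.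
  by rewrite gt_eqF //; apply: vert_lt_O.
have ne : edge u a != edge v b.
  apply/eqP => /setP/(_ (vert u)); rewrite !inE eqxx /= => /esym/orP[]/eqP /vert_inj E.
    by move: uv; rewrite -E ?ltnn.
  by move: us; rewrite E // ltnNge sb.
have [Iu Iv] := (vert_M us, vert_M vs).
have Ia : inner (vert a) = ~~ side by apply: vert_O; rewrite sa.
have Ib : inner (vert b) = ~~ side by apply: vert_O; rewrite sb.
rewrite -sks; case: (boolP side) => sd.
  apply: (@spoke_count (vert u) (vert a) (vert v) (vert b)) => //;
    rewrite ?Iu ?Iv ?Ia ?Ib ?sd //.
  move=> z /ksP; rewrite /winding sd /reversed => -[h1 h2].
  rewrite luv (lt_eqF luv) andbF andbT ltab eqab; split => //.
  by rewrite orbC -le_eqVlt.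
rewrite -(size_map (fun z => z + winding u a - winding v b)).
apply: (@spoke_count (vert a) (vert u) (vert b) (vert v)) => //;
  rewrite ?Iu ?Iv ?Ia ?Ib ?sd //; try exact: finset.setUC.
  by rewrite map_inj_uniq // => x y; rewrite -!addrA => /addIr.
move=> y /mapP[z /ksP + ->]; rewrite /winding (negbTE sd) /reversed.
set x1 := turns _ _; set x2 := turns _ _ => -[h1 h2].
have -> : z + - x1 - - x2 + x1 - x2 = z by ring.
rewrite luv (lt_eqF luv) andbF andbT ltab eqab; split => //.
by rewrite addbC orbC -le_eqVlt.
Qed.

Theorem assembled_bound : (Z n <= size (finmap.enum_fset (fset_set (crossings D))))%N.
Proof.
rewrite -(@leq_pmul2l 2) //.
have Einj (e f : 'I_n * 'I_n) : (e.1 < e.2)%N -> (f.1 < f.2)%N ->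
  edge e.1 e.2 = edge f.1 f.2 -> e = f.
  case: e f => [a b] [k l] /= ab kl E.
  have inj (i j : 'I_n) : vert i = vert j -> i = j.
    by move/(vert_inj (ltn_ord i) (ltn_ord j))/val_inj.
  have : vert a \in edge k l by rewrite -E !inE eqxx.
  have : vert b \in edge k l by rewrite -E !inE eqxx orbT.
  rewrite !inE => /orP[]/eqP/inj eb /orP[]/eqP/inj ea; rewrite ea eb // in ab *.
  - by rewrite ltnn in ab.
  - by have := ltn_trans ab kl; rewrite ltnn.
  - by rewrite ltnn in ab.
apply: leq_trans _ (@sum_num_crossings R n D n (fun e => edge e.1 e.2) Einj).
have sn := s_le_n.
apply: (@cylindrical_count n s ann winding arc_crossings sn).
- by rewrite -addnn -{1}size_MO size_cat leq_add2l.
- by move=> i j k l; apply: num_crossingsC.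
- exact: assembly_same_side.
- move=> a b e d u v ae eb bs ds out /andP[su un] /andP[sv vn] annab.
  have as_ : (a < s)%N by nat_lia.
  have es : (e < s)%N by nat_lia.
  have Ou : inner (vert u) = ~~ side by apply: vert_O; rewrite su.
  have Ov : inner (vert v) = ~~ side by apply: vert_O; rewrite sv.
  apply: assembly_separated => //; rewrite ?(vert_M as_) ?(vert_M bs) ?(vert_M es)
    ?(vert_M ds) ?Ou ?Ov //;
    try nat_lia; try by case: side.
  + by rewrite /= !inE; nat_lia.
  + by rewrite /= !inE; nat_lia.
  + exact: vert_lt_M.
  + exact: vert_lt_M.
  + by case/orP: out => h; apply/orP; [left|right]; apply: vert_lt_M.
- move=> a b e d u v sa ae eb b_n /andP[sd dn] out us vs annab.
  rewrite (arc_crossings_swap a b u e) (arc_crossings_swap a b v d).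
  have [a_n e_n] : (a < n)%N /\ (e < n)%N by split; nat_lia.
  have Oa : inner (vert a) = ~~ side by apply: vert_O; rewrite sa.
  have Ob : inner (vert b) = ~~ side by apply: vert_O; rewrite b_n; nat_lia.
  have Oe : inner (vert e) = ~~ side by apply: vert_O; rewrite e_n; nat_lia.
  have Od : inner (vert d) = ~~ side by apply: vert_O; rewrite sd.
  apply: assembly_separated => //; rewrite ?(vert_M us) ?(vert_M vs) ?Oa ?Ob ?Oe ?Od //;
    try nat_lia; try by case: side.
  + by rewrite /= !inE; nat_lia.
  + by rewrite /= !inE; nat_lia.
  + by apply: vert_lt_O.
  + by apply: vert_lt_O => //; nat_lia.
  + by case/orP: out => h; apply/orP; [left|right]; apply: vert_lt_O => //; nat_lia.
- exact: assembly_spokes.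
Qed.

End Assembly.

Section Existence.
Local Open Scope classical_set_scope.
Local Open Scope ring_scope.
Variables (R : realType) (n : nat) (D : drawing R (complete_graph n)).
Variables (c : R * R) (r1 r2 : R).
Hypotheses (r1_gt0 : 0 < r1) (r1_lt_r2 : r1 < r2).
Hypothesis vertex_on_circle : forall v, (circle c r1 `|` circle c r2) (vpoint D v).
Hypothesis curve_off_circles : forall e, e \in edges (complete_graph n) ->
  curve D e `&` (circle c r1 `|` circle c r2) `<=` endvertices D e.

Local Notation inner := (inner D c r1).

Lemma cut_exists (ang : 'I_n -> R) : (forall v, 0 <= ang v < pi *+ 2) ->
  exists2 cut : R, cut < 0 & forall v, ang v < cut + pi *+ 2.
Proof.
move=> ab; have p0 : 0 < (pi : R) *+ 2 by rewrite pmulrn_lgt0 ?pi_gt0.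
pose m := \big[Num.max/0]_(v : 'I_n) ang v.
have mp : m < pi *+ 2.
  by rewrite /m; elim/big_ind: _ => // [x y|v _]; [rewrite gt_max => -> ->|case/andP: (ab v)].
exists ((m - pi *+ 2) / 2); first by rewrite mulr2n in mp *; lra.
move=> v; have : ang v <= m by apply: le_bigmax_cond.
by rewrite mulr2n in mp *; lra.
Qed.

Lemma lift_exists PX PY (ang : 'I_n -> R) :
  (forall u v, u != v -> is_path D c u v (PX u v) (PY u v)) ->
  (forall v, has_angle (xpos D c v) (ypos D c v) (ang v)) ->
  forall i o, inner i -> ~~ inner o -> exists p : (R -> R) * int, [/\ continuous p.1,
    p.1 0 = ang i, p.1 1 = ang o + p.2%:~R * (pi *+ 2) &
    forall t, 0 <= t <= 1 -> has_angle (PX i o t) (PY i o t) (p.1 t)].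
Proof.
move=> P_path ang_pos i o ii oo.
have iio : inner i != inner o by rewrite ii (negbTE oo).
have io : i != o by apply: contraNneq iio => ->.
have [[cX cY] [[X0 Y0] [X1 Y1]] cl _ _] := P_path i o io.
have [|| th [cth th0 tha]] := @polar_lift R (PX i o) (PY i o) (ang i) cX cY.
- move=> t; have [-> ->] := cl t.
  have := nsq_spoke_le r1_gt0 r1_lt_r2 vertex_on_circle curve_off_circles P_path iio (clamp01 t).
  by case/andP => h _; apply: lt_le_trans h; rewrite exprn_gt0.
- by rewrite X0 Y0.
have := tha 1; rewrite lexx ler01 X1 Y1 => /(_ isT) /(has_angle_inj (ang_pos o)) [k E].
by exists (th, k).
Qed.

Lemma angle_exists v : exists a : R, 0 <= a < pi *+ 2 /\ has_angle (xpos D c v) (ypos D c v) a.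
Proof.
have [|a a1 a2] := @has_angle_exists R (xpos D c v) (ypos D c v); last by exists a.
by rewrite (pos_norm vertex_on_circle) exprn_gt0 // (radius_gt0 _ _ r1_gt0 r1_lt_r2).
Qed.

Lemma angle_inj (ang : 'I_n -> R) u v :
  (forall v, has_angle (xpos D c v) (ypos D c v) (ang v)) ->
  inner u = inner v -> ang u = ang v -> u = v.
Proof.
move=> ang_pos iuv auv; apply: (@vpoint_inj _ _ D).
have ruv : radius D c r1 r2 u = radius D c r1 r2 v by rewrite /radius iuv.
have := xposE r1_gt0 r1_lt_r2 vertex_on_circle ang_pos u.
have := yposE r1_gt0 r1_lt_r2 vertex_on_circle ang_pos u.
rewrite ruv auv -(xposE r1_gt0 r1_lt_r2 vertex_on_circle ang_pos)
  -(yposE r1_gt0 r1_lt_r2 vertex_on_circle ang_pos).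
rewrite /xpos /ypos => /addIr e2 /addIr e1.
by rewrite [LHS]surjective_pairing e1 e2 -surjective_pairing.
Qed.

Lemma crossings_bound : finite_set (crossings D) ->
  (Z n <= size (finmap.enum_fset (fset_set (crossings D))))%N.
Proof.
move=> fin; case: (posnP n) => [n0|n_gt0]; first by have -> : Z n = 0%N by rewrite n0.
have /choice[P PP] : forall uv : 'I_n * 'I_n, exists p : (R -> R) * (R -> R),
    uv.1 != uv.2 -> is_path D c uv.1 uv.2 p.1 p.2.
  move=> [u v]; have [->|uv] := eqVneq u v; first by exists (id, id) => /eqP[].
  by have [p pP] := path_exists D c uv; exists p.
pose PX u v := (P (u, v)).1; pose PY u v := (P (u, v)).2.
have P_path u v : u != v -> is_path D c u v (PX u v) (PY u v) by exact: (PP (u, v)).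
have /choice[ang angP] := angle_exists.
have ang_bound v : 0 <= ang v < pi *+ 2 by case: (angP v).
have ang_pos v : has_angle (xpos D c v) (ypos D c v) (ang v) by case: (angP v).
have [cut cut_lt0 ang_cut] := cut_exists ang_bound.
have /choice[L LP] : forall io : 'I_n * 'I_n, exists p : (R -> R) * int,
    inner io.1 -> ~~ inner io.2 -> [/\ continuous p.1,
    p.1 0 = ang io.1, p.1 1 = ang io.2 + p.2%:~R * (pi *+ 2) &
    forall t, 0 <= t <= 1 -> has_angle (PX io.1 io.2 t) (PY io.1 io.2 t) (p.1 t)].
  move=> [i o]; have [ii|ni] := boolP (inner i); last by exists (id, 0).
  have [no|oo] := boolP (inner o); first by exists (id, 0).
  by have [p pP] := lift_exists P_path ang_pos ii oo; exists p.
pose le_ang : rel 'I_n := fun u v => ang u <= ang v.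
pose sorted_class b := sort le_ang [seq v <- enum 'I_n | inner v == b].
have mem_class b v : (v \in sorted_class b) = (inner v == b).
  by rewrite mem_sort mem_filter mem_enum andbT.
have uniq_class b : uniq (sorted_class b) by rewrite sort_uniq filter_uniq // enum_uniq.
have lt_class b v0 i j : (i < j < size (sorted_class b))%N ->
    ang (nth v0 (sorted_class b) i) < ang (nth v0 (sorted_class b) j).
  move=> /andP[ij jsz]; have isz := ltn_trans ij jsz.
  have tr : transitive le_ang by move=> y x z; apply: le_trans.
  have tot : total le_ang by move=> x y; apply: le_total.
  have := sorted_ltn_nth tr v0 (sort_sorted tot _) => /(_ _ i j isz jsz ij).
  rewrite /le_ang le_eqVlt => /orP[/eqP E|//]; exfalso.
  have inb k : (k < size (sorted_class b))%N -> inner (nth v0 (sorted_class b) k) = b.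
    by move=> ksz; have := mem_nth v0 ksz; rewrite mem_class => /eqP.
  have /eqP := angle_inj ang_pos (etrans (inb i isz) (esym (inb j jsz))) E.
  by rewrite nth_uniq // ltn_eqF.
have uniq_cat b : uniq (sorted_class b ++ sorted_class (~~ b)).
  rewrite cat_uniq !uniq_class andbT /=; apply/hasPn => v; rewrite !mem_class.
  by move=> /eqP ->; case: (b).
have size_cat b : size (sorted_class b ++ sorted_class (~~ b)) = n.
  rewrite -[RHS]size_enum_ord; apply: perm_size; apply: uniq_perm => //; first exact: enum_uniq.
  by move=> v; rewrite mem_cat !mem_class mem_enum; case: (inner v); case: (b).
have main b : (size (sorted_class (~~ b)) <= size (sorted_class b))%N ->
    (Z n <= size (finmap.enum_fset (fset_set (crossings D))))%N.
  move=> szb; apply: (@assembled_bound R n D fin c r1 r2 r1_gt0 r1_lt_r2 vertex_on_circle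
    curve_off_circles PX PY P_path ang cut ang_bound ang_pos cut_lt0 ang_cut
    (fun i o => (L (i, o)).1) (fun i o => (L (i, o)).2) _ b (sorted_class b)
    (sorted_class (~~ b)) (Ordinal n_gt0) (uniq_cat b) (size_cat b) szb).
  - by move=> i o; apply: (LP (i, o)).
  - by move=> v; rewrite mem_class => /eqP.
  - by move=> v; rewrite mem_class => /eqP.
  - exact: lt_class.
  - exact: lt_class.
by have [/(main true)|/ltnW] := leqP (size (sorted_class (~~ true))) (size (sorted_class true));
  last exact: (main false).
Qed.

End Existence.

Local Open Scope classical_set_scope.
Local Open Scope card_scope.

Theorem theorem2 (R : realType) (n : nat) (D : drawing R (complete_graph n)) :
  cylindrical D -> `I_(Z n) #<= crossings D.
Proof.
move=> [c [r1 [r2 [r1_gt0 r1_lt_r2 onC offC]]]].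
have [fin|inf] := pselect (finite_set (crossings D)).
  have le := crossings_bound r1_gt0 r1_lt_r2 onC offC fin.
  have [m Am] := proj1 (finite_setP _) fin.
  by rewrite (card_le_eqr Am) card_le_II -(card_fset_set Am).
apply: card_le_trans (proj1 (infiniteP _) inf).
exact: subset_card_le.
Qed.
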